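(* Let $X,Y\subset\mathbb{R}^d$ be bounded convex open sets, $\mu\in P(X)$, $\nu\in P(Y)$. Then (i) $\displaystyle\mathcal{T}_2(\mu,\mathrm{P}^{sh}_{\le\nu})=\sup_{\psi\in\mathcal{A}_{sh}\cap C_b(Y)}\Big\{\int_X Q_2(\psi)\,d\mu-\int_Y\psi\,d\nu\Big\}$, with $Q_2(\psi)(x)=\inf_{y\in Y}\{\psi(y)+|x-y|^2\}$; (ii) $\displaystyle\mathcal{T}_2(\mathrm{P}^{sh}_{\mu\le},\nu)=\sup_{\psi\in\mathcal{A}_{sh}\cap C_b(X)}\Big\{\int_X \psi\,d\mu-\int_Y Q_{\bar2}(\psi)\,d\nu\Big\}$, with $Q_{\bar2}(\psi)(y)=\sup_{x\in X}\{\psi(x)-|x-y|^2\}$. In both, $\psi\in\mathcal{A}_{sh}\cap C_b$ may be replaced by $\psi\in\mathcal{A}_{sh}\cap\mathrm{S}_b$ (bounded measurable) without changing the value.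
   Context: A function $\psi$ on an open set $U\subset\mathbb{R}^d$ is subharmonic if it is upper semicontinuous with values in $[-\infty,\infty)$ and $\psi(x_0)\le\frac{1}{|\partial B_r(x_0)|}\int_{\partial B_r(x_0)}\psi\,d\sigma$ for every ball $B_r(x_0)$ contained in $U$. For $U$ bounded convex open and $\eta,\xi\in P(U)$, $\eta\le_{sh}\xi$ means $\int\psi\,d\eta\le\int\psi\,d\xi$ for all subharmonic $\psi\in C_b(U)$. $\mathcal{A}_{sh}$: subharmonic functions bounded from below (on the relevant domain). $\mathrm{P}^{sh}_{\le\nu}=\{\eta\in P(Y):\eta\le_{sh}\nu\}$ (subharmonic on $Y$), $\mathrm{P}^{sh}_{\mu\le}=\{\xi\in P(X):\mu\le_{sh}\xi\}$ (subharmonic on $X$). $\mathcal{T}_2(\alpha,\beta)=\inf_{\pi\in\Pi(\alpha,\beta)}\int|x-y|^2d\pi$, infimized over a cone where a cone appears. *)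

(* Defs.v *)
From HB Require Import structures.
From mathcomp Require Import all_boot all_order all_algebra.
From mathcomp Require Import all_classical all_reals all_analysis.
Set Implicit Arguments. Unset Strict Implicit. Unset Printing Implicit Defensive.
Import Order.TTheory GRing.Theory Num.Theory.
Import numFieldNormedType.Exports.
Local Open Scope classical_set_scope.
Local Open Scope ring_scope.

Section Defs.
Variables (R : realType) (d : nat).

Definition Rd := g_sigma_algebraType (@open 'rV[R]_d).

Definition eucl2 (x y : 'rV[R]_d) : R := \sum_(i < d) (x ord0 i - y ord0 i) ^+ 2.

Definition eball (x0 : 'rV[R]_d) (r : R) : set 'rV[R]_d :=
  [set y | eucl2 y x0 <= r ^+ 2].

Definition convex (U : set 'rV[R]_d) : Prop :=
  forall x y (t : R), U x -> U y -> 0 <= t -> t <= 1 ->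
    U (t *: x + (1 - t) *: y).

(* Normalized surface measure on the unit sphere of R^d: a Borel probability
   measure carried by the Euclidean unit sphere and invariant under all
   orthogonal maps (it is unique, the normalized surface measure). *)
Definition normalized_sphere_measure (s : probability Rd R) : Prop :=
  s (~` [set w : 'rV[R]_d | eucl2 w 0 = 1]) = 0%E /\
  forall M : 'M[R]_d, M *m M^T = 1%:M ->
    forall A : set Rd, measurable A ->
      s ((fun w : 'rV[R]_d => w *m M) @^-1` A) = s A.

Definition usc_on (U : set 'rV[R]_d) (psi : 'rV[R]_d -> R) : Prop :=
  forall x, U x -> forall e : R, 0 < e -> exists2 delta : R, 0 < delta &
    forall y, U y -> ball x delta y -> psi y < psi x + e.

Definition subharmonic (U : set 'rV[R]_d) (psi : 'rV[R]_d -> R) : Prop :=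
  usc_on U psi /\
  forall x0 (r : R), 0 < r -> eball x0 r `<=` U ->
    forall s : probability Rd R, normalized_sphere_measure s ->
      ((psi x0)%:E <= \int[s]_w (psi (x0 + r *: w))%:E)%E.

Definition Cb (U : set 'rV[R]_d) (psi : 'rV[R]_d -> R) : Prop :=
  {within U, continuous psi} /\ exists M : R, forall x, U x -> `|psi x| <= M.

Definition Sb (U : set 'rV[R]_d) (psi : 'rV[R]_d -> R) : Prop :=
  measurable_fun (U : set Rd) (psi : Rd -> R) /\
  exists M : R, forall x, U x -> `|psi x| <= M.

Definition prob_on (U : set 'rV[R]_d) (eta : probability Rd R) : Prop :=
  eta (~` U) = 0%E.

Definition sh_le (U : set 'rV[R]_d) (eta xi : probability Rd R) : Prop :=
  forall psi, Cb U psi -> subharmonic U psi ->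
    (\int[eta]_(x in (U : set Rd)) (psi x)%:E <=
     \int[xi]_(x in (U : set Rd)) (psi x)%:E)%E.

Definition coupling (a b : probability Rd R) (pi : probability (Rd * Rd)%type R)
  : Prop :=
  forall A : set Rd, measurable A ->
    pi (A `*` setT) = a A /\ pi (setT `*` A) = b A.

Definition T2 (a b : probability Rd R) : \bar R :=
  ereal_inf [set (\int[pi]_z (eucl2 z.1 z.2)%:E)%E | pi in coupling a b].

Definition T2_sh_below (Y : set 'rV[R]_d) (mu nu : probability Rd R) : \bar R :=
  ereal_inf [set T2 mu eta | eta in [set eta | prob_on Y eta /\ sh_le Y eta nu]].

Definition T2_sh_above (X : set 'rV[R]_d) (mu nu : probability Rd R) : \bar R :=
  ereal_inf [set T2 xi nu | xi in [set xi | prob_on X xi /\ sh_le X mu xi]].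

Definition Q2 (Y : set 'rV[R]_d) (psi : 'rV[R]_d -> R) (x : 'rV[R]_d) : R :=
  inf [set psi y + eucl2 x y | y in Y].

Definition Q2bar (X : set 'rV[R]_d) (psi : 'rV[R]_d -> R) (y : 'rV[R]_d) : R :=
  sup [set psi x - eucl2 x y | x in X].

Definition Ash (C : set 'rV[R]_d -> ('rV[R]_d -> R) -> Prop) (U : set 'rV[R]_d)
  (psi : 'rV[R]_d -> R) : Prop :=
  C U psi /\ subharmonic U psi /\ exists m : R, forall x, U x -> m <= psi x.

Definition dual_below (C : set 'rV[R]_d -> ('rV[R]_d -> R) -> Prop)
  (X Y : set 'rV[R]_d) (mu nu : probability Rd R) : \bar R :=
  ereal_sup [set (\int[mu]_(x in (X : set Rd)) (Q2 Y psi x)%:E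
                  - \int[nu]_(y in (Y : set Rd)) (psi y)%:E)%E
            | psi in Ash C Y].

Definition dual_above (C : set 'rV[R]_d -> ('rV[R]_d -> R) -> Prop)
  (X Y : set 'rV[R]_d) (mu nu : probability Rd R) : \bar R :=
  ereal_sup [set (\int[mu]_(x in (X : set Rd)) (psi x)%:E
                  - \int[nu]_(y in (Y : set Rd)) (Q2bar X psi y)%:E)%E
            | psi in Ash C X].

End Defs.

(* Main.v *)
Require Import Defs.
From HB Require Import structures.
From mathcomp Require Import all_boot all_order all_algebra.
From mathcomp Require Import all_classical all_reals all_analysis.
From mathcomp Require Import measurable_realfun ring lra.
Import Order.TTheory GRing.Theory Num.Theory.
Import numFieldNormedType.Exports.
Local Open Scope classical_set_scope.
Local Open Scope ring_scope.

(** The inequality "sup <= inf" is Kantorovich's, once the order [sh_le], defined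
    by continuous test functions, is known to control bounded subharmonic
    functions that are only upper semicontinuous. On a convex set [U], given
    uniformly bounded subharmonic functions [b i], put
      [phi_k x = sup (b i (t x + (1 - t) z) - k (1 - t))]
    over all [i], [0 <= t <= 1] and [z] in [U]. Each [x |-> t x + (1 - t) z] is a
    homothety of [U] into itself, so [phi_k] is subharmonic; it is continuous,
    dominates every [b i], and for a single function [b] it decreases to [b] as
    [k] grows. Neither mollification nor the existence of the surface measure
    is involved.

    For the converse, let [p F] be the infimum of [int a dmu + int b dnu] over
    the pairs with [F(x, y) <= a x + b y] and [b] subharmonic. By Hahn-Banach,
    [p] dominates a positive functional whose value at the cost is the dual
    value. It is the expectation of a random pair in the closure of [X * Y]. Its
    first marginal is [mu], and its second one does not charge the boundary of
    [Y] because the functions [max 0 (1 - n depth)] are convex.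

    In the second problem mass may escape to the boundary of [X], where the
    order is lost. One works instead with triples [(x, z, y)] and functions
    [b x z] subharmonic in [z], as in Strassen's theorem. Then [t z + (1 - t) x]
    lies in [X], has a law above [mu], and is almost optimal as [t] tends to 1.
    The extended dual problem has the same value, since
    [sup_x b x] is regularized by the [phi_k] above. *)

Set Implicit Arguments.
Unset Strict Implicit.
Unset Printing Implicit Defensive.

(** * Positive functionals *)

Section positive_functional.
Variables (R : realType) (Om : Type) (S : set Om).
Implicit Types (f g : Om -> R) (q : (Om -> R) -> R).

(** The functional produced by Hahn-Banach is only finitely additive on functions on [S]. It becomes
    a law on the closure of [S], tested by functions uniformly continuous there. A function in
    [Cb U] need not extend continuously to the boundary of [U]; hence each subharmonic test function
    is first composed with a contraction towards an interior point, which sends the closure of [U]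
    into a compact subset of [U], and the contraction is removed at the end by dominated
    convergence. The two problems differ by what the order says about the boundary. Functions
    concave on [U] and vanishing at its boundary, such as [bump], have larger integrals under
    measures below [nu], so these cannot lose mass; above [mu] the inequality is reversed and gives
    no control. This is why the second problem keeps the starting point [x], whose law [mu] is
    carried by the open set, as an anchor for the endpoint [z]. *)

Definition bounded_on f := exists M : R, forall w, S w -> `|f w| <= M.

Lemma bounded_on_cst (r : R) : bounded_on (fun=> r).
Proof. by exists `|r|. Qed.

Lemma bounded_onD f g : bounded_on f -> bounded_on g ->
  bounded_on (fun w => f w + g w).
Proof.
move=> [M fM] [N gN]; exists (M + N) => w Sw.
by rewrite (le_trans (ler_normD _ _))// lerD ?fM ?gN.
Qed.

Lemma bounded_onZ (a : R) f : bounded_on f -> bounded_on (fun w => a * f w).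
Proof.
by move=> [M fM]; exists (`|a| * M) => w Sw; rewrite normrM ler_wpM2l ?fM.
Qed.

Definition sublinear_on q :=
  (forall f g, bounded_on f -> bounded_on g ->
    q (fun w => f w + g w) <= q f + q g) /\
  (forall (a : R) f, 0 <= a -> bounded_on f -> q (fun w => a * f w) <= a * q f).

Lemma sublinear_on0 q : sublinear_on q -> q (fun=> 0) = 0.
Proof.
move=> [qD qZ]; have b0 := bounded_on_cst 0.
have := qD _ _ b0 b0; have := qZ 0 _ (lexx 0) b0.
have -> : (fun _ : Om => 0 * 0 : R) = fun=> 0 by apply/funext => w; rewrite mul0r.
have -> : (fun _ : Om => 0 + 0 : R) = fun=> 0 by apply/funext => w; rewrite addr0.
by lra.
Qed.

(** Homogeneity is only demanded as an inequality; scaling back by [a^-1] gives the reverse one. *)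
Lemma sublinear_onZ q (a : R) f : sublinear_on q -> 0 <= a -> bounded_on f ->
  q (fun w => a * f w) = a * q f.
Proof.
move=> sq; rewrite le_eqVlt => /orP[/eqP<- _|a0 bf].
  have -> : (fun w => 0 * f w) = fun=> 0 by apply/funext => w; rewrite mul0r.
  by rewrite mul0r sublinear_on0.
have [_ qZ] := sq; apply/eqP; rewrite eq_le qZ ?(ltW a0)//=.
have a1 : 0 <= a^-1 by rewrite invr_ge0 ltW.
have := qZ a^-1 _ a1 (bounded_onZ a bf).
have -> : (fun w => a^-1 * (a * f w)) = f.
  by apply/funext => w; rewrite mulrA mulVf ?gt_eqF// mul1r.
by rewrite ler_pdivlMl.
Qed.

Lemma sublinear_on_ge q f : sublinear_on q -> bounded_on f ->
  - q (fun w => -1 * f w) <= q f.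
Proof.
move=> sq bf; have [qD _] := sq.
have := qD f _ bf (bounded_onZ (-1) bf).
have -> : (fun w => f w + -1 * f w) = fun=> 0 by apply/funext => w; ring.
by rewrite sublinear_on0//; lra.
Qed.

(* The pointwise infimum of a chain is sublinear, and perturbing a minimal q
   to inf_(t >= 0) q (f + t g) - t q g forces q f + q g <= q (f + g). *)
Lemma minimal_sublinear (p : (Om -> R) -> R) : sublinear_on p ->
  exists L : (Om -> R) -> R,
  [/\ forall f, bounded_on f -> L f <= p f,
      forall f g, bounded_on f -> bounded_on g ->
        L (fun w => f w + g w) = L f + L g &
      forall a f, bounded_on f -> L (fun w => a * f w) = a * L f].
Proof.
move=> sp.
pose T := {q | sublinear_on q /\ forall f, bounded_on f -> q f <= p f}.
(* The order is reversed, so that the maximal element given by Zorn's lemma is a minimal functional.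
   Functionals are compared on bounded functions only, hence a preorder. *)
pose le (s t : T) := `[< forall f, bounded_on f -> sval t f <= sval s f >].
have p_spec : sublinear_on p /\ forall f, bounded_on f -> p f <= p f by [].
pose t0 : T := exist _ p p_spec.
have [||A totA|[q [sq qp]] qmin] := @ZL_preorder T t0 le.
- by move=> t; apply/asboolP.
- by move=> r s t /asboolP rs /asboolP st; apply/asboolP => f bf;
    rewrite (le_trans (st _ bf))// rs.
- have [[t1 At1]|A0] := pselect (A !=set0); last first.
    by exists t0 => s As; exfalso; apply: A0; exists s.
  pose V f := [set sval s f | s in A].
  have lbV f : bounded_on f -> has_lbound (V f).
    (* Subadditivity at [f] and [- f] bounds the whole chain from below, so the real [inf] is a true
       infimum. *)
    move=> bf; exists (- p (fun w => -1 * f w)) => _ [[s [ss sp']] As <-] /=.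
    rewrite (le_trans _ (sublinear_on_ge ss bf))// lerN2 sp'//.
    exact: bounded_onZ.
  have nV f : V f !=set0 by exists (sval t1 f); exists t1.
  pose q f := inf (V f).
  have qle s f : A s -> bounded_on f -> q f <= sval s f.
    by move=> As bf; apply: ge_inf; [exact: lbV|exists s].
  have sq : sublinear_on q.
    split=> [f g bf bg|a f a0 bf].
      apply/ler_addgt0Pr => e e0.
      have [_ [s As <-] se] := inf_adherent (divr_gt0 e0 (ltr0n R 2)) (conj (nV f) (lbV f bf)).
      have [_ [t At <-] te] := inf_adherent (divr_gt0 e0 (ltr0n R 2)) (conj (nV g) (lbV g bg)).
      (* Two near-minimizers are replaced by the smaller of the two in the chain, whose
         subadditivity then handles both functions at once. *)
      have [r [Ar rs rt]] : exists r, [/\ A r, sval r f <= sval s f & sval r g <= sval t g].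
        have [/asboolP st|/asboolP ts] := totA _ _ As At.
        - by exists t; split=> //; apply: st.
        - by exists s; split=> //; apply: ts.
      have := qle r _ Ar (bounded_onD bf bg).
      have [[rD _] _] := svalP r.
      have := rD f g bf bg; rewrite -/(q f) -/(q g) in se te *.
      by move: (sval r (fun w => f w + g w)) => x; lra.
    have [->|an0] := eqVneq a 0.
      have [st1 _] := svalP t1; have := qle t1 _ At1 (bounded_onZ 0 bf).
      by rewrite (sublinear_onZ st1)// !mul0r.
    have {an0} a0' : 0 < a by rewrite lt_def an0.
    rewrite -ler_pdivrMl//; apply: lb_le_inf => // _ [s As <-].
    rewrite ler_pdivrMl// -(@sublinear_onZ (sval s))//; last by have [] := svalP s.
    by apply: qle => //; exact: bounded_onZ.
  have q_spec : sublinear_on q /\ forall f, bounded_on f -> q f <= p f.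
    split=> // f bf; rewrite (le_trans (qle _ _ At1 bf))//.
    by have [_] := svalP t1; apply.
  by exists (exist _ q q_spec) => s As; apply/asboolP => f bf /=; apply: qle.
have qsup f g : bounded_on f -> bounded_on g ->
    q f + q g <= q (fun w => f w + g w).
  move=> bf bg.
  pose V f := [set q (fun w => f w + t * g w) - t * q g | t in [set t | 0 <= t]].
  have bt f' t : bounded_on f' -> bounded_on (fun w => f' w + t * g w).
    by move=> bf'; apply: bounded_onD => //; exact: bounded_onZ.
  have lbV f' : bounded_on f' -> has_lbound (V f').
    (* Finiteness: [t * q g], which is [q (t g)], is at most [q (f' + t g) + q (- f')]. *)
    move=> bf'; exists (- q (fun w => -1 * f' w)) => _ [t t0' <-] /=.
    rewrite -(sublinear_onZ sq t0' bg).
    have [qD _] := sq.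
    have := qD _ _ (bt _ t bf') (bounded_onZ (-1) bf').
    rewrite (_ : (fun w => f' w + t * g w + -1 * f' w) = fun w => t * g w); last first.
      by apply/funext => w; ring.
    by lra.
  have nV f' : V f' !=set0.
    by exists (q (fun w => f' w + 0 * g w) - 0 * q g); exists 0 => /=.
  pose q' f := inf (V f).
  have q'le f' t : 0 <= t -> bounded_on f' ->
      q' f' <= q (fun w => f' w + t * g w) - t * q g.
    by move=> t0' bf'; apply: ge_inf; [exact: lbV|exists t].
  have q'q f' : bounded_on f' -> q' f' <= q f'.
    move=> bf'; rewrite (le_trans (q'le _ 0 _ _))// mul0r subr0.
    have -> // : (fun w => f' w + 0 * g w) = f' by apply/funext => w; ring.
  have sq' : sublinear_on q'.
    split=> [f1 f2 b1 b2|a f1 a0 b1].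
      apply/ler_addgt0Pr => e e0.
      have [_ [s s0 <-] se] := inf_adherent (divr_gt0 e0 (ltr0n R 2)) (conj (nV f1) (lbV _ b1)).
      have [_ [t t0' <-] te] := inf_adherent (divr_gt0 e0 (ltr0n R 2)) (conj (nV f2) (lbV _ b2)).
      have := q'le _ (s + t) (addr_ge0 s0 t0') (bounded_onD b1 b2).
      have [qD _] := sq; have := qD _ _ (bt _ s b1) (bt _ t b2).
      rewrite (_ : (fun w => f1 w + s * g w + (f2 w + t * g w)) =
        (fun w => f1 w + f2 w + (s + t) * g w)); last by apply/funext => w; ring.
      rewrite -/(q' f1) -/(q' f2) in se te *; rewrite [(s + t) * q g]mulrDl.
      by lra.
    have [->|an0] := eqVneq a 0.
      rewrite mul0r (le_trans (q'q _ (bounded_onZ 0 b1)))//.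
      by rewrite sublinear_onZ// mul0r.
    have {an0} a0' : 0 < a by rewrite lt_def an0.
    rewrite -ler_pdivrMl//; apply: lb_le_inf => // _ [t t0' <-].
    rewrite ler_pdivrMl// mulrBr -(@sublinear_onZ q a)//; last exact: bt.
    rewrite (le_trans (q'le _ (a * t) _ _)) ?mulr_ge0//; first exact: bounded_onZ.
    rewrite mulrA lerB//.
    by rewrite le_eqVlt; apply/orP; left; apply/eqP; congr q; apply/funext => w; ring.
  have q'_spec : sublinear_on q' /\ forall f, bounded_on f -> q' f <= p f.
    by split=> // f' bf'; rewrite (le_trans (q'q _ bf'))// qp.
  have qle : le (exist _ q (conj sq qp)) (exist _ q' q'_spec).
    by apply/asboolP => f' bf' /=; exact: q'q.
  (* Minimality returns [q f <= q' f]; the value [t = 1] in the infimum defining [q'] then gives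
     superadditivity. *)
  have /asboolP/(_ f bf)/= := qmin _ qle.
  have := q'le f 1 ler01 bf.
  have -> : (fun w => f w + 1 * g w) = (fun w => f w + g w).
    by apply/funext => w; ring.
  by rewrite mul1r; lra.
exists q; split=> // [f g bf bg|a f bf].
  by apply/eqP; rewrite eq_le qsup// andbT; have [qD _] := sq; apply: qD.
have [a0|a0] := leP 0 a; first exact: sublinear_onZ.
have bnaf : bounded_on (fun w => - a * f w) by exact: bounded_onZ.
have baf : bounded_on (fun w => a * f w) by exact: bounded_onZ.
have := qsup _ _ baf bnaf; have [qD _] := sq; have := qD _ _ baf bnaf.
rewrite (_ : (fun w => a * f w + - a * f w) = fun=> 0); last by apply/funext => w; ring.
rewrite sublinear_on0// (@sublinear_onZ q (- a))//; last by lra.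
by lra.
Qed.

(** Read [C g v] as: [g] can be bought at price [v]. Then [p f] is the least price of a function
    dominating [f] on [S], and positivity of prices keeps it above every lower bound of [f]. A
    linear functional below [p] is positive, because a nonpositive function is dominated by [0],
    whose price is [0]. *)
Theorem positive_functional (C : (Om -> R) -> R -> Prop) :
  (forall f v g w, C f v -> C g w -> C (fun x => f x + g x) (v + w)) ->
  (forall (a : R) f v, 0 <= a -> C f v -> C (fun x => a * f x) (a * v)) ->
  (forall r, C (fun=> r) r) ->
  (forall f v, C f v -> (forall w, S w -> 0 <= f w) -> 0 <= v) ->
  exists L : (Om -> R) -> R,
  [/\ forall f g, bounded_on f -> bounded_on g ->
        L (fun w => f w + g w) = L f + L g,
      forall a f, bounded_on f -> L (fun w => a * f w) = a * L f,
      forall f g, bounded_on f -> bounded_on g ->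
        (forall w, S w -> f w <= g w) -> L f <= L g,
      forall r, L (fun=> r) = r &
      forall f v, C f v -> bounded_on f -> L f <= v].
Proof.
move=> CD CZ C1 Cpos.
pose V f := [set v | exists2 g, C g v & forall w, S w -> f w <= g w].
have Cle f v (r : R) : C f v -> (forall w, S w -> r <= f w) -> r <= v.
  move=> Cfv rf; rewrite -subr_ge0; apply: Cpos (CD _ _ _ _ Cfv (C1 (- r))) _.
  by move=> w Sw; rewrite subr_ge0 rf.
have nV f : bounded_on f -> V f !=set0.
  move=> [M fM]; exists M; exists (fun=> M) => // w Sw.
  by rewrite (le_trans (ler_norm _))// fM.
have lbV f : bounded_on f -> has_lbound (V f).
  move=> [M fM]; exists (- M) => v [g Cgv fg]; apply: (Cle g) => // w Sw.
  by rewrite (le_trans _ (fg _ Sw))// lerNl (le_trans _ (fM _ Sw))// -normrN ler_norm.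
pose p f := inf (V f).
have ple f g v : bounded_on f -> C g v -> (forall w, S w -> f w <= g w) -> p f <= v.
  by move=> bf Cgv fg; apply: ge_inf; [exact: lbV|exists g].
have sp : sublinear_on p.
  split=> [f g bf bg|a f a0 bf].
    apply/ler_addgt0Pr => e e0.
    have [v [f1 Cv fv] ve] := inf_adherent (divr_gt0 e0 (ltr0n R 2)) (conj (nV f bf) (lbV f bf)).
    have [w [g1 Cw gw] we] := inf_adherent (divr_gt0 e0 (ltr0n R 2)) (conj (nV g bg) (lbV g bg)).
    have : p (fun w => f w + g w) <= v + w.
      apply: ple (CD _ _ _ _ Cv Cw) _; first exact: bounded_onD.
      by move=> x Sx; rewrite lerD ?fv ?gw.
    by rewrite -/(p f) -/(p g) in ve we *; lra.
  have [->|an0] := eqVneq a 0.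
    by rewrite mul0r; apply: ple (C1 0) _; [exact: bounded_onZ|move=> w _; rewrite mul0r].
  have {an0} a0' : 0 < a by rewrite lt_def an0.
  rewrite -ler_pdivrMl//; apply: lb_le_inf; first exact: nV.
  move=> v [g Cgv fg]; rewrite ler_pdivrMl//; apply: ple (CZ _ _ _ a0 Cgv) _.
    exact: bounded_onZ.
  by move=> w Sw; rewrite ler_wpM2l// fg.
have [L [Lp LD LZ]] := minimal_sublinear sp.
have LC f v : C f v -> bounded_on f -> L f <= v.
  by move=> Cfv bf; rewrite (le_trans (Lp _ bf))//; apply: ple Cfv _.
exists L; split=> // [f g bf bg fg|r].
  have bgf : bounded_on (fun w => f w + -1 * g w).
    by apply: bounded_onD => //; exact: bounded_onZ.
  have : L (fun w => f w + -1 * g w) <= 0.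
    rewrite (le_trans (Lp _ bgf))//; apply: ple (C1 0) _ => // w Sw.
    by have := fg _ Sw; lra.
  by rewrite LD ?LZ//; [lra|exact: bounded_onZ].
apply/eqP; rewrite eq_le (LC _ _ (C1 r) (bounded_on_cst r))/=.
have := LC _ _ (C1 (- r)) (bounded_on_cst (- r)).
have := LZ (-1) _ (bounded_on_cst r).
have -> : (fun _ : Om => -1 * r) = fun=> - r by apply/funext => w; ring.
by lra.
Qed.

End positive_functional.

(** * Bounded measurable functions *)

Lemma inv_succ_lt (R : realType) (e : R) : 0 < e ->
  exists N, forall n, (N <= n)%N -> n.+1%:R^-1 < e.
Proof.
move=> e0; exists (Num.truncn e^-1) => n Nn; rewrite invf_plt ?posrE//.
have /truncn_itv/andP[_ h] : 0 <= e^-1 by rewrite invr_ge0 ltW.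
by rewrite (lt_le_trans h)// ler_nat.
Qed.

Section bounded_measurable.
Context d (T : measurableType d) (R : realType) (P : probability T R).
Implicit Types (D : set T) (f g : T -> R).

(* On the Borel space [Rd] this is convertible to [Sb]. *)
Definition bmeas D f :=
  measurable_fun D f /\ exists M : R, forall x, D x -> `|f x| <= M.

Lemma bmeas_cst D (r : R) : bmeas D (fun=> r).
Proof. by split=> //; exists `|r|. Qed.

Lemma bmeas_indic D (A : set T) : measurable A -> bmeas D (\1_A : T -> R).
Proof.
move=> mA; split; first exact: measurable_indic.
by exists 1 => x _; rewrite indicE; case: (_ \in _); rewrite ?normr1// normr0.
Qed.

Lemma bmeasD D f g : bmeas D f -> bmeas D g -> bmeas D (fun x => f x + g x).
Proof.
move=> [mf [M fM]] [mg [N gN]]; split; first exact: measurable_funD.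
by exists (M + N) => x Dx; rewrite (le_trans (ler_normD _ _))// lerD ?fM ?gN.
Qed.

Lemma bmeasZ D (a : R) f : bmeas D f -> bmeas D (fun x => a * f x).
Proof.
move=> [mf [M fM]]; split; first exact: measurable_funM.
by exists (`|a| * M) => x Dx; rewrite normrM ler_wpM2l ?fM.
Qed.

Lemma bmeasS D D' f : measurable D' -> D `<=` D' -> bmeas D' f -> bmeas D f.
Proof.
move=> mD' DD' [mf [M fM]]; split; first exact: measurable_funS mf.
by exists M => x /DD'; exact: fM.
Qed.

Lemma eq_bmeas D f g : {in D, f =1 g} -> bmeas D f -> bmeas D g.
Proof.
move=> fg [mf [M fM]]; split; first exact: eq_measurable_fun mf.
by exists M => x Dx; rewrite -fg ?inE//; exact: fM.
Qed.

Lemma bmeas_integrable D f : measurable D -> bmeas D f ->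
  P.-integrable D (EFin \o f).
Proof.
move=> mD [mf [M fM]]; apply: measurable_bounded_integrable => //.
  by rewrite (le_lt_trans (probability_le1 _ _))// ltry.
by exists M; split; [exact: num_real|move=> N MN x Dx; apply: le_trans (fM _ Dx) (ltW MN)].
Qed.

Lemma EFin_Rintegral D f : measurable D -> bmeas D f ->
  (\int[P]_(x in D) (f x)%:E)%E = (\int[P]_(x in D) f x)%:E.
Proof.
move=> mD bf; rewrite /Rintegral fineK//.
by apply: integrable_fin_num => //; exact: bmeas_integrable.
Qed.

Lemma Rintegral_full D D' f : measurable D -> measurable D' -> D `<=` D' ->
  P (~` D) = 0%E -> bmeas D' f -> \int[P]_(x in D') f x = \int[P]_(x in D) f x.
Proof.
move=> mD mD' DD' PD bf; congr fine.
rewrite (negligible_integral _ _ (bmeas_integrable mD' bf) PD)//; last exact: measurableC.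
by rewrite setDE setCK setIidr.
Qed.

Lemma Rintegral_prob_cst D (r : R) : measurable D -> P (~` D) = 0%E ->
  \int[P]_(x in D) r = r.
Proof.
move=> mD PD; rewrite -(Rintegral_full mD measurableT)//; last exact: bmeas_cst.
rewrite Rintegral_cst//. by rewrite [X in fine X](probability_setT P) mulr1.
Qed.

Lemma probability_setC_eq0 D : measurable D -> P D = 1%E -> P (~` D) = 0%E.
Proof. by move=> mD PD; rewrite probability_setC// PD subee. Qed.

Lemma probability_setI_full A D : measurable A -> measurable D ->
  P (~` D) = 0%E -> P A = P (A `&` D).
Proof.
move=> mA mD PD; rewrite (measureDI P mA mD).
rewrite [X in (X + _)%E](_ : _ = 0%E) ?add0e//.
apply: subset_measure0 PD; [exact: measurableD|exact: measurableC|].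
by rewrite setDE; exact: subIsetr.
Qed.

Lemma le_bmeas_Rintegral D f g : measurable D -> bmeas D f -> bmeas D g ->
  (forall x, D x -> f x <= g x) -> \int[P]_(x in D) f x <= \int[P]_(x in D) g x.
Proof.
by move=> mD bf bg fg; apply: le_Rintegral => //; exact: bmeas_integrable.
Qed.

Lemma bmeas_RintegralD D f g : measurable D -> bmeas D f -> bmeas D g ->
  \int[P]_(x in D) (f x + g x) = \int[P]_(x in D) f x + \int[P]_(x in D) g x.
Proof. by move=> mD bf bg; apply: RintegralD => //; exact: bmeas_integrable. Qed.

Lemma bmeas_RintegralZ D (a : R) f : measurable D -> bmeas D f ->
  \int[P]_(x in D) (a * f x) = a * \int[P]_(x in D) f x.
Proof. by move=> mD bf; apply: RintegralZl => //; exact: bmeas_integrable. Qed.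

Lemma bmeas_sum D (I : eqType) (s : seq I) (h : I -> T -> R) :
  (forall i, i \in s -> bmeas D (h i)) -> bmeas D (fun x => \sum_(i <- s) h i x).
Proof.
elim: s => [|i s ih] bh.
  by apply: (eq_bmeas _ (bmeas_cst D 0)) => x _; rewrite big_nil.
apply: (@eq_bmeas _ (fun x => h i x + \sum_(i <- s) h i x)).
  by move=> x _; rewrite big_cons.
apply: bmeasD; first by apply: bh; rewrite mem_head.
by apply: ih => j js; apply: bh; rewrite inE js orbT.
Qed.

Lemma bmeas_Rintegral_sum D (I : eqType) (s : seq I) (h : I -> T -> R) :
  measurable D -> (forall i, i \in s -> bmeas D (h i)) ->
  \int[P]_(x in D) (\sum_(i <- s) h i x) = \sum_(i <- s) \int[P]_(x in D) h i x.
Proof.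
move=> mD; elim: s => [|i s ih] bh.
  rewrite big_nil (@eq_Rintegral _ _ _ _ _ (fun=> 0)) ?Rintegral_cst ?mul0r//.
  by move=> x _; rewrite big_nil.
rewrite big_cons -ih; last by move=> j js; apply: bh; rewrite inE js orbT.
rewrite -bmeas_RintegralD//.
- by apply: eq_Rintegral => x _; rewrite big_cons.
- by apply: bh; rewrite mem_head.
- by apply: bmeas_sum => j js; apply: bh; rewrite inE js orbT.
Qed.

Lemma cvg_bmeas_Rintegral D (h : nat -> T -> R) f (M : R) : measurable D ->
  (forall n, measurable_fun D (h n)) -> measurable_fun D f ->
  (forall n x, D x -> `|h n x| <= M) ->
  (forall x, D x -> h n x @[n --> \oo] --> f x) ->
  \int[P]_(x in D) h n x @[n --> \oo] --> \int[P]_(x in D) f x.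
Proof.
move=> mD mh mf hM hf.
have [] := @dominated_convergence _ T R P D mD (fun n => EFin \o h n)
    (EFin \o f) (fun=> M%:E).
- by move=> n; apply/measurable_EFinP.
- exact/measurable_EFinP.
- by apply: aeW => x Dx; apply/cvg_EFin; [exact: nearW|exact: hf].
- by apply: (@bmeas_integrable D (fun=> M)) => //; exact: bmeas_cst.
- by apply: aeW => x n Dx /=; rewrite lee_fin hM.
move=> fi _ cv; apply: fine_cvg; rewrite fineK//.
exact: integrable_fin_num.
Qed.

End bounded_measurable.

Lemma bmeas_restrict d (T : measurableType d) (R : realType) (D : set T)
  (f : T -> R) : measurable D -> bmeas D f -> bmeas setT (f \_ D).
Proof.
move=> mD [mf [M fM]]; split; first exact/(measurable_restrictT f mD).
exists `|M| => x _; rewrite patchE; case: ifPn => [|_]; last by rewrite normr0.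
by rewrite inE => Dx; rewrite (le_trans (fM _ Dx))// ler_norm.
Qed.

(** The law is given by its values on measurable sets, so that one formula serves marginals of
    couplings, laws of random vectors and the reflection of the sphere. Extending [g] by zero
    outside [D] reduces to integrals over the whole space. *)
Lemma Rintegral_law d d' (T : measurableType d) (T' : measurableType d')
    (R : realType) (P : probability T R) (Q : probability T' R) (phi : T -> T') :
  measurable_fun setT phi ->
  (forall A, measurable A -> Q A = P (phi @^-1` A)) ->
  forall (D : set T') (g : T' -> R), measurable D -> bmeas D g ->
  \int[Q]_(x in D) g x = \int[P]_(x in phi @^-1` D) g (phi x).
Proof.
move=> mphi H D g mD bg; rewrite Rintegral_mkcond [RHS]Rintegral_mkcond.
have bh := bmeas_restrict mD bg; set h := g \_ D in bh *.
have -> : (fun x => g (phi x)) \_ (phi @^-1` D) = h \o phi.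
  apply/funext => x; rewrite /h /= !patchE.
  have [Dx|Dx] := pselect (D (phi x)); first by rewrite !mem_set.
  by rewrite !memNset.
pose f : {mfun T >-> T'} := HB.pack phi (isMeasurableFun.Build _ _ _ _ _ mphi).
have bhf : bmeas setT (h \o phi).
  have [mh [M hM]] := bh; split; last by exists M => x _; exact: hM.
  exact: measurableT_comp.
congr fine; rewrite (eq_measure_integral (distribution P f)); last first.
  by move=> A mA _; exact: H.
rewrite (@integral_distribution _ _ _ _ _ P f (EFin \o h))//.
- by apply/measurable_EFinP; have [] := bh.
- exact: bmeas_integrable.
Qed.

(* Any function, measurable or not: the integral is defined through lower
   simple approximations, which may be truncated to a set of full measure. *)
Section integral_full.
Import HBNNSimple.

Lemma integral_full_eq d (T : measurableType d) (R : realType)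
    (P : {measure set T -> \bar R}) (D : set T) (f g : T -> \bar R) :
  measurable D -> P (~` D) = 0%E -> {in D, f =1 g} ->
  (\int[P]_x f x = \int[P]_x g x)%E.
Proof.
move=> mD PD; move: f g.
suff H (f g : T -> \bar R) : (forall x, D x -> f x <= g x)%E ->
   (forall x, 0 <= g x)%E ->
   (ereal_sup [set sintegral P h | h in [set h : {nnsfun T >-> R} |
      forall x, (h x)%:E <= f x]] <=
   ereal_sup [set sintegral P h | h in [set h : {nnsfun T >-> R} |
      forall x, (h x)%:E <= g x]])%E.
  move=> f g fg; rewrite integralE [RHS]integralE.
  have pos (u v : T -> \bar R) : {in D, u =1 v} ->
      (\int[P]_x funepos u x <= \int[P]_x funepos v x)%E.
    move=> uv; rewrite !ge0_integralTE//; apply: H => x // Dx.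
    by rewrite !funeposE uv ?inE.
  have neg (u v : T -> \bar R) : {in D, u =1 v} ->
      (\int[P]_x funeneg u x <= \int[P]_x funeneg v x)%E.
    by move=> uv; rewrite -!funeposN; apply: pos => x xD /=; rewrite uv.
  have gf : {in D, g =1 f} by move=> x xD; rewrite fg.
  congr (_ - _)%E; apply/eqP; rewrite eq_le.
  - by rewrite !pos.
  - by rewrite !neg.
move=> fg g0; apply: ge_ereal_sup => _ [h hf <-].
(* Cutting [h] off outside [D] brings it below [g], which is nonnegative everywhere, and does not
   change its integral. *)
pose h' : {nnsfun T >-> R} := proj_nnsfun h mD.
apply: (@le_trans _ _ (sintegral P h')); last first.
  apply: ereal_sup_ubound; exists h' => // x /=.
  rewrite mindicE; case: (boolP (x \in D)) => xD.
    by rewrite mulr1 (le_trans (hf x)) ?fg//; rewrite inE in xD.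
  by rewrite mulr0.
have := @integral_nnsfun _ T R P setT measurableT h.
have := @integral_nnsfun _ T R P setT measurableT h'.
rewrite !patch_setT => <- <-.
rewrite le_eqVlt; apply/orP; left; apply/eqP.
rewrite (ge0_negligible_integral (measurableC mD) measurableT)//; last first.
- by move=> x _; rewrite lee_fin.
- exact/measurable_EFinP.
rewrite [RHS](ge0_negligible_integral (measurableC mD) measurableT)//; last first.
- by move=> x _; rewrite lee_fin.
- exact/measurable_EFinP.
apply: eq_integral => x; rewrite setDE setCK setTI => xD /=.
by rewrite mindicE xD mulr1.
Qed.

End integral_full.

(** * Representation of positive functionals by random matrices *)

Section riesz_representation.
Variables (R : realType) (m n : nat) (S : set 'M[R]_(m, n)).
Variables (B : R) (SB : forall x, S x -> forall i j, `|x i j| <= B).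
Variable L : ('M[R]_(m, n) -> R) -> R.
Hypothesis LD : forall f g, bounded_on S f -> bounded_on S g ->
  L (fun w => f w + g w) = L f + L g.
Hypothesis LZ : forall a f, bounded_on S f -> L (fun w => a * f w) = a * L f.
Hypothesis Lle : forall f g, bounded_on S f -> bounded_on S g ->
  (forall w, S w -> f w <= g w) -> L f <= L g.
Hypothesis L1 : forall r, L (fun=> r) = r.

(* A point is coded by the word of its threshold bits, last bit first. The cell
   of a word [w] receives the interval of length [mass w] starting at [lo w];
   these intervals are nested as the cells are, so that the representatives of
   the cells visited by [u] in [0, 1[ converge, and their limit has law [L]. *)
Let bit (k : nat) (x : 'M[R]_(m, n)) : bool :=
  if unpickle k is Some ijq then
    let: (i, j, q) := (ijq : 'I_m * 'I_n * rat) in x i j < ratr q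
  else false.

Let wd (k : nat) (x : 'M[R]_(m, n)) : seq bool := iteri k (fun i s => bit i x :: s) [::].

Let size_wd k x : size (wd k x) = k.
Proof. by elim: k => //= k ->. Qed.

Let wd_bit N x y : wd N x = wd N y -> forall k, (k < N)%N -> bit k x = bit k y.
Proof.
elim: N => // N ih /=; rewrite -!/(wd _ _) => -[bN /ih{}ih] k.
by rewrite ltnS leq_eqVlt => /predU1P[->//|]; exact: ih.
Qed.

(** Since [S] is bounded, finitely many rational thresholds of mesh below [e] suffice for all
    coordinates, and [N] exceeds all their codes. *)
Let bits_separate (e : R) : 0 < e -> exists N, forall x y, S x -> S y ->
  wd N x = wd N y -> forall i j, `|x i j - y i j| <= e.
Proof.
move=> e0.
pose K := (Num.truncn e^-1).+1.
have K0 : 0 < K%:R :> R by rewrite ltr0n.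
have Ke : K%:R^-1 < e.
  rewrite invf_plt ?posrE//; have /truncn_itv : 0 <= e^-1 by rewrite invr_ge0 ltW.
  by case/andP.
pose A := (Num.truncn `|B|).+1.
have BA : B <= A%:R.
  rewrite (le_trans (ler_norm B))//; have /truncn_itv/andP[_ /ltW] : 0 <= `|B| by [].
  exact.
pose q (l : nat) : rat := l%:R / K%:R - A%:R.
pose G := (2 * A * K).+1.
pose F (i : 'I_m * 'I_n * 'I_G) := pickle (i.1, q i.2).
pose N := (\max_i F i).+1; exists N.
suff H x y i j : S x -> S y -> wd N x = wd N y -> x i j - y i j <= e.
  move=> x y Sx Sy xy i j; rewrite ler_norml H// andbT lerNl opprB.
  exact: H.
move=> Sx Sy xy; rewrite leNgt; apply/negP => exy.
(* Position of [x i j] on the grid of mesh [1 / K] starting at [- A]. The last grid point not above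
   [x i j] separates it from any [y i j] lower by more than [e]. *)
pose z := (x i j + A%:R) * K%:R.
have xB := SB Sx i j; have yB := SB Sy i j; rewrite !ler_norml in xB yB.
have z0 : 0 <= z by apply: mulr_ge0 => //; lra.
have /truncn_itv/andP[lz zl] := z0.
set l := Num.truncn z in lz zl.
have lG : (l < G)%N.
  rewrite -(ltr_nat R); apply: le_lt_trans lz _.
  rewrite /z /G -natr1 !natrM; apply: (@le_lt_trans _ _ (2 * A%:R * K%:R)); last by lra.
  by apply: ler_wpM2r; [exact: ltW|lra].
have bl : bit (F (i, j, Ordinal lG)) y = bit (F (i, j, Ordinal lG)) x.
  by apply: wd_bit (esym xy) _ _; rewrite ltnS; exact: leq_bigmax.
have qE : ratr (q l) = l%:R / K%:R - A%:R :> R.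
  by rewrite /q rmorphB/= rmorphM/= fmorphV/= !ratr_nat.
have ql : l%:R / K%:R - A%:R <= x i j.
  by rewrite lerBlDr ler_pdivrMr.
have lq : x i j < l%:R / K%:R - A%:R + e.
  have : x i j + A%:R < l.+1%:R / K%:R by rewrite ltr_pdivlMr.
  rewrite -natr1 mulrDl mul1r; lra.
move: bl; rewrite /bit /F pickleK /= qE => bl.
have : y i j < l%:R / K%:R - A%:R by lra.
by rewrite bl ltNge ql.
Qed.

Let mass (w : seq bool) := L (fun x => (wd (size w) x == w)%:R).

Let bounded_bool (b : 'M[R]_(m, n) -> bool) :
  bounded_on S (fun x => (b x)%:R : R).
Proof. by exists 1 => x _; case: (b x); rewrite ?normr1// normr0. Qed.

Let mass_nil : mass [::] = 1.
Proof. by rewrite /mass /= -[RHS]L1; congr L; apply/funext => x. Qed.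

Let mass_ge0 w : 0 <= mass w.
Proof.
rewrite -(L1 0); apply: Lle => //; first exact: bounded_on_cst.
Qed.

Let massE w : mass w = mass (true :: w) + mass (false :: w).
Proof.
rewrite /mass -LD//; congr L; apply/funext => x /=; rewrite -!/(wd _ _) !eqseq_cons.
by case: (bit _ _); rewrite /= ?addr0 ?add0r.
Qed.

Let mass_gt0 w : 0 < mass w -> exists2 x, S x & wd (size w) x = w.
Proof.
move=> w0; apply: contrapT => H; move: w0; apply/negP; rewrite -leNgt -(L1 0).
apply: Lle => //; first exact: bounded_on_cst.
move=> x Sx; case: eqP => //= xw.
by exfalso; apply: H; exists x.
Qed.


Let Fixpoint lo (w : seq bool) : R :=
  if w is b :: w' then lo w' + (if b then 0 else mass (true :: w')) else 0.

Let lo_bounds w : 0 <= lo w /\ lo w + mass w <= 1.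
Proof.
elim: w => [|[] w [l0 l1]]; first by rewrite mass_nil add0r.
  by rewrite /= addr0; split=> //; have := massE w; have := mass_ge0 (false :: w); lra.
rewrite /=; have := massE w; have := mass_ge0 (true :: w); split; lra.
Qed.

Let wdu (k : nat) (u : R) : seq bool :=
  iter k (fun w => (u < lo w + mass (true :: w)) :: w) [::].

Let size_wdu k u : size (wdu k u) = k.
Proof. by elim: k => //= k ->. Qed.

(** Induction on the word: the half-open interval of [w] is cut at [lo w + mass (true :: w)] into
    those of its two extensions, and the next bit records on which side [u] falls. *)
Let wduP w u : 0 <= u < 1 ->
  (wdu (size w) u == w) = (lo w <= u < lo w + mass w).
Proof.
move=> u01; elim: w => [|b w ih]; first by rewrite /= eqxx mass_nil add0r u01.
rewrite /= -/(wdu _ _) eqseq_cons ih; have mE := massE w.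
have t0 := mass_ge0 (true :: w); have f0 := mass_ge0 (false :: w).
have [E|E] := eqVneq (wdu (size w) u) w.
  move: ih; rewrite E eqxx => /esym/andP[h1 h2]; rewrite h1 h2 andbT.
  case: b; rewrite /= ?addr0 ?h1 /=; first by case: ltP.
  have -> : lo w + mass (true :: w) + mass (false :: w) = lo w + mass w by lra.
  by rewrite h2 andbT; case: ltP.
move: ih; rewrite (negbTE E) => /esym ih; rewrite ih andbF; apply/esym/negbTE.
apply: contraFN ih => /andP[]; case: b; rewrite /= => ? ?; apply/andP; split; lra.
Qed.

(** The interval of a visited word contains [u], hence has positive length. Cells of mass zero,
    which may miss [S], are thus never visited. *)
Let mass_wdu k u : 0 <= u < 1 -> 0 < mass (wdu k u).
Proof.
move=> u01; have := wduP (wdu k u) u01; rewrite size_wdu eqxx => /esym/andP[].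
by lra.
Qed.

Let measurable_wdu k w : measurable [set u : R | wdu k u = w].
Proof.
elim: k w => [|k ih] w.
  have [->|w0] := eqVneq w [::].
    by rewrite (_ : mkset _ = setT)//; apply/seteqP.
  by rewrite (_ : mkset _ = set0)//; apply/seteqP; split=> // u /= /esym/eqP; rewrite (negbTE w0).
case: w => [|b w]; first by rewrite (_ : mkset _ = set0)//; apply/seteqP; split.
rewrite (_ : mkset _ = [set u | wdu k u = w] `&`
  [set u | (u < lo w + mass (true :: w)) = b]); last first.
  by apply/seteqP; split=> u /=; rewrite -/(wdu k u); [move=> [<- <-]|move=> [-> <-]].
apply: measurableI; first exact: ih.
case: b.
  rewrite (_ : mkset _ = `]-oo, (lo w + mass (true :: w))[%classic); last first.
    by apply/seteqP; split=> u /=; rewrite in_itv.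
  exact: measurable_itv.
rewrite (_ : mkset _ = `[lo w + mass (true :: w), +oo[%classic); last first.
  by apply/seteqP; split=> u /=; rewrite in_itv /= andbT leNgt; case: (u < _).
exact: measurable_itv.
Qed.

Let P0 : probability _ R := uniform_prob (@ltr01 R).

Let P0_itv (a b : R) : 0 <= a -> a <= b -> b <= 1 ->
  P0 [set u : R | a <= u < b] = (b - a)%:E.
Proof.
move=> a0 ab b1.
have -> : [set u : R | a <= u < b] = `[a, b[%classic.
  by apply/seteqP; split=> u /=; rewrite in_itv.
rewrite /P0 /= /uniform_prob (eq_integral (fun=> 1%:E)).
  rewrite integral_cst//= mul1e lebesgue_measure_itv /= lte_fin.
  case: ltP => // ba; rewrite (_ : b = a) ?subrr//.
  by apply/eqP; rewrite eq_le ab ba.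
move=> u; rewrite inE /= in_itv /= /uniform_pdf => /andP[au ub].
rewrite ifT ?subr0 ?invr1//; apply/andP; split; lra.
Qed.

(** The uniform law lives on all of [R]. Parameters outside [[0, 1[] form a null set and are sent to
    [0], so that every value of the limit map lies in the closure of [S]. *)
Let cl (u : R) : R := if 0 <= u < 1 then u else 0.

Let cl01 u : 0 <= cl u < 1.
Proof. by rewrite /cl; case: ifP => // _; rewrite lexx ltr01. Qed.

Let measurable_cl : measurable_fun setT cl.
Proof.
apply: measurable_fun_if => //; apply: measurable_and.
  exact: measurable_fun_ler.
exact: measurable_fun_ltr.
Qed.

Let W k u := wdu k (cl u).

Let measurable_W k (Q : set (seq bool)) : measurable [set u : R | Q (W k u)].
Proof.

rewrite (_ : mkset _ = \bigcup_w [set u | Q w /\ W k u = w]); last first.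
  by apply/seteqP; split=> [u /= Qu|u [w _ /= [Qw ->]]//]; exists (W k u).
apply: countable_bigcupT_measurable => [|w]; first exact: countableP.
have [Qw|Qw] := pselect (Q w); last first.
  by rewrite (_ : mkset _ = set0)//; apply/seteqP; split=> // u [].
rewrite (_ : mkset _ = [set u | W k u = w]); last first.
  by apply/seteqP; split=> [u []|u].
by have := measurable_cl measurableT (measurable_wdu k w); rewrite setTI.
Qed.

Let pt (w : seq bool) : 'M[R]_(m, n) := xget 0 [set x | S x /\ wd (size w) x = w].

Let ptP w : (exists2 x, S x & wd (size w) x = w) -> S (pt w) /\ wd (size w) (pt w) = w.
Proof. by move=> [x Sx xw]; rewrite /pt; case: xgetP => [y _ //|/(_ x)]; case. Qed.

Let t k u := pt (W k u).

Let tP k u : S (t k u) /\ wd k (t k u) = W k u.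
Proof.
have := ptP (mass_gt0 (mass_wdu k (cl01 u))).
by rewrite size_wdu.
Qed.

Let W_le k l x u : (k <= l)%N -> wd l x = W l u -> wd k x = W k u.
Proof.
elim: l => [|l ih]; first by rewrite leqn0 => /eqP->.
by rewrite leq_eqVlt => /predU1P[->//|kN [_ ?]]; exact: ih.
Qed.

Let inv_gt0 k : 0 < k.+1%:R^-1 :> R.
Proof. by rewrite invr_gt0. Qed.

Let N k := sval (cid (bits_separate (inv_gt0 k))).
Let NP k : forall x y, S x -> S y -> wd (N k) x = wd (N k) y ->
  forall i j, `|x i j - y i j| <= k.+1%:R^-1.
Proof. exact: svalP (cid (bits_separate (inv_gt0 k))). Qed.

Let t_cauchy k l l' u i j : (N k <= l)%N -> (N k <= l')%N ->
  `|t l u i j - t l' u i j| <= k.+1%:R^-1.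
Proof.
move=> kl kl'; have [Sl wl] := tP l u; have [Sl' wl'] := tP l' u.
by apply: (NP Sl Sl'); rewrite (W_le kl wl) (W_le kl' wl').
Qed.

Let T u : 'M[R]_(m, n) := \matrix_(i, j) lim (t k u i j @[k --> \oo]).

Let small (e : R) : 0 < e -> exists k, k.+1%:R^-1 < e.
Proof. by move=> /inv_succ_lt[K H]; exists K; exact: H. Qed.

Let t_cvg u i j : t k u i j @[k --> \oo] --> T u i j.
Proof.
rewrite mxE; apply: cauchy_cvg; apply: cauchy_exP => e e0.
have [k ke] := small e0; exists (t (N k) u i j).
exists (N k) => // l /= kl; rewrite /ball /= (le_lt_trans _ ke)//.
exact: t_cauchy.
Qed.

Let t_close k l u i j : (N k <= l)%N -> `|t l u i j - T u i j| <= k.+1%:R^-1.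
Proof.
move=> kl; apply/ler_addgt0Pr => e e0.
have /cvg_ballP/(_ e e0)[K _ HK] := @t_cvg u i j.
have := HK (maxn K (N k)); rewrite /= leq_maxl => /(_ isT).
rewrite /ball /= => H.
have := @t_cauchy k l (maxn K (N k)) u i j kl (leq_maxr _ _).
rewrite distrC in H => H'.
have := ler_distD (t (maxn K (N k)) u i j) (t l u i j) (T u i j) => h.
apply: (le_trans h); apply: lerD => //; exact: ltW.
Qed.

Let T_closure u : closure S (T u).
Proof.
move=> A /nbhs_ballP[e /= e0 eA]; have [k ke] := small e0.
exists (t (N k) u); split; first by have [] := tP (N k) u.
apply: eA; split=> // i j; rewrite /ball /= distrC (le_lt_trans _ ke)//.
exact: t_close.
Qed.

(** Membership of the limit in an open set is witnessed by one of countably many events on finite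
    words. The [k]-th representative is within [1 / k.+1] of the limit, and the radius [2 / k.+1]
    leaves room for strictness. *)
Let measurable_T U : open U -> measurable (T @^-1` U).
Proof.
move=> oU.
rewrite (_ : _ @^-1` _ = \bigcup_k [set u | ball (pt (W (N k) u)) (2 / k.+1%:R) `<=` U]).
  apply: bigcupT_measurable => k.
  exact: (@measurable_W (N k) [set w | ball (pt w) (2 / k.+1%:R) `<=` U]).
apply/seteqP; split=> [u /= UTu|u [k _] /=]; last first.
  apply; split=> [|i j]; first by rewrite divr_gt0.
  rewrite /ball /= (le_lt_trans (t_close _ _ _ (leqnn (N k))))//.
  by rewrite ltr_pMl ?ltr1n// invr_gt0.
move: oU; rewrite openE => /(_ _ UTu)/nbhs_ballP[e /= e0 eU].
(* A third of [e]: one part for the distance from the limit to the representative, two for the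
   radius of the ball. *)
have [k ke] : exists k, k.+1%:R^-1 < e / 3 by apply: small; rewrite divr_gt0.
exists k => // y [_ H]; apply: eU; split=> // i j.
have := H i j; have := t_close u i j (leqnn (N k)); rewrite /ball /= -/(t (N k) u).
have := ler_distD (t (N k) u i j) (T u i j) (y i j).
rewrite [`|T u i j - t _ _ _ _|]distrC; move: ke; move: (k.+1%:R^-1) => c; lra.
Qed.

Let L_sum (I : eqType) (s : seq I) (h : I -> 'M[R]_(m, n) -> R) :
  (forall i, bounded_on S (h i)) ->
  bounded_on S (fun x => \sum_(i <- s) h i x) /\
  L (fun x => \sum_(i <- s) h i x) = \sum_(i <- s) L (h i).
Proof.
move=> bh; elim: s => [|i s [bs ih]].
  have -> : (fun x => \sum_(i <- [::]) h i x) = fun=> 0.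
    by apply/funext => x; rewrite big_nil.
  by rewrite big_nil L1; split=> //; exact: bounded_on_cst.
have -> : (fun x => \sum_(i <- i :: s) h i x) =
    fun x => h i x + \sum_(i <- s) h i x.
  by apply/funext => x; rewrite big_cons.
by rewrite big_cons -ih LD//; split=> //; exact: bounded_onD.
Qed.

Let sum_word k (g : seq bool -> R) (w : seq bool) : size w = k ->
  g w = \sum_(v : k.-tuple bool) g v * (w == v)%:R.
Proof.
move=> wk; rewrite (bigD1 (Tuple (introT eqP wk)))//= eqxx mulr1 big1 ?addr0//.
move=> v; rewrite -val_eqE /= eq_sym => /negbTE->; by rewrite mulr0.
Qed.

Let P0_word k (v : k.-tuple bool) : P0 [set u | W k u = v] = (mass v)%:E.
Proof.
have [l0 l1] := lo_bounds v; have m0 := mass_ge0 v.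
have m01 : measurable [set u : R | 0 <= u < 1].
  rewrite (_ : mkset _ = `[0, 1[%classic); first exact: measurable_itv.
  by apply/seteqP; split=> u /=; rewrite in_itv.
have P01 : P0 (~` [set u : R | 0 <= u < 1]) = 0%E.
  by apply: probability_setC_eq0 => //; rewrite P0_itv ?lexx// subr0.
have mW : measurable [set u | W k u = v] by exact: (@measurable_W k [set w : seq bool | w = v]).
have mv : measurable [set u : R | lo v <= u < lo v + mass v].
  rewrite (_ : mkset _ = `[lo v, lo v + mass v[%classic); first exact: measurable_itv.
  by apply/seteqP; split=> u /=; rewrite in_itv.
transitivity (P0 [set u : R | lo v <= u < lo v + mass v]); last first.
  rewrite P0_itv//; last by lra.
  by rewrite addrC addKr.
transitivity (P0 ([set u | W k u = v] `&` [set u : R | 0 <= u < 1])).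
  exact: probability_setI_full.
transitivity (P0 ([set u : R | lo v <= u < lo v + mass v] `&` [set u : R | 0 <= u < 1]));
  last by apply/esym; exact: probability_setI_full.
congr (P0 _); apply/seteqP; split=> u /= [].
  move=> Wu u01; split=> //; rewrite -wduP// -Wu.
  by rewrite /W /cl u01 size_wdu.
move=> uv u01; split=> //; apply/eqP; rewrite /W /cl u01.
by have := wduP v u01; rewrite size_tuple uv => ->.
Qed.

(** Both sides are within [e] of the same finite sum of [g v * mass v] over the words of length [K]:
    by uniform continuity a point may be replaced by the representative of its cell, along [T] as
    well as under [L]. Countable additivity comes from the uniform law, [L] being only finitely
    additive. *)
Theorem random_matrix_representation :
  exists T : R -> 'M[R]_(m, n),
  [/\ forall U, open U -> measurable (T @^-1` U),
      forall u, closure S (T u) &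
      forall f, measurable_fun setT (f \o T) ->
        bounded_on (closure S) f ->
        (forall e : R, 0 < e -> exists2 delta : R, 0 < delta &
          forall x y, closure S x -> closure S y -> ball x delta y ->
            `|f x - f y| <= e) ->
        \int[uniform_prob (@ltr01 R)]_u f (T u) = L f].
Proof.
exists T; split=> // f mf [M fM] uf.
have bf : bounded_on S f by exists M => w Sw; apply: fM; exact: subset_closure.
have bfT : bmeas setT (f \o T) by split=> //; exists M => u _; exact: fM.
suff H e : 0 < e -> `|\int[P0]_u f (T u) - L f| <= e + e.
  apply/eqP; rewrite -subr_eq0 -normr_le0; apply/ler_addgt0Pr => e e0.
  by rewrite add0r [e]splitr; apply: H; rewrite divr_gt0.
move=> e0; have [delta d0 fd] := uf e e0; have [k kd] := small d0.
pose g w := f (pt w); pose K := N k.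
have gsum u : g (W K u) = \sum_(v : K.-tuple bool) g v * \1_[set u | W K u = v] u.
  rewrite (@sum_word K g (W K u)) ?size_wdu//; apply: eq_bigr => v _; congr (_ * _).
  by rewrite indicE; congr ((nat_of_bool _)%:R); apply/idP/idP; rewrite inE => /eqP.
have bgv (v : K.-tuple bool) : bmeas setT (fun u => g v * \1_[set u | W K u = v] u : R).
  by apply/bmeasZ/bmeas_indic; exact: (@measurable_W K [set w : seq bool | w = v]).
have bg : bmeas setT (fun u => g (W K u)).
  by apply: (@eq_bmeas _ _ _ _ (fun u => \sum_(v : K.-tuple bool) g v * \1_[set u | W K u = v] u));
    [move=> u _; rewrite gsum|exact: bmeas_sum].
have intg : \int[P0]_u g (W K u) = \sum_(v : K.-tuple bool) g v * mass v.
  under eq_Rintegral do rewrite gsum.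
  transitivity (\sum_(v : K.-tuple bool) \int[P0]_u (g v * \1_[set u | W K u = v] u)).
    by apply: bmeas_Rintegral_sum => // v _; exact: bgv.
  apply: eq_bigr => v _.
  have mWv : measurable [set u | W K u = v] by exact: (@measurable_W K [set w : seq bool | w = v]).
  rewrite bmeas_RintegralZ//; last exact: bmeas_indic.
  congr (_ * _); rewrite /Rintegral integral_indic// setIT.
  by rewrite [X in fine X]P0_word.
have [bgL intL] : bounded_on S (fun x => g (wd K x)) /\
    L (fun x => g (wd K x)) = \sum_(v : K.-tuple bool) g v * mass v.
  have -> : (fun x => g (wd K x)) =
      fun x => \sum_(v : K.-tuple bool) g v * (wd K x == v)%:R.
    by apply/funext => x; apply: sum_word.
  have [|bs ->] := @L_sum _ (index_enum (K.-tuple bool)) (fun v x => g v * (wd K x == v)%:R).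
    by move=> v; apply: bounded_onZ.
  split=> //; apply: eq_bigr => v _; rewrite LZ// /mass size_tuple.
  by [].
have near1 u : `|f (T u) - g (W K u)| <= e.
  apply: fd => //; first by apply: subset_closure; have [] := tP K u.
  by split=> // i j; rewrite /ball /= distrC (le_lt_trans _ kd)//; exact: t_close.
have near2 x : S x -> `|f x - g (wd K x)| <= e.
  move=> Sx; have [|Sp wp] := @ptP (wd K x); first by exists x; rewrite ?size_wd.
  rewrite size_wd in wp.
  apply: fd; [exact: subset_closure|exact: subset_closure|split=> // i j].
  by rewrite /ball /= (le_lt_trans _ kd)//; exact: NP.
have bc (h : R -> R) : bmeas setT h -> bmeas setT (fun u => h u + e).
  by move=> bh; apply: bmeasD => //; exact: bmeas_cst.
have Ic (h : R -> R) : bmeas setT h -> \int[P0]_u (h u + e) = \int[P0]_u h u + e.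
  move=> bh; rewrite bmeas_RintegralD//; last exact: bmeas_cst.
  by congr (_ + _); apply: Rintegral_prob_cst => //; rewrite setCT measure0.
have i1 : \int[P0]_u f (T u) <= \int[P0]_u g (W K u) + e.
  rewrite -Ic//; apply: le_bmeas_Rintegral => //; first exact: bc.
  by move=> u _; have := near1 u; rewrite ler_norml => /andP[]; lra.
have i2 : \int[P0]_u g (W K u) <= \int[P0]_u f (T u) + e.
  rewrite -Ic//; apply: le_bmeas_Rintegral => //; first exact: bc.
  by move=> u _; have := near1 u; rewrite ler_norml => /andP[]; lra.
have i3 : L f <= L (fun x => g (wd K x)) + e.
  rewrite -[X in _ + X]L1 -LD//; last exact: bounded_on_cst.
  apply: Lle => //; first by apply: bounded_onD => //; exact: bounded_on_cst.
  by move=> x /near2; rewrite ler_norml => /andP[]; lra.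
have i4 : L (fun x => g (wd K x)) <= L f + e.
  rewrite -[X in _ + X]L1 -LD//; last exact: bounded_on_cst.
  apply: Lle => //; first by apply: bounded_onD => //; exact: bounded_on_cst.
  by move=> x /near2; rewrite ler_norml => /andP[]; lra.
rewrite intL in i3 i4; rewrite intg in i1 i2.
rewrite ler_norml; apply/andP; split; lra.
Qed.

End riesz_representation.

(** * Borel sets and convex sets of row vectors *)

Section borel.
Variables (R : realType) (d : nat).
Local Notation E := 'rV[R]_d.
Implicit Types (U : set E) (x y z w : E).

Lemma measurable_open U : open U -> measurable (U : set (Rd R d)).
Proof. by move=> oU; exact: sub_sigma_algebra. Qed.

Lemma measurable_fun_Rd d' (T : measurableType d') (f : T -> Rd R d) :
  (forall U, open U -> measurable (f @^-1` U)) -> measurable_fun setT f.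
Proof.
move=> H; apply: (@measurability _ _ T (Rd R d) setT f (@open E)) => // _ [U oU <-].
by rewrite setTI; exact: H.
Qed.

Lemma measurable_fun_ltP d' (T : measurableType d') (D : set T) (f : T -> R) :
  measurable D -> (forall c, measurable (D `&` [set x | f x < c])) ->
  measurable_fun D f.
Proof.
move=> mD H; apply: (measurability _ (RGenInftyO.measurableE R)) => //.
move=> /= _ [_ [c ->] <-].
rewrite (_ : _ `&` _ = D `&` [set x | f x < c]); first exact: H.
by apply/seteqP; split=> x /=; rewrite in_itv.
Qed.

Lemma measurable_continuous_rV (f : E -> R) : continuous f ->
  measurable_fun setT (f : Rd R d -> R).
Proof.
move=> cf; apply: measurable_fun_ltP => // c; rewrite setTI.
apply: measurable_open; rewrite (_ : mkset _ = f @^-1` `]-oo, c[); last first.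
  by apply/seteqP; split=> x /=; rewrite in_itv.
by apply: open_comp => // x _; exact: cf.
Qed.

Lemma ball_rVE x (e : R) y : ball x e y = is_true (`|x - y| < e).
Proof. by rewrite -ball_normE. Qed.

End borel.

(* Capped at 1, so as to be meaningful when [U] is the whole space. *)
HB.lock Definition depth (R : realType) (d : nat) (U : set 'rV[R]_d)
  (x : 'rV[R]_d) : R := sup [set r | 0 <= r <= 1 /\ ball x r `<=` U].

Lemma lipschitz_continuous (R : realType) (V W : normedModType R) (f : V -> W)
    (C : R) : (forall x y, `|f x - f y| <= C * `|x - y|) -> continuous f.
Proof.
move=> H x A /= /(nbhs_ballP (f x))[e /= e0 eA].
have C0 : 0 < `|C| + 1 by rewrite ltr_wpDl.
apply/nbhs_ballP; exists (e / (`|C| + 1)); first by rewrite /= divr_gt0.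
move=> y; rewrite -ball_normE /= ltr_pdivlMr// mulrC => xy.
apply: eA; rewrite -ball_normE /= (le_lt_trans (H x y))//.
rewrite (le_lt_trans _ xy)// ler_wpM2r//.
by rewrite (le_trans (ler_norm C))// lerDl.
Qed.

Section depth.
Variables (R : realType) (d : nat).
Local Notation E := 'rV[R]_d.
Implicit Types (U : set E) (x y z w : E).

Let depth_sup U x : has_sup [set r | 0 <= r <= 1 /\ ball x r `<=` U].
Proof.
split; last by exists 1 => r /= [/andP[]].
by exists 0; split; [rewrite lexx ler01|move=> y []; rewrite ltxx].
Qed.

Lemma depth_ge U x (r : R) : 0 <= r <= 1 -> ball x r `<=` U -> r <= depth U x.
Proof. by rewrite depth.unlock => r01 rU; apply: sup_upper_bound. Qed.

Lemma depth_ge0 U x : 0 <= depth U x.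
Proof. by apply: depth_ge; rewrite ?lexx ?ler01// => y []; rewrite ltxx. Qed.

Lemma depth_le1 U x : depth U x <= 1.
Proof. by rewrite depth.unlock; apply: ge_sup => [|r [/andP[]//]]; case: (depth_sup U x). Qed.

Lemma depth_ball U x (r : R) : r < depth U x -> ball x r `<=` U.
Proof.
rewrite depth.unlock => /(sup_gt (proj1 (depth_sup U x)))[s [_ sU] rs] y xy; apply: sU.
exact: le_ball (ltW rs) _ xy.
Qed.

Lemma depth_gt0 U x : open U -> U x -> 0 < depth U x.
Proof.
rewrite openE => oU /oU/nbhs_ballP[e /= e0 eU].
apply: (@lt_le_trans _ _ (Num.min e 1)); first by rewrite lt_min e0 ltr01.
apply: depth_ge; first by rewrite le_min (ltW e0) ler01 ge_min lexx orbT.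
by move=> y xy; apply: eU; apply: le_ball xy; rewrite ge_min lexx.
Qed.

Lemma depth_in U x : 0 < depth U x -> U x.
Proof.
move=> x0; apply: (@depth_ball U x (depth U x / 2)).
  by rewrite ltr_pdivrMr// ltr_pMr// ltr1n.
by apply: ballxx; rewrite divr_gt0.
Qed.

Lemma depth_out U x : ~ U x -> depth U x = 0.
Proof.
move=> Ux; apply/eqP; rewrite eq_le depth_ge0 andbT leNgt; apply/negP => x0.
by apply: Ux; exact: depth_in.
Qed.

Lemma depth_lip U x y : depth U x - `|x - y| <= depth U y.
Proof.
rewrite lerBlDr {1}depth.unlock; apply: ge_sup; first by case: (depth_sup U x).
move=> r [/andP[r0 r1] rU]; rewrite -lerBlDr.
have [rxy|xyr] := leP (r - `|x - y|) 0; first exact: le_trans rxy (depth_ge0 _ _).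
apply: depth_ge; first by rewrite (ltW xyr) (le_trans _ r1)// lerBlDr lerDl.
move=> z; rewrite ball_rVE => yz; apply: rU; rewrite ball_rVE.
have := ler_distD y x z; lra.
Qed.

Lemma depth_continuous U : continuous (depth U).
Proof.
move=> x A /= /(nbhs_ballP (depth U x))[e e0 eA].
apply/nbhs_ballP; exists e => // y; rewrite ball_rVE => xy.
apply: eA; rewrite /ball /=.
have := depth_lip U x y; have := depth_lip U y x.
rewrite [`|y - x|]distrC ltr_norml => *; apply/andP; split; lra.
Qed.

(** The ball of radius [(r + s) / 2] around [x] consists of midpoints of points of the balls of
    radii [r] and [s] around [x + v] and [x - v]: the offset is shared in proportion to the
    radii. *)
Lemma depth_midpoint U x v : convex U -> open U -> U (x + v) -> U (x - v) ->
  (depth U (x + v) + depth U (x - v)) / 2 <= depth U x.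
Proof.
move=> cU oU /(depth_gt0 oU) r0 /(depth_gt0 oU) s0.
have r1 := depth_le1 U (x + v); have s1 := depth_le1 U (x - v).
have [r rE] : exists r, r = depth U (x + v) by exists (depth U (x + v)).
have [s sE] : exists s, s = depth U (x - v) by exists (depth U (x - v)).
rewrite -rE -sE in r0 s0 r1 s1 *.
apply: depth_ge; first by apply/andP; split; lra.
move=> y; rewrite ball_rVE => xy.
have rs0 : 0 < r + s by rewrite addr_gt0.
have -> : y = (2^-1 : R) *: ((x + v) - (2 * r / (r + s)) *: (x - y)) +
              (1 - 2^-1) *: ((x - v) - (2 * s / (r + s)) *: (x - y)).
  apply/rowP => i; rewrite !mxE; field; lra.
have H w (c : R) : c = depth U w -> 0 < c -> U (w - (2 * c / (r + s)) *: (x - y)).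
  move=> cE c0; pose c' := 2 * c / (r + s) * `|x - y|.
  have c'c : c' < c.
    rewrite /c' (mulrC 2) -!mulrA gtr_pMr// mulrCA ltr_pdivrMl//; lra.
  have := @depth_ball U w ((c' + c) / 2); rewrite -cE => /(_ _) H; apply: H; first by lra.
  rewrite ball_rVE opprB addrCA subrr addr0 normrZ ger0_norm; last first.
    by rewrite divr_ge0 ?mulr_ge0// ltW.
  rewrite -/c'; lra.
by apply: cU; [exact: H|exact: H|lra|lra].
Qed.

(* In particular [t x + (1 - t) w] lies in [U] when [t < 1] and [w] does. *)
Lemma depth_conv U x w (t : R) : convex U -> closure U x -> 0 <= t <= 1 ->
  (1 - t) * depth U w <= depth U (t *: x + (1 - t) *: w).
Proof.
move=> cU Ux /andP[t0]; rewrite le_eqVlt => /predU1P[->|t1].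
  by rewrite subrr mul0r depth_ge0.
have t'0 : 0 < 1 - t by lra.
have w1 := depth_le1 U w; have w0 := depth_ge0 U w.
apply: depth_ge.
  by rewrite mulr_ge0 ?(ltW t'0)//= mulr_ile1//; lra.
move=> y; rewrite ball_rVE; set p := t *: x + _ => yp.
pose e := (1 - t) * depth U w - `|p - y|.
have e0 : 0 < e by rewrite /e subr_gt0.
have [x' [Ux']] := Ux _ (nbhsx_ballx x e e0).
rewrite ball_rVE => xx'.
(* The closure point [x] is traded for [x'] in [U]; [w'] absorbs the difference, and the slack [e]
   keeps it within the depth of [w]. *)
pose w' := (1 - t)^-1 *: (y - t *: x').
have -> : y = t *: x' + (1 - t) *: w'.
  by rewrite /w' scalerA mulfV ?gt_eqF// scale1r addrC subrK.
apply: cU => //; last exact: ltW.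
pose c := `|w - w'|.
have cw : c < depth U w.
  rewrite /c; have -> : w - w' = (1 - t)^-1 *: ((p - y) - t *: (x - x')).
    rewrite /w' /p; apply/rowP => i; rewrite !mxE; field; lra.
  rewrite normrZ ger0_norm ?invr_ge0 ?ltW// ltr_pdivrMl//.
  rewrite (le_lt_trans (ler_normB _ _))// normrZ ger0_norm//.
  have : t * `|x - x'| <= `|x - x'| by rewrite ler_piMl// ltW.
  move: xx'; rewrite /e; lra.
apply: (@depth_ball U w ((c + depth U w) / 2)); first by lra.
rewrite ball_rVE -/c; lra.
Qed.

End depth.

(** * Uniform continuity on compact subsets of an open set *)

Section continuity.
Variables (R : realType) (d : nat).
Local Notation E := 'rV[R]_d.
Implicit Types (U K : set E) (x y z w : E) (f : E -> R).

Lemma Cb_near U f : open U -> Cb U f -> forall x, U x -> forall e : R, 0 < e ->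
  exists2 delta : R, 0 < delta & forall y, `|x - y| < delta -> `|f x - f y| < e.
Proof.
move=> oU [/subspace_continuousP cf _] x Ux e e0.
have /nbhs_ballP[a /= a0 aH] := cf x Ux _ (nbhsx_ballx (f x) e e0).
move: oU; rewrite openE => /(_ _ Ux)/nbhs_ballP[b /= b0 bU].
exists (Num.min a b); first by rewrite lt_min a0 b0.
move=> y; rewrite lt_min => /andP[xya xyb].
by apply: (aH y); [rewrite ball_rVE|apply: bU; rewrite ball_rVE].
Qed.

Lemma near_Cb U f : (exists M : R, forall x, U x -> `|f x| <= M) ->
  (forall x, U x -> forall e : R, 0 < e -> exists2 delta : R, 0 < delta &
    forall y, U y -> `|x - y| < delta -> `|f x - f y| < e) -> Cb U f.
Proof.
move=> bf H; split=> //; apply/subspace_continuousP => x Ux.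
move=> A /= /(nbhs_ballP (f x))[e /= e0 eA].
have [delta d0 dH] := H x Ux e e0.
apply/nbhs_ballP; exists delta => // y; rewrite ball_rVE => xy Uy.
by apply: eA; exact: dH.
Qed.

(** Only [x] is confined to [K]: compactness of [K] inside the open [U] provides a margin around [K]
    together with the uniformity. *)
Lemma heine U K f (e : R) : open U -> Cb U f -> K `<=` U -> compact K -> 0 < e ->
  exists2 delta : R, 0 < delta & forall x y, K x -> `|x - y| < delta ->
    `|f x - f y| <= e.
Proof.
move=> oU Cf KU /compact_near_coveringP cK e0.
have [N _ HN] : \forall n \near \oo, K `<=` [set x | forall y, `|x - y| < n.+1%:R^-1 ->
    `|f x - f y| <= e].
  apply: (cK nat \oo (fun n x => forall y, `|x - y| < n.+1%:R^-1 -> `|f x - f y| <= e)).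
  move=> x Kx; have [|delta d0 dH] := Cb_near oU Cf (KU _ Kx) (e := e / 2).
    by rewrite divr_gt0.
  have d20 : 0 < delta / 2 by rewrite divr_gt0.
  have [N HN] := inv_succ_lt d20.
  exists (ball x (delta / 2), [set n | (N <= n)%N]) => /=.
    by split; [exact: nbhsx_ballx|exists N].
  move=> [x' n] [/= + Nn] y x'y; rewrite ball_rVE => xx'.
  have := HN _ Nn; move: x'y; move: (n.+1%:R^-1) => c x'y cd.
  have h1 : `|x - y| < delta.
    by have := ler_distD x' x y; lra.
  have h2 : `|x - x'| < delta by lra.
  have := dH _ h1; have := dH _ h2.
  by rewrite [X in X < _ -> _]distrC; have := ler_distD (f x) (f x') (f y); lra.
exists N.+1%:R^-1; first by rewrite invr_gt0.
by move=> x y Kx; exact: (HN N (leqnn _) x Kx).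
Qed.

Lemma compact_depth U (rho : R) : bounded_set U -> 0 < rho ->
  compact [set x | rho <= depth U x] /\ [set x | rho <= depth U x] `<=` U.
Proof.
move=> bU r0.
have KU : [set x | rho <= depth U x] `<=` U.
  by move=> x /= rx; apply: depth_in; exact: lt_le_trans rx.
split=> //; apply: bounded_closed_compact.
  by move: bU => [M [Mr UM]]; exists M; split=> // N MN x /KU; exact: UM.
rewrite (_ : mkset _ = depth U @^-1` [set r | rho <= r]) //.
apply: closed_comp => [x _|]; first exact: depth_continuous.
exact: closed_ge.
Qed.

End continuity.

(** * Laws determined by their values on open sets *)

Section law.
Variables (R : realType) (d : nat) (P Q : probability (Rd R d) R).

(** Approximations of the indicator of [U] from below that are Lipschitz and, on a convex open [U],
    concave. The first property makes them admissible in the representation, the second makes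
    [1 - bump] subharmonic. *)
Definition bump (U : set 'rV[R]_d) (k : nat) (x : 'rV[R]_d) : R :=
  Num.min 1 (k%:R * depth U x).

Lemma bump01 U k x : 0 <= bump U k x <= 1.
Proof.
by rewrite /bump le_min ler01 mulr_ge0 ?depth_ge0//= ge_min lexx.
Qed.

Lemma bump_lip U k x y : `|bump U k x - bump U k y| <= k%:R * `|x - y|.
Proof.
have H u v : bump U k u - bump U k v <= k%:R * `|u - v|.
  have h : k%:R * depth U u <= k%:R * depth U v + k%:R * `|u - v|.
    by rewrite -mulrDr ler_wpM2l//; have := depth_lip U u v; lra.
  have h0 : 0 <= k%:R * `|u - v| by rewrite mulr_ge0.
  by rewrite /bump !minEle; case: ifP; case: ifP; lra.
by rewrite ler_norml H andbT lerNl opprB distrC H.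
Qed.

Lemma bump_measurable U k : measurable_fun setT (bump U k : Rd R d -> R).
Proof.
apply: measurable_minr => //; apply: measurable_funM => //.
by apply: measurable_continuous_rV; exact: depth_continuous.
Qed.

Lemma bump_cvg U x : open U -> bump U k x @[k --> \oo] --> (\1_U x : R).
Proof.
move=> oU; have [Ux|nUx] := pselect (U x).
  rewrite indicE mem_set//=; apply: cvg_near_cst.
  have x0 := depth_gt0 oU Ux; exists (Num.truncn (depth U x)^-1).+1 => // k /= kx.
  rewrite /bump; apply/min_idPl; rewrite -ler_pdivrMr// mul1r.
  have /truncn_itv/andP[_ /ltW h] : 0 <= (depth U x)^-1 by rewrite invr_ge0 ltW.
  by rewrite (le_trans h)// ler_nat.
rewrite indicE memNset//= (_ : (fun k => _) = fun=> 0); first exact: cvg_cst.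
by apply/funext => k; rewrite /bump depth_out// mulr0; apply/min_idPr.
Qed.

(** Dominated convergence recovers the measure of every open set, and open sets form a generating
    class stable under intersection. *)
Lemma eq_law : (forall U k, open U -> \int[P]_x bump U k x = \int[Q]_x bump U k x) ->
  forall A : set (Rd R d), measurable A -> P A = Q A.
Proof.
move=> H A mA; apply: (@measure_unique _ R (Rd R d) (@open 'rV[R]_d) (fun=> setT)
  erefl _ _ _ P Q) => //.
- by move=> B C; exact: openI.
- by move=> ?; exact: openT.
- by rewrite bigcup_const.
- move=> U oU.
  have cvgU (M : probability (Rd R d) R) :
      \int[M]_x bump U k x @[k --> \oo] --> fine (M U).
    have -> : fine (M U) = \int[M]_x (\1_U x).
      by rewrite /Rintegral integral_indic ?setIT//; exact: measurable_open.
    apply: (@cvg_bmeas_Rintegral _ _ _ _ _ _ _ 1) => //.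
    - by move=> k; exact: bump_measurable.
    - by apply: measurable_indic; exact: measurable_open.
    - by move=> k x _; have /andP[? ?] := bump01 U k x; rewrite ger0_norm.
    - by move=> x _; exact: bump_cvg.
  have cQ := cvgU Q; rewrite (_ : (fun k => _) = fun k => \int[P]_x bump U k x) in cQ; last first.
    by apply/funext => k; rewrite H.
  have h : fine (P U) = fine (Q U) := cvg_unique (@Rhausdorff R) (cvgU P) cQ.
  have mU := measurable_open oU.
  rewrite -[LHS]fineK ?h ?fineK//; exact: fin_num_measure.
- by move=> k; rewrite [ltLHS](probability_setT P) ltry.
Qed.

End law.

(** * Subharmonic functions *)

Section squared_distance.
Variables (R : realType) (d : nat).
Local Notation E := 'rV[R]_d.
Implicit Types (U : set E) (x y z w : E).

Lemma eucl2_ge0 x y : 0 <= eucl2 x y.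
Proof. by apply: sumr_ge0 => i _; exact: sqr_ge0. Qed.

Lemma eucl2C x y : eucl2 x y = eucl2 y x.
Proof. by apply: eq_bigr => i _; rewrite -sqrrN opprB. Qed.

Lemma coord_le_norm x i : `|x ord0 i| <= `|x|.
Proof.
rewrite [leRHS]/Num.Def.normr /= mx_normrE.
by apply/bigmax_geP; right => /=; exists (ord0, i).
Qed.

(** In each coordinate the difference of squares factors as [(u - v) * (u + v)], where [u] and [v]
    are bounded by [2 * B]; whence [4 * B], summed over [d] coordinates. *)
Lemma eucl2_lip (B : R) x y x' y' : 0 <= B ->
  (forall i, `|x ord0 i| <= B) -> (forall i, `|y ord0 i| <= B) ->
  (forall i, `|x' ord0 i| <= B) -> (forall i, `|y' ord0 i| <= B) ->
  `|eucl2 x y - eucl2 x' y'| <= 4 * d%:R * B * (`|x - x'| + `|y - y'|).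
Proof.
move=> B0 xB yB x'B y'B; rewrite /eucl2 -sumrB.
have -> : 4 * d%:R * B * (`|x - x'| + `|y - y'|) =
    \sum_(i < d) 4 * B * (`|x - x'| + `|y - y'|).
  by rewrite sumr_const card_ord -mulr_natr; ring.
apply: le_trans (ler_norm_sum _ _ _) _; apply: ler_sum => i _.
rewrite subr_sqr normrM mulrC ler_pM//.
- rewrite (le_trans (ler_normD _ _))//.
  have := ler_normB (x ord0 i) (y ord0 i); have := ler_normB (x' ord0 i) (y' ord0 i).
  by have := xB i; have := yB i; have := x'B i; have := y'B i; lra.
- have := coord_le_norm (x - x') i; have := coord_le_norm (y - y') i; rewrite !mxE.
  have -> : x ord0 i - y ord0 i - (x' ord0 i - y' ord0 i) =
    (x ord0 i - x' ord0 i) - (y ord0 i - y' ord0 i) by ring.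
  by have := ler_normB (x ord0 i - x' ord0 i) (y ord0 i - y' ord0 i); lra.
Qed.

Lemma eucl2_le (B : R) x y : 0 <= B ->
  (forall i, `|x ord0 i| <= B) -> (forall i, `|y ord0 i| <= B) ->
  eucl2 x y <= 4 * d%:R * B * (`|x| + `|y|).
Proof.
move=> B0 xB yB; have z0 : forall i, `|(0 : E) ord0 i| <= B by move=> i; rewrite mxE normr0.
have := eucl2_lip B0 xB yB z0 z0; rewrite !subr0; apply: le_trans.
have -> : eucl2 (0 : E) 0 = 0 by apply: big1 => i _; rewrite !mxE subrr expr0n.
by rewrite subr0 ler_norm.
Qed.

Lemma measurable_coord i : measurable_fun setT (fun x : Rd R d => (x : E) ord0 i).
Proof.
by apply: measurable_continuous_rV; exact: coord_continuous.
Qed.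

Lemma measurable_eucl2 d' (T : measurableType d') (f g : T -> Rd R d) :
  measurable_fun setT f -> measurable_fun setT g ->
  measurable_fun setT (fun u => eucl2 (f u) (g u)).
Proof.
move=> mf mg; apply: measurable_sum => i; apply: measurable_funX.
by apply: measurable_funB; exact: measurableT_comp (measurable_coord i) _.
Qed.

Lemma eball_sphere x0 (r : R) w : eucl2 w 0 = 1 -> eball x0 r (x0 + r *: w).
Proof.
move=> w1; have -> : eball x0 r (x0 + r *: w) = (r ^+ 2 * eucl2 w 0 <= r ^+ 2).
  congr (is_true (_ <= _)); rewrite /eucl2 mulr_sumr.
  by apply: eq_bigr => i _; rewrite !mxE; ring.
by rewrite w1 mulr1.
Qed.

Lemma eucl2N0 w : eucl2 (- w) 0 = eucl2 w 0.
Proof. by apply: eq_bigr => i _; rewrite !mxE !subr0 sqrrN. Qed.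

Lemma eball_contract U x0 z (r t : R) : convex U -> U z -> 0 < t <= 1 ->
  eball x0 r `<=` U -> eball (t *: x0 + (1 - t) *: z) (t * r) `<=` U.
Proof.
move=> cU Uz /andP[t0 t1] x0U y; rewrite /eball /= => H.
have -> : y = t *: (t^-1 *: (y - (1 - t) *: z)) + (1 - t) *: z.
  by rewrite scalerA mulfV ?gt_eqF// scale1r subrK.
apply: cU => //; last exact: ltW.
apply: x0U; rewrite /eball /= -(@ler_pM2l _ (t ^+ 2)) ?exprn_gt0// -exprMn.
apply: le_trans H; rewrite le_eqVlt; apply/orP; left; apply/eqP.
rewrite /eucl2 mulr_sumr; apply: eq_bigr => i _; rewrite !mxE; field.
by rewrite gt_eqF.
Qed.

End squared_distance.

Lemma Cb_Sb (R : realType) (d : nat) (U : set 'rV[R]_d) (f : 'rV[R]_d -> R) :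
  open U -> Cb U f -> Sb U f.
Proof.
move=> oU Cf; split; last by have [] := Cf.
apply: measurable_fun_ltP => [|c]; first exact: measurable_open.
apply: measurable_open; rewrite openE => x [Ux /= fxc].
have [|e e0 eH] := Cb_near oU Cf Ux (e := c - f x); first by rewrite subr_gt0.
move: (oU); rewrite openE => /(_ _ Ux)/nbhs_ballP[r /= r0 rU].
apply/nbhs_ballP; exists (Num.min e r); first by rewrite /= lt_min e0 r0.
move=> y; rewrite ball_rVE lt_min => /andP[xye xyr]; split.
  by apply: rU; rewrite ball_rVE.
by have := eH _ xye; rewrite /= ltr_norml => /andP[]; lra.
Qed.

Section sphere.
Variables (R : realType) (d : nat).
Local Notation E := 'rV[R]_d.
Implicit Types (U : set E) (x y z w : E) (f g : E -> R) (s : probability (Rd R d) R).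

Definition sphere : set (Rd R d) := [set w : E | eucl2 w 0 = 1].

Lemma measurable_sphere : measurable sphere.
Proof.
have m : measurable_fun setT (fun w : Rd R d => eucl2 (w : E) 0).
  by apply: measurable_eucl2 => //; exact: measurable_id.
have := m measurableT [set 1] (measurable_set1 1).
by rewrite setTI.
Qed.

Lemma measurable_affine x (r : R) :
  measurable_fun setT (fun w : Rd R d => (x + r *: (w : E)) : Rd R d).
Proof.
apply: measurable_fun_Rd => U oU; apply: measurable_open.
apply: open_comp oU => w _.
apply: (@lipschitz_continuous R E E (fun w => x + r *: w) `|r|) => u v.
by rewrite -normrZ opprD addrACA subrr add0r scalerBr.
Qed.

Lemma bmeas_sphere U f x (r : R) : open U -> Sb U f -> eball x r `<=` U ->
  bmeas sphere (fun w : Rd R d => f (x + r *: (w : E))).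
Proof.
move=> oU [mf [M fM]] xrU; split; last first.
  by exists M => w w1; apply/fM/xrU/eball_sphere.
apply: (@measurable_comp _ _ _ _ _ _ (U : set (Rd R d)) f).
- exact: measurable_open.
- by move=> _ [w w1 <-]; apply/xrU/eball_sphere.
- exact: mf.
- by apply: measurable_funTS; exact: measurable_affine.
Qed.

(** Off the sphere the point [x + r *: w] may leave [U], where nothing is known about the integrand,
    not even measurability. The whole-space integral in [subharmonic] is therefore cut down to the
    sphere, which carries [s]. *)
Lemma sphere_integral s (h : E -> R) : normalized_sphere_measure s ->
  bmeas sphere (h : Rd R d -> R) ->
  (\int[s]_w (h w)%:E)%E = (\int[s]_(w in sphere) h w)%:E.
Proof.
move=> [s0 _] bh; have mS := measurable_sphere.
rewrite (integral_full_eq (g := (EFin \o h) \_ sphere) mS s0); last first.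
  by move=> w wS; rewrite patchE wS.
by rewrite -integral_mkcond; exact: EFin_Rintegral.
Qed.

Definition submean U f := forall x (r : R), 0 < r -> eball x r `<=` U ->
  forall s, normalized_sphere_measure s ->
  f x <= \int[s]_(w in sphere) f (x + r *: (w : E)).

Lemma subharmonicP U f : open U -> Sb U f ->
  subharmonic U f <-> usc_on U f /\ submean U f.
Proof.
move=> oU Sf; split=> -[uf H]; split=> // x r r0 xrU s sP.
  have := H x r r0 xrU s sP.
  rewrite (@sphere_integral s (fun w => f (x + r *: w)))// ?lee_fin//.
  exact: (bmeas_sphere oU).
rewrite (@sphere_integral s (fun w => f (x + r *: w)))// ?lee_fin; first exact: H.
exact: (bmeas_sphere oU).
Qed.

Definition Sbsub U f := Sb U f /\ subharmonic U f.

Lemma Sbsub_cst U (c : R) : open U -> Sbsub U (fun=> c).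
Proof.
move=> oU; have Sc : Sb U (fun=> c) by exact: bmeas_cst.
split=> //; apply/subharmonicP => //; split.
  by move=> x Ux e e0; exists 1 => // y _ _; rewrite ltrDl.
move=> x r r0 xrU s sP; rewrite Rintegral_prob_cst//; first exact: measurable_sphere.
by have [] := sP.
Qed.

Lemma Sbsub_sumof U f g : open U -> Sbsub U f -> Sbsub U g ->
  Sbsub U (fun x => f x + g x).
Proof.
move=> oU [Sf hf] [Sg hg]; have Sfg : Sb U (fun x => f x + g x) by exact: bmeasD.
split=> //; apply/subharmonicP => //.
move: hf hg => /subharmonicP[//|//|uf hf] /subharmonicP[//|//|ug hg]; split.
  move=> x Ux e e0; have e20 : 0 < e / 2 by rewrite divr_gt0.
  have [a a0 fa] := uf x Ux _ e20; have [b b0 gb] := ug x Ux _ e20.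
  exists (Num.min a b); first by rewrite lt_min a0 b0.
  move=> y Uy; rewrite ball_rVE lt_min => /andP[xa xb].
  have := fa _ Uy; have := gb _ Uy; rewrite !ball_rVE => /(_ xb) + /(_ xa).
  by lra.
move=> x r r0 xrU s sP; rewrite bmeas_RintegralD ?lerD//.
- exact: hf.
- exact: hg.
- exact: measurable_sphere.
- exact: (bmeas_sphere oU).
- exact: (bmeas_sphere oU).
Qed.

Lemma Sbsub_scale U (a : R) f : open U -> 0 <= a -> Sbsub U f ->
  Sbsub U (fun x => a * f x).
Proof.
move=> oU; rewrite le_eqVlt => /predU1P[<- _|a0 [Sf hf]].
  have -> : (fun x => 0 * f x) = fun=> 0 by apply/funext => x; rewrite mul0r.
  exact: Sbsub_cst.
have Saf : Sb U (fun x => a * f x) by exact: bmeasZ.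
split=> //; apply/subharmonicP => //.
move: hf => /subharmonicP[//|//|uf hf]; split.
  move=> x Ux e e0; have [b b0 fb] := uf x Ux (e / a) (divr_gt0 e0 a0).
  exists b => // y Uy xy; have := fb y Uy xy.
  by rewrite -(ltr_pM2l a0) mulrDr mulrCA mulfV ?mulr1// gt_eqF.
move=> x r r0 xrU s sP; rewrite bmeas_RintegralZ.
- by rewrite ler_pM2l//; exact: hf.
- exact: measurable_sphere.
- exact: (bmeas_sphere oU).
Qed.

(** The reflection is the orthogonal map [- 1%:M], so the invariance of [s] applies. *)
Lemma sphere_symmetric s (g : E -> R) : normalized_sphere_measure s ->
  bmeas sphere (g : Rd R d -> R) ->
  \int[s]_(w in sphere) g (- (w : E)) = \int[s]_(w in sphere) g w.
Proof.
move=> [_ sM] bg; apply/esym.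
have mN : measurable_fun setT (fun w : Rd R d => (- (w : E)) : Rd R d).
  have -> : (fun w : Rd R d => (- (w : E)) : Rd R d) = fun w => 0 + (-1) *: (w : E).
    by apply/funext => w; rewrite add0r scaleN1r.
  exact: measurable_affine.
have H A : measurable A -> s A = s ((fun w : Rd R d => (- (w : E)) : Rd R d) @^-1` A).
  move=> mA; rewrite -[LHS](sM (- 1%:M) _ A mA); last first.
    by rewrite linearN /= trmx1 mulNmx mulmxN opprK mulmx1.
  have -> // : (fun w : E => w *m - 1%:M) = -%R.
  by apply/funext => w; rewrite mulmxN mulmx1.
rewrite (Rintegral_law mN H measurable_sphere bg).
congr (Rintegral _ _ _); apply/seteqP.
by split=> w; rewrite /sphere /= eucl2N0.
Qed.

(** Averaging the hypothesis over [v = r *: w] and pairing [w] with [- w] gives the mean-value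
    inequality for every admissible [s]. *)
Lemma midpoint_submean U f : open U -> Sb U f ->
  (forall x v, U (x + v) -> U (x - v) -> f x <= (f (x + v) + f (x - v)) / 2) ->
  submean U f.
Proof.
move=> oU Sf H x r r0 xrU s sP; have mS := measurable_sphere.
have bg := bmeas_sphere oU Sf xrU.
pose g w := f (x + r *: w).
have bg' : bmeas sphere (fun w : Rd R d => g (- (w : E))).
  have := @bmeas_sphere U f x (- r) oU Sf.
  have -> : (fun w : Rd R d => f (x + - r *: (w : E))) = fun w => g (- (w : E)).
    by apply/funext => w; rewrite /g scalerN scaleNr.
  by apply; rewrite /eball /= sqrrN; exact: xrU.
have E2 : \int[s]_(w in sphere) (g w + g (- (w : E))) = 2 * \int[s]_(w in sphere) g w.
  by rewrite bmeas_RintegralD// (sphere_symmetric sP)//; ring.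
have : 2 * f x <= \int[s]_(w in sphere) (g w + g (- (w : E))).
  rewrite -(@Rintegral_prob_cst _ _ _ s sphere (2 * f x))//; last by case: sP.
  apply: le_bmeas_Rintegral => //; [exact: bmeas_cst|exact: bmeasD|].
  move=> w w1; have := H x (r *: w); rewrite /g scalerN => Hw.
  have {}Hw : f x <= (f (x + r *: w) + f (x - r *: w)) / 2.
    apply: Hw; first exact/xrU/eball_sphere.
    rewrite -scalerN; apply/xrU/eball_sphere.
    by rewrite eucl2N0.
  by lra.
by rewrite E2 ler_pM2l.
Qed.

Lemma dilation_in U x z (t : R) : convex U -> U x -> U z -> 0 <= t <= 1 ->
  U (t *: x + (1 - t) *: z).
Proof. by move=> cU Ux Uz /andP[t0 t1]; exact: cU. Qed.

Lemma dilation_bmeas U f z (t : R) : open U -> convex U -> U z -> 0 <= t <= 1 ->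
  Sb U f -> Sb U (fun x => f (t *: x + (1 - t) *: z)).
Proof.
move=> oU cU Uz t01 [mf [M fM]]; split; last first.
  by exists M => x Ux; apply: fM; exact: dilation_in.
apply: (@measurable_comp _ _ _ _ _ _ (U : set (Rd R d)) f).
- exact: measurable_open.
- by move=> _ [x Ux <-]; exact: dilation_in.
- exact: mf.
- apply: measurable_funTS; under eq_fun do rewrite addrC.
  exact: measurable_affine.
Qed.

Lemma dilation_submean U f z (t : R) : open U -> convex U -> U z -> 0 <= t <= 1 ->
  submean U f -> submean U (fun x => f (t *: x + (1 - t) *: z)).
Proof.
(* Ratio [0] is set apart: the radius [t * r] would vanish, but the function is then constant. *)
move=> oU cU Uz /andP[]; rewrite le_eqVlt => /predU1P[<- _ _|t0 t1 hf].
  move=> x r r0 xrU s sP.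
  have -> : (fun w : Rd R d => f (0 *: (x + r *: (w : E)) + (1 - 0) *: z)) =
      fun=> f (0 *: x + (1 - 0) *: z).
    by apply/funext => w; rewrite !scale0r.
  rewrite Rintegral_prob_cst//; first exact: measurable_sphere.
  by case: sP.
move=> x r r0 xrU s sP.
have := hf (t *: x + (1 - t) *: z) (t * r) (mulr_gt0 t0 r0).
have t01 : 0 < t <= 1 by rewrite t0 t1.
move=> /(_ (eball_contract cU Uz t01 xrU) s sP).
congr (_ <= Rintegral _ _ _); apply/funext => w.
by congr f; rewrite scalerDr scalerA addrAC.
Qed.

Lemma dilation_usc U f z (t : R) : convex U -> U z -> 0 <= t <= 1 ->
  usc_on U f -> usc_on U (fun x => f (t *: x + (1 - t) *: z)).
Proof.
move=> cU Uz t01 uf x Ux e e0; have [t0 t1] := andP t01.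
have [b b0 fb] := uf _ (dilation_in cU Ux Uz t01) e e0.
exists b => // y Uy; rewrite ball_rVE => xy.
apply: fb; first exact: dilation_in.
rewrite ball_rVE opprD addrACA subrr addr0 -scalerBr normrZ ger0_norm//.
by rewrite (le_lt_trans _ xy)// ler_piMl.
Qed.

Lemma Sbsub_dilation U f z (t : R) : open U -> convex U -> U z -> 0 <= t <= 1 ->
  Sbsub U f -> Sbsub U (fun x => f (t *: x + (1 - t) *: z)).
Proof.
move=> oU cU Uz t01 [Sf /subharmonicP[//|//|uf mf]].
have Sg := dilation_bmeas oU cU Uz t01 Sf.
split=> //; apply/subharmonicP => //.
by split; [exact: dilation_usc|exact: dilation_submean].
Qed.

End sphere.

(** * Continuous subharmonic majorants of bounded families *)

HB.lock Definition sup_regularization (R : realType) (d : nat)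
  (U : set 'rV[R]_d) (I : Type) (b : I -> 'rV[R]_d -> R) (k : R)
  (x : 'rV[R]_d) : R :=
  sup [set v | exists i t z,
    [/\ 0 <= t <= 1, U z & v = b i (t *: x + (1 - t) *: z) - k * (1 - t)]].

Section sup_regularization.
Variables (R : realType) (d : nat) (U : set 'rV[R]_d).
Hypotheses (oU : open U) (cU : convex U).
Variables (I : Type) (i0 : I) (b : I -> 'rV[R]_d -> R) (M k : R).
Hypotheses (bM : forall i x, U x -> `|b i x| <= M) (k0 : 0 < k).
Implicit Types (x y z : 'rV[R]_d).

Local Notation reg := (sup_regularization U b k).

Let vals x := [set v | exists i t z,
    [/\ 0 <= t <= 1, U z & v = b i (t *: x + (1 - t) *: z) - k * (1 - t)]].

Let vals_le x v : U x -> vals x v -> v <= M.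
Proof.
move=> Ux [i [t [z [t01 Uz ->]]]].
have := bM i (dilation_in cU Ux Uz t01); rewrite ler_norml => /andP[_].
have : 0 <= k * (1 - t) by rewrite mulr_ge0 ?(ltW k0)// subr_ge0; case/andP: t01.
by lra.
Qed.

Let vals_b i x : U x -> vals x (b i x).
Proof.
move=> Ux; exists i, 1, x; split => //; first by rewrite ler01 lexx.
by rewrite subrr mulr0 subr0 scale1r scale0r addr0.
Qed.

Let vals_sup x : U x -> has_sup (vals x).
Proof.
move=> Ux; split; first by exists (b i0 x); exact: vals_b.
by exists M => v; exact: vals_le.
Qed.

Lemma sup_regularization_ge_dil i x z (t : R) : U x -> U z -> 0 <= t <= 1 ->
  b i (t *: x + (1 - t) *: z) - k * (1 - t) <= reg x.
Proof.
move=> Ux Uz t01; rewrite sup_regularization.unlock.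
by apply: sup_upper_bound; [exact: vals_sup|exists i, t, z].
Qed.

Lemma sup_regularization_ge i x : U x -> b i x <= reg x.
Proof.
move=> Ux; rewrite sup_regularization.unlock.
by apply: sup_upper_bound; [exact: vals_sup|exact: vals_b].
Qed.

Lemma sup_regularization_le x (C : R) : U x ->
  (forall i z t, U z -> 0 <= t <= 1 ->
    b i (t *: x + (1 - t) *: z) - k * (1 - t) <= C) -> reg x <= C.
Proof.
move=> Ux H; rewrite sup_regularization.unlock.
apply: ge_sup; first by case: (vals_sup Ux).
by move=> v [i [t [z [t01 Uz ->]]]]; exact: H.
Qed.

Lemma sup_regularization_bounded x : U x -> `|reg x| <= M.
Proof.
move=> Ux; rewrite ler_norml; apply/andP; split.
  rewrite (le_trans _ (sup_regularization_ge i0 Ux))//.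
  by have := bM i0 Ux; rewrite ler_norml => /andP[].
apply: sup_regularization_le => // i z t Uz t01.
by apply: (@vals_le x) => //; exists i, t, z.
Qed.

(* Moving [x'] back to [x] costs a decrease of [t] by [delta]. *)
Lemma sup_regularization_near x x' (delta : R) : U x -> U x' -> 0 < delta ->
  `|x - x'| < delta * depth U x -> reg x' <= reg x + k * delta.
Proof.
move=> Ux Ux' d0 xx'; apply: sup_regularization_le => // i z t Uz /andP[t0 t1].
(* A small ratio is dropped: the target point itself is reached from [x] with ratio [0], at an extra
   cost [k * t]. *)
have [td|dt] := leP t delta.
  have Uu : U (t *: x' + (1 - t) *: z) by apply: dilation_in => //; rewrite t0 t1.
  have := @sup_regularization_ge_dil i x _ 0 Ux Uu; rewrite lexx ler01 => /(_ isT).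
  rewrite scale0r add0r subr0 scale1r mulr1.
  have : k * t <= k * delta by rewrite ler_pM2l.
  by rewrite mulrBr mulr1; lra.
(* The displacement [x' - x] is magnified by [t / delta]; the closeness hypothesis is exactly what
   keeps [u] in [U]. *)
pose u := x + (t / delta) *: (x' - x).
have Uu : U u.
  have hD : `|x - x'| / delta < depth U x by rewrite ltr_pdivrMr// [ltRHS]mulrC.
  apply: (depth_ball (r := (`|x - x'| / delta + depth U x) / 2)); first by lra.
  rewrite ball_rVE /u opprD addrA subrr add0r normrN normrZ ger0_norm; last first.
    by rewrite divr_ge0// ltW.
  have : t / delta * `|x' - x| <= `|x - x'| / delta.
    by rewrite distrC mulrC mulrA ler_pM2r ?invr_gt0// ler_piMr.
  by lra.
pose c := 1 - t + delta; have c0 : 0 < c by rewrite /c; lra.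
(* These weights solve [(t - delta) x + (1 - t + delta) w = t x' + (1 - t) z], so the target is
   reached from [x] with the smaller ratio [t - delta]. *)
pose w := (delta / c) *: u + (1 - delta / c) *: z.
have Uw : U w.
  apply: dilation_in => //; rewrite divr_ge0 ?(ltW d0) ?(ltW c0)//=.
  by rewrite ler_pdivrMr// mul1r /c; lra.
have t'01 : 0 <= t - delta <= 1 by apply/andP; split; lra.
have := @sup_regularization_ge_dil i x w (t - delta) Ux Uw t'01.
have -> : (t - delta) *: x + (1 - (t - delta)) *: w = t *: x' + (1 - t) *: z.
  rewrite /w /u /c; apply/rowP => j; rewrite !mxE; field.
  by apply/andP; split; rewrite gt_eqF//; lra.
have -> : k * (1 - (t - delta)) = k * (1 - t) + k * delta by ring.
by lra.
Qed.

(** The one-sided estimate is used in both directions. Halving the radius transfers the margin from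
    [depth U x] to [depth U y], since [depth] is 1-Lipschitz and [delta <= 1]. *)
Lemma sup_regularization_Cb : Cb U reg.
Proof.
apply: near_Cb; first by exists M => x; exact: sup_regularization_bounded.
move=> x Ux e e0; have x0 := depth_gt0 oU Ux.
pose delta := Num.min 1 (e / (2 * k)).
have d0 : 0 < delta by rewrite lt_min ltr01 divr_gt0// mulr_gt0.
have d1 : delta <= 1 by rewrite ge_min lexx.
have kd : k * delta < e.
  have : delta <= e / (2 * k) by rewrite ge_min lexx orbT.
  rewrite ler_pdivlMr ?mulr_gt0//.
  have : 0 < delta * k by rewrite mulr_gt0.
  by rewrite mulrC; lra.
exists (delta * depth U x / 2); first by rewrite divr_gt0 ?mulr_gt0.
move=> y Uy xy.
have hx : `|x - y| < delta * depth U x.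
  by have := mulr_gt0 d0 x0; lra.
have hy : `|y - x| < delta * depth U y.
  rewrite distrC; have := depth_lip U x y => h.
  have : delta * (depth U x - `|x - y|) <= delta * depth U y by rewrite ler_pM2l.
  have : delta * depth U x <= depth U x by rewrite ler_piMl// ltW.
  have : delta * `|x - y| <= `|x - y| by rewrite ler_piMl.
  by rewrite mulrBr; lra.
have := sup_regularization_near Ux Uy d0 hx.
have := sup_regularization_near Uy Ux d0 hy.
by rewrite ltr_norml => *; apply/andP; split; lra.
Qed.

(** Each dilated and penalized function satisfies the mean-value inequality and lies below the
    regularization. The supremum inherits the inequality, and its continuity supplies measurability
    and semicontinuity. *)
Lemma sup_regularization_subharmonic : (forall i, Sbsub U (b i)) ->
  subharmonic U reg.
Proof.
move=> hb; have SC := Cb_Sb oU sup_regularization_Cb.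
apply/subharmonicP => //; split.
  move=> x Ux e e0.
  have [a a0 aH] := Cb_near oU sup_regularization_Cb Ux e0.
  exists a => // y Uy; rewrite ball_rVE => /aH; rewrite ltr_norml => /andP[]; lra.
move=> x r r0 xrU s sP; have mS := @measurable_sphere R d.
have Ux : U x.
  apply: xrU; rewrite /eball /= /eucl2 big1 ?sqr_ge0// => i _.
  by rewrite subrr expr0n.
apply: sup_regularization_le => // i z t Uz t01.
have [Sb_ hs] := Sbsub_dilation oU cU Uz t01 (hb i).
have bi := bmeas_sphere oU Sb_ xrU.
have [_ /(_ x r r0 xrU s sP) h] := (subharmonicP oU Sb_).1 hs.
apply: le_trans (lerB h (lexx _)) _.
have bc : bmeas (@sphere R d) (fun=> - (k * (1 - t))) by exact: bmeas_cst.
rewrite -(@Rintegral_prob_cst _ _ _ s _ (- (k * (1 - t))) mS); last by case: sP.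
rewrite -bmeas_RintegralD//; apply: le_bmeas_Rintegral => //.
- exact: bmeasD.
- exact: (bmeas_sphere oU SC).
- by move=> w w1; apply: sup_regularization_ge_dil => //; exact/xrU/eball_sphere.
Qed.

(** A ratio with [k * (1 - t) > 2 * M] loses more than the oscillation of the family and cannot beat
    [b i x]. The other ratios move [x] by at most [2 * M / k * D]. *)
Lemma sup_regularization_upper x (C D : R) : U x ->
  (forall z, U z -> `|z - x| <= D) ->
  (forall i u, U u -> `|u - x| <= 2 * M / k * D -> b i u <= C) -> reg x <= C.
Proof.
move=> Ux xD H; have D0 : 0 <= D by rewrite (le_trans _ (xD _ Ux)).
have M0 : 0 <= M by rewrite (le_trans _ (bM i0 Ux)).
apply: sup_regularization_le => // i z t Uz /andP[t0 t1].
have Uu : U (t *: x + (1 - t) *: z) by apply: dilation_in => //; rewrite t0 t1.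
have [kt|kt] := ltP (2 * M) (k * (1 - t)).
  have h1 : - M <= b i x by have := bM i Ux; rewrite ler_norml => /andP[].
  have h2 : b i x <= C.
    by apply: H => //; rewrite subrr normr0 !mulr_ge0// invr_ge0 ltW.
  by have := bM i Uu; rewrite ler_norml => /andP[]; lra.
have kt0 : 0 <= k * (1 - t) by rewrite mulr_ge0 ?(ltW k0)//; lra.
have : b i (t *: x + (1 - t) *: z) <= C; last by lra.
apply: H => //.
have -> : t *: x + (1 - t) *: z - x = (1 - t) *: (z - x).
  by apply/rowP => j; rewrite !mxE; ring.
rewrite normrZ ger0_norm; last by lra.
apply: ler_pM => //; [lra|rewrite ler_pdivlMr// mulrC//|exact: xD].
Qed.

End sup_regularization.

(** * Transport cost *)

Lemma bounded_norm (R : realType) (d : nat) (U : set 'rV[R]_d) : bounded_set U ->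
  exists2 B : R, 0 < B & forall x, U x -> `|x| <= B.
Proof.
move=> [M [_ UM]]; exists (`|M| + 1); first by rewrite ltr_wpDl.
by apply: UM; rewrite (le_lt_trans (ler_norm _))// ltrDl.
Qed.

Lemma prob_on_neq0 (R : realType) (d : nat) (U : set 'rV[R]_d)
  (P : probability (Rd R d) R) : prob_on U P -> exists x, U x.
Proof.
move=> PU; apply: contrapT => U0.
have UT : ~` U = setT by apply/seteqP; split=> // x _ Ux; apply: U0; exists x.
move: PU; rewrite /prob_on UT => P0.
have := probability_setT P; rewrite [LHS]P0 => /eqP.
by rewrite eq_sym onee_eq0.
Qed.

Section bounded_subharmonic.
Variables (R : realType) (d : nat) (U : set 'rV[R]_d).
Hypotheses (oU : open U) (cU : convex U) (bU : bounded_set U).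
Variables (eta nu : probability (Rd R d) R).
Hypotheses (etaU : prob_on U eta) (nuU : prob_on U nu) (h : sh_le U eta nu).

Lemma sh_le_Cb psi : Cb U psi -> subharmonic U psi ->
  \int[eta]_(x in (U : set (Rd R d))) psi x <=
  \int[nu]_(x in (U : set (Rd R d))) psi x.
Proof.
move=> Cpsi spsi; have Spsi := Cb_Sb oU Cpsi.
have mU := measurable_open oU.
by have := h Cpsi spsi; rewrite !EFin_Rintegral// lee_fin.
Qed.

Lemma sh_le_Sbsub psi : Sbsub U psi ->
  \int[eta]_(x in (U : set (Rd R d))) psi x <=
  \int[nu]_(x in (U : set (Rd R d))) psi x.
Proof.
move=> Spsi; have [[mpsi [M psiM]] [upsi _]] := Spsi.
have mU := measurable_open oU; have [x0 Ux0] := prob_on_neq0 etaU.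
have M0 : 0 <= M by rewrite (le_trans _ (psiM _ Ux0)).
have [B B0 UB] := bounded_norm bU.
pose phi n := sup_regularization U (fun _ : unit => psi) n.+1%:R.
have bM (i : unit) x : U x -> `|psi x| <= M by exact: psiM.
have k0 n : 0 < n.+1%:R :> R by rewrite ltr0n.
have Cphi n : Cb U (phi n) by exact: (sup_regularization_Cb oU cU tt bM (k0 n)).
have sphi n : subharmonic U (phi n).
  by apply: (sup_regularization_subharmonic oU cU tt bM (k0 n)).
have phiM n x : U x -> `|phi n x| <= M.
  exact: (sup_regularization_bounded cU tt bM (k0 n)).
have psiphi n x : U x -> psi x <= phi n x.
  exact: (sup_regularization_ge cU tt bM (k0 n) tt).
have cphi x : U x -> phi n x @[n --> \oo] --> psi x.
  move=> Ux; apply/cvgrPdist_le => e e0.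
  have [delta d0 dH] := upsi x Ux e e0.
  have MB : 0 <= M * B by rewrite mulr_ge0// ltW.
  (* The shift allowed at penalty [n.+1] is [2 * M / n.+1 * (2 * B)], which falls below [delta] for
     large [n]; the added [1] keeps the divisor positive when [M = 0]. *)
  have c0 : 0 < 2 * M * (2 * B) + 1 by lra.
  have [N NH] := inv_succ_lt (divr_gt0 d0 c0).
  near=> n; have psin := psiphi n x Ux.
  rewrite distrC ger0_norm ?subr_ge0// lerBlDl addrC.
  apply: (@sup_regularization_upper R d U cU unit tt _ M n.+1%:R bM (k0 n) x _ (2 * B)) => //.
    by move=> z Uz; rewrite (le_trans (ler_normB _ _))//; have := UB _ Ux; have := UB _ Uz; lra.
  move=> _ u Uu xu; rewrite addrC; apply/ltW/dH => //; rewrite ball_rVE distrC.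
  apply: le_lt_trans xu _.
  have /NH : (N <= n)%N by near: n; exists N.
  rewrite ltr_pdivlMr//.
  have : 0 < n.+1%:R^-1 :> R by rewrite invr_gt0.
  by move: (n.+1%:R^-1) => c; rewrite mulrDr; lra.
have cv (P : probability (Rd R d) R) : \int[P]_(x in (U : set (Rd R d))) phi n x @[n --> \oo] -->
    \int[P]_(x in (U : set (Rd R d))) psi x.
  apply: (@cvg_bmeas_Rintegral _ _ _ _ _ _ _ M) => //.
  by move=> n; have [] := Cb_Sb oU (Cphi n).
apply: (ler_cvg_to (cv eta) (cv nu)); apply: nearW => n.
by apply: sh_le_Cb.
Unshelve. all: by end_near. Qed.

End bounded_subharmonic.

Section transport.
Variables (R : realType) (d : nat) (X Y : set 'rV[R]_d).
Hypotheses (oX : open X) (oY : open Y) (bX : bounded_set X) (bY : bounded_set Y).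
Local Notation Rd := (Rd R d).
Implicit Types (x y : 'rV[R]_d).

Lemma bounded_norm2 : exists2 B : R, 0 < B &
  (forall x, X x -> `|x| <= B) /\ (forall y, Y y -> `|y| <= B).
Proof.
have [B1 B10 XB] := bounded_norm bX; have [B2 B20 YB] := bounded_norm bY.
exists (B1 + B2); first by rewrite addr_gt0.
by split=> [x /XB|x /YB]; lra.
Qed.

Lemma eucl2_lip_norm (B : R) x y x' y' : 0 <= B -> `|x| <= B -> `|y| <= B ->
  `|x'| <= B -> `|y'| <= B ->
  `|eucl2 x y - eucl2 x' y'| <= 4 * d%:R * B * (`|x - x'| + `|y - y'|).
Proof.
move=> B0 xB yB x'B y'B.
by apply: eucl2_lip => // i; apply: le_trans (coord_le_norm _ i) _.
Qed.

Lemma eucl2_le_norm (B : R) x y : 0 <= B -> `|x| <= B -> `|y| <= B ->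
  `|eucl2 x y| <= 4 * d%:R * B * (B + B).
Proof.
move=> B0 xB yB; rewrite ger0_norm ?eucl2_ge0//.
apply: (@le_trans _ _ (4 * d%:R * B * (`|x| + `|y|))).
  by apply: eucl2_le => // i; apply: le_trans (coord_le_norm _ i) _.
by rewrite ler_wpM2l ?lerD// !mulr_ge0.
Qed.

Lemma weak_duality (a b : probability Rd R) (f g : 'rV[R]_d -> R) :
  prob_on X a -> prob_on Y b -> Sb X f -> Sb Y g ->
  (forall x y, X x -> Y y -> f x - g y <= eucl2 x y) ->
  ((\int[a]_(x in (X : set Rd)) f x - \int[b]_(y in (Y : set Rd)) g y)%:E <= T2 a b)%E.
Proof.
move=> aX bY' Sf Sg H; apply: le_ereal_inf_tmp => _ [pi cpi <-].
have mX := measurable_open oX; have mY := measurable_open oY.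
pose Z : set (Rd * Rd) := (X : set Rd) `*` (Y : set Rd).
have mZ : measurable Z by exact: measurableX.
have ma A : measurable A -> a A = pi (fst @^-1` A).
  move=> mA; have [<- _] := cpi A mA; congr (pi _).
  by apply/seteqP; split=> [[u v] []|[u v]].
have mb A : measurable A -> b A = pi (snd @^-1` A).
  move=> mA; have [_ <-] := cpi A mA; congr (pi _).
  by apply/seteqP; split=> [[u v] []|[u v]].
have mXT : measurable (fst @^-1` (X : set Rd) : set (Rd * Rd)).
  by rewrite -[X in measurable X]setTI; exact: measurable_fst.
have mYT : measurable (snd @^-1` (Y : set Rd) : set (Rd * Rd)).
  by rewrite -[X in measurable X]setTI; exact: measurable_snd.
have piX : pi (~` (fst @^-1` (X : set Rd))) = 0%E.
  by have := ma _ (measurableC mX); rewrite [LHS]aX => /esym.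
have piY : pi (~` (snd @^-1` (Y : set Rd))) = 0%E.
  by have := mb _ (measurableC mY); rewrite [LHS]bY' => /esym.
(* The marginals are carried by [X] and [Y], so the coupling is carried by [Z], the set on which the
   bound on [f x - g y] is known. *)
have piZ : pi (~` Z) = 0%E.
  have -> : ~` Z = ~` (fst @^-1` (X : set Rd)) `|` ~` (snd @^-1` (Y : set Rd)).
    by rewrite -setCI.
  apply/eqP; rewrite -measure_le0; apply: le_trans (measureU2 _ _ _) _.
  - exact: measurableC.
  - exact: measurableC.
  - by rewrite [A in (A + _)%E]piX [A in (_ + A)%E]piY adde0.
have bf : bmeas (fst @^-1` (X : set Rd)) (fun z : Rd * Rd => f z.1).
  have [mf [M fM]] := Sf; split; last by exists M => z; exact: fM.
  apply: (@measurable_comp _ _ _ _ _ _ (X : set Rd) f) => //.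
    by move=> _ [z Xz <-].
  exact: measurable_funTS.
have bg : bmeas (snd @^-1` (Y : set Rd)) (fun z : Rd * Rd => g z.2).
  have [mg [M gM]] := Sg; split; last by exists M => z; exact: gM.
  apply: (@measurable_comp _ _ _ _ _ _ (Y : set Rd) g) => //.
    by move=> _ [z Xz <-].
  exact: measurable_funTS.
have mc : measurable_fun setT (fun z : Rd * Rd => eucl2 (z.1 : 'rV[R]_d) z.2).
  by apply: measurable_eucl2; [exact: measurable_fst|exact: measurable_snd].
have [B B0 [XB YB]] := bounded_norm2.
have bc : bmeas Z (fun z : Rd * Rd => eucl2 (z.1 : 'rV[R]_d) z.2).
  split; first exact: measurable_funTS.
  exists (4 * d%:R * B * (B + B)) => z [Xz Yz].
  by apply: eucl2_le_norm; [exact: ltW|exact: XB|exact: YB].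
have ZX : Z `<=` fst @^-1` (X : set Rd) by move=> z [].
have ZY : Z `<=` snd @^-1` (Y : set Rd) by move=> z [].
apply: (@le_trans _ _ (\int[pi]_(z in Z) (eucl2 (z.1 : 'rV[R]_d) z.2)%:E)%E); last first.
  apply: ge0_subset_integral => //; first exact/measurable_EFinP.
  by move=> z _; rewrite lee_fin eucl2_ge0.
rewrite (EFin_Rintegral _ mZ bc) lee_fin.
rewrite (Rintegral_law measurable_fst ma mX Sf) (Rintegral_law measurable_snd mb mY Sg).
rewrite (Rintegral_full mZ mXT ZX piZ bf) (Rintegral_full mZ mYT ZY piZ bg).
have bfZ := bmeasS mXT ZX bf; have bgZ := bmeasS mYT ZY bg.
rewrite lerBlDr -bmeas_RintegralD//; apply: le_bmeas_Rintegral => //.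
  exact: bmeasD.
by move=> z [Xz Yz]; rewrite -lerBlDr; exact: H.
Qed.

(** The joint law of [x] and [y] is a coupling, so random vectors on any probability space bound the
    transport cost. *)
Lemma T2_le d' (T : measurableType d') (P : probability T R) (a b : probability Rd R)
    (x y : T -> Rd) (C : R) :
  measurable_fun setT x -> measurable_fun setT y ->
  (forall A, measurable A -> a A = P (x @^-1` A)) ->
  (forall A, measurable A -> b A = P (y @^-1` A)) ->
  bmeas setT (fun u => eucl2 (x u : 'rV[R]_d) (y u)) ->
  \int[P]_u eucl2 (x u : 'rV[R]_d) (y u) <= C -> (T2 a b <= C%:E)%E.
Proof.
move=> mx my ax ay bc xyC.
have mxy : measurable_fun setT (fun u => (x u, y u)) by exact: measurable_fun_pair.
pose phi : {mfun T >-> (Rd * Rd)%type} := HB.pack (fun u => (x u, y u))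
  (isMeasurableFun.Build _ _ _ _ _ mxy).
apply: (@le_trans _ _ (\int[distribution P phi]_z (eucl2 (z.1 : 'rV[R]_d) z.2)%:E)%E).
  apply: ereal_inf_lbound; exists (distribution P phi) => // A mA; split.
    rewrite ax// /distribution /pushforward; congr (P _).
    by apply/seteqP; split=> u //= [].
  rewrite ay// /distribution /pushforward; congr (P _).
  by apply/seteqP; split=> u //= [].
rewrite ge0_integral_distribution//; last 2 first.
- apply/measurable_EFinP.
  by apply: measurable_eucl2; [exact: measurable_fst|exact: measurable_snd].
- by move=> z; rewrite lee_fin eucl2_ge0.
by rewrite (@EFin_Rintegral _ _ _ P setT (fun u => eucl2 (x u : 'rV[R]_d) (y u)))// lee_fin.
Qed.

Section Q2.
Variables (psi : 'rV[R]_d -> R) (m : R) (y0 : 'rV[R]_d).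
Hypotheses (psim : forall y, Y y -> m <= psi y) (Yy0 : Y y0).

Let lbQ x : has_lbound [set psi y + eucl2 x y | y in Y].
Proof.
by exists m => _ [y Yy <-]; have := psim Yy; have := eucl2_ge0 x y; lra.
Qed.

Lemma Q2_le x y : Y y -> Q2 Y psi x <= psi y + eucl2 x y.
Proof. by move=> Yy; apply: ge_inf => //; exists y. Qed.

Lemma Q2_ge x (c : R) : (forall y, Y y -> c <= psi y + eucl2 x y) -> c <= Q2 Y psi x.
Proof.
move=> H; apply: lb_le_inf; first by exists (psi y0 + eucl2 x y0); exists y0.
by move=> _ [y Yy <-]; exact: H.
Qed.

(** An infimum of functions of [x] with a common Lipschitz constant, finite because [psi] is bounded
    below on [Y]. *)
Lemma Q2_Cb : Cb X (Q2 Y psi).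
Proof.
have [B B0 [XB YB]] := bounded_norm2; have B0' := ltW B0.
pose K := 4 * d%:R * B; have K0 : 0 <= K by rewrite !mulr_ge0.
apply: near_Cb.
  exists (`|m| + `|psi y0| + K * (B + B)) => x Xx.
  have := eucl2_le_norm B0' (XB _ Xx) (YB _ Yy0); rewrite -/K ler_norml => /andP[_ h1].
  have h2 := @Q2_le x _ Yy0.
  have h3 : m <= Q2 Y psi x.
    by apply: Q2_ge => y Yy; have := psim Yy; have := eucl2_ge0 x y; lra.
  have h4 : 0 <= K * (B + B) by rewrite mulr_ge0 ?addr_ge0.
  have := ler_norm (psi y0); have := ler_norm (- m); rewrite normrN.
  have := normr_ge0 m; have := normr_ge0 (psi y0).
  by rewrite ler_norml => *; apply/andP; split; lra.
have L x x' : X x -> X x' -> Q2 Y psi x <= Q2 Y psi x' + K * `|x - x'|.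
  move=> Xx Xx'; rewrite -lerBlDr; apply: Q2_ge => y Yy.
  have := @Q2_le x _ Yy.
  have := eucl2_lip_norm B0' (XB _ Xx) (YB _ Yy) (XB _ Xx') (YB _ Yy).
  by rewrite subrr normr0 addr0 -/K ler_norml => /andP[_]; lra.
move=> x Xx e e0; exists (e / (K + 1)); first by rewrite divr_gt0// ltr_wpDl.
move=> x' Xx'; rewrite ltr_pdivlMr ?ltr_wpDl// => xx'.
have := L _ _ Xx Xx'; have := L _ _ Xx' Xx; rewrite (distrC x').
have : K * `|x - x'| <= `|x - x'| * (K + 1) by rewrite mulrC ler_wpM2l//; lra.
by rewrite ltr_norml => *; apply/andP; split; lra.
Qed.

End Q2.

End transport.

(** Carries the regularity and the bounds of [Q2] over to the supremal operator, with the two sets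
    exchanging roles. *)
Lemma Q2barE (R : realType) (d : nat) (X : set 'rV[R]_d) psi y :
  Q2bar X psi y = - Q2 X (fun x => - psi x) y.
Proof.
rewrite /Q2bar /Q2 /inf opprK; congr sup; apply/seteqP; split=> v.
  move=> [x Xx <-]; exists (- psi x + eucl2 y x); first by exists x.
  by rewrite opprD opprK eucl2C.
by move=> [_ [x Xx <-] <-]; exists x => //; rewrite opprD opprK eucl2C.
Qed.

(** * Random vectors representing a cone *)

Section Cb_cone.
Variables (R : realType) (d : nat) (U : set 'rV[R]_d).
Implicit Types f g : 'rV[R]_d -> R.

Lemma Cb_cst (c : R) : Cb U (fun=> c).
Proof.
apply: near_Cb => [|x Ux e e0]; first by exists `|c|.
by exists 1 => // y _ _; rewrite subrr normr0.
Qed.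

Lemma CbD f g : Cb U f -> Cb U g -> Cb U (fun x => f x + g x).
Proof.
move=> [/subspace_continuousP cf [M fM]] [/subspace_continuousP cg [N gN]]; split.
  apply/subspace_continuousP => x Ux.
  by apply: cvgD; [exact: cf|exact: cg].
by exists (M + N) => x Ux; rewrite (le_trans (ler_normD _ _))// lerD ?fM ?gN.
Qed.

Lemma CbZ (a : R) f : Cb U f -> Cb U (fun x => a * f x).
Proof.
move=> [/subspace_continuousP cf [M fM]]; split.
  apply/subspace_continuousP => x Ux.
  by apply: cvgM; [exact: cvg_cst|exact: cf].
by exists (`|a| * M) => x Ux; rewrite normrM ler_wpM2l ?fM.
Qed.

Lemma Cb_Ash f : subharmonic U f -> Cb U f -> Ash (@Cb R d) U f.
Proof.
move=> sf Cf; split=> //; split=> //; have [_ [M fM]] := Cf.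
by exists (- M) => x /fM; rewrite ler_norml => /andP[].
Qed.

Lemma dilation_Cb f z (t : R) : open U -> convex U -> U z -> 0 <= t <= 1 ->
  Cb U f -> Cb U (fun x => f (t *: x + (1 - t) *: z)).
Proof.
move=> oU cU Uz t01 Cf; have [t0 t1] := andP t01; apply: near_Cb.
  by have [_ [M fM]] := Cf; exists M => x Ux; apply: fM; exact: dilation_in.
move=> x Ux e e0.
have [a a0 fa] := Cb_near oU Cf (dilation_in cU Ux Uz t01) e0.
exists a => // y _ xy; apply: fa.
rewrite opprD addrACA subrr addr0 -scalerBr normrZ ger0_norm//.
by rewrite (le_lt_trans _ xy)// ler_piMl.
Qed.

End Cb_cone.

Section rows.
Variables (R : realType) (k d : nat).
Implicit Types (M N : 'M[R]_(k, d)) (S : set 'M[R]_(k, d)) (X : set 'rV[R]_d).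

Lemma norm_row_le i M : `|row i M| <= `|M|.
Proof.
rewrite [leLHS]/Num.Def.normr /= mx_normrE [leRHS]/Num.Def.normr /= mx_normrE.
apply/bigmax_leP; split=> [|[a b] _] /=.
  by apply: bigmax_ge_id.
by rewrite mxE; apply/bigmax_geP; right; exists (i, b).
Qed.

Lemma row_lip i M N : `|row i M - row i N| <= `|M - N|.
Proof. by rewrite -linearB; exact: norm_row_le. Qed.

Lemma closure_row i X S M : (forall N, S N -> X (row i N)) -> closure S M ->
  closure X (row i M).
Proof.
move=> SX SM A /nbhs_ballP[e /= e0 eA].
have [N [SN MN]] := SM _ (nbhsx_ballx M e e0).
exists (row i N); split; first exact: SX.
apply: eA; rewrite ball_rVE (le_lt_trans (row_lip _ _ _))//.
by move: MN; rewrite -ball_normE.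
Qed.

Lemma closure_norm_le X (B : R) x : (forall y, X y -> `|y| <= B) ->
  closure X x -> `|x| <= B.
Proof.
move=> XB Xx; apply/ler_addgt0Pr => e e0.
have [y [Xy]] := Xx _ (nbhsx_ballx x e e0); rewrite ball_rVE => xy.
rewrite -[x](subrK y) (le_trans (ler_normD _ _))// addrC.
by apply: lerD; [exact: XB|exact: ltW].
Qed.

End rows.

Section representing_matrix.
Variables (R : realType) (k d : nat) (S : set 'M[R]_(k, d)) (B : R).
Hypothesis SB : forall M, S M -> forall i j, `|M i j| <= B.
Variable C : ('M[R]_(k, d) -> R) -> R -> Prop.

Definition uniform_on (K : set 'M[R]_(k, d)) (f : 'M[R]_(k, d) -> R) :=
  forall e : R, 0 < e -> exists2 delta : R, 0 < delta &
    forall M N, K M -> K N -> `|M - N| < delta -> `|f M - f N| <= e.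

Lemma representing_matrix :
  (forall f v g w, C f v -> C g w -> C (fun x => f x + g x) (v + w)) ->
  (forall (a : R) f v, 0 <= a -> C f v -> C (fun x => a * f x) (a * v)) ->
  (forall r, C (fun=> r) r) ->
  (forall f v, C f v -> (forall w, S w -> 0 <= f w) -> 0 <= v) ->
  exists (dO : measure_display) (Om : measurableType dO)
    (P : probability Om R) (T : Om -> 'M[R]_(k, d)),
  [/\ forall U, open U -> measurable (T @^-1` U),
      forall u, closure S (T u) &
      forall f v, C f v -> measurable_fun setT (f \o T) ->
        bounded_on (closure S) f -> uniform_on (closure S) f ->
        \int[P]_u f (T u) <= v].
Proof.
move=> CD CZ C1 Cpos; have [L [LD LZ Lle L1 LC]] := positive_functional CD CZ C1 Cpos.
have [T [mT clT intT]] := random_matrix_representation SB LD LZ Lle L1.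
exists _, _, (uniform_prob (@ltr01 R) : probability _ R), T.
split=> // f v Cfv mf bf uf.
have bSf : bounded_on S f.
  by have [M fM] := bf; exists M => w Sw; apply: fM; exact: subset_closure.
rewrite intT//; first exact: LC.
move=> e e0; have [delta d0 dH] := uf e e0; exists delta => // x y Sx Sy xy.
by apply: dH => //; move: xy; rewrite -ball_normE.
Qed.

End representing_matrix.

Section random_vectors.
Variables (R : realType) (d : nat).
Variables (d' : measure_display) (T : measurableType d') (P : probability T R).
Local Notation Rd := (Rd R d).

Lemma law_of_bumps (mu : probability Rd R) (x : T -> Rd) : measurable_fun setT x ->
  (forall U k, open U -> \int[P]_u bump U k (x u) = \int[mu]_x bump U k x) ->
  forall A, measurable A -> mu A = P (x @^-1` A).
Proof.
move=> mx H A mA.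
pose X : {mfun T >-> Rd} := HB.pack x (isMeasurableFun.Build _ _ _ _ _ mx).
apply: (@eq_law _ _ mu (distribution P X)) => // U k oU.
rewrite -H// (@Rintegral_law _ _ T Rd R P (distribution P X) x mx)//.
split; first exact: bump_measurable.
by exists 1 => y _; have /andP[? ?] := bump01 U k y; rewrite ger0_norm.
Qed.

End random_vectors.

Section dilation_limit.
Variables (R : realType) (d : nat) (U : set 'rV[R]_d).
Hypotheses (oU : open U) (cU : convex U).

Definition dilation_ratio (n : nat) : R := 1 - n.+1%:R^-1.

Lemma dilation_ratio01 n : 0 <= dilation_ratio n <= 1.
Proof.
rewrite /dilation_ratio subr_ge0 invf_le1// ler1n /= lerBlDr lerDl.
by rewrite invr_ge0.
Qed.

Lemma dilation_ratio_lt1 n : dilation_ratio n < 1.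
Proof. by rewrite /dilation_ratio ltrBlDr ltrDl invr_gt0. Qed.

Lemma cvg_shift (f : 'rV[R]_d -> R) (x v : 'rV[R]_d) : Cb U f -> U x ->
  f (x + n.+1%:R^-1 *: v) @[n --> \oo] --> f x.
Proof.
move=> Cf Ux; apply/cvgrPdist_lt => e e0.
have [a a0 fa] := Cb_near oU Cf Ux e0.
have c0 : 0 < `|v| + 1 by rewrite ltr_wpDl.
have [N NH] := inv_succ_lt (divr_gt0 a0 c0).
exists N => // n /= Nn; apply: fa.
rewrite opprD addrA subrr add0r normrN normrZ ger0_norm ?invr_ge0//.
have := NH _ Nn; rewrite ltr_pdivlMr// mulrDr mulr1.
have : 0 < n.+1%:R^-1 :> R by rewrite invr_gt0.
by move: (n.+1%:R^-1) => c; lra.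
Qed.

Lemma cvg_dilation (f : 'rV[R]_d -> R) (x z : 'rV[R]_d) : Cb U f -> U x ->
  f (dilation_ratio n *: x + (1 - dilation_ratio n) *: z) @[n --> \oo] --> f x.
Proof.
move=> Cf Ux; have := cvg_shift (z - x) Cf Ux.
have -> // : (fun n => f (x + n.+1%:R^-1 *: (z - x))) =
  fun n => f (dilation_ratio n *: x + (1 - dilation_ratio n) *: z).
apply/funext => n; congr f; rewrite /dilation_ratio.
by apply/rowP => j; rewrite !mxE; ring.
Qed.

End dilation_limit.

Section uniform_on.
Variables (R : realType) (k d : nat) (K : set 'M[R]_(k, d)).
Implicit Types (U : set 'rV[R]_d).

Lemma uniform_on_lip f (A : R) :
  (forall M N, K M -> K N -> `|f M - f N| <= A * `|M - N|) -> uniform_on K f.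
Proof.
move=> H e e0; have A0 : 0 < `|A| + 1 by rewrite ltr_wpDl.
exists (e / (`|A| + 1)); first by rewrite divr_gt0.
move=> M N KM KN; rewrite ltr_pdivlMr// mulrC => MN.
apply: le_trans (H _ _ KM KN) _; apply: le_trans (ltW MN); rewrite ler_wpM2r//.
by rewrite (le_trans (ler_norm A))// lerDl.
Qed.

(** A bounded continuous function on [U] may oscillate near the boundary. The map keeps [K] at depth
    at least [rho], hence in a compact subset of [U], where Heine's theorem applies. *)
Lemma uniform_on_comp U f (phi : 'M[R]_(k, d) -> 'rV[R]_d) (A rho : R) :
  open U -> bounded_set U -> Cb U f -> 0 < rho ->
  (forall M, K M -> rho <= depth U (phi M)) ->
  (forall M N, `|phi M - phi N| <= A * `|M - N|) ->
  uniform_on K (fun M => f (phi M)).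
Proof.
move=> oU bU Cf r0 Krho philip e e0.
have [cK KU] := compact_depth bU r0.
have [delta d0 dH] := heine oU Cf KU cK e0.
have A0 : 0 < `|A| + 1 by rewrite ltr_wpDl.
exists (delta / (`|A| + 1)); first by rewrite divr_gt0.
move=> M N KM KN; rewrite ltr_pdivlMr// mulrC => MN; apply: dH; first exact: Krho.
apply: le_lt_trans (philip _ _) _; apply: le_lt_trans MN; rewrite ler_wpM2r//.
by rewrite (le_trans (ler_norm A))// lerDl.
Qed.

End uniform_on.

Lemma bmeas_bump (R : realType) (d : nat) (U Q : set 'rV[R]_d) (k : nat) :
  measurable (Q : set (Rd R d)) -> bmeas (Q : set (Rd R d)) (bump U k).
Proof.
move=> mQ; apply: (bmeasS measurableT) => //; split; first exact: bump_measurable.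
by exists 1 => z _; have /andP[? ?] := bump01 U k z; rewrite ger0_norm.
Qed.

Lemma bump_indic (R : realType) (d : nat) (U : set 'rV[R]_d) (k : nat) x :
  bump U k x <= \1_U x.
Proof.
have [Ux|Ux] := pselect (U x).
  by rewrite indicE mem_set//; have /andP[] := bump01 U k x.
rewrite indicE memNset//= /bump ge_min; apply/orP; right.
by rewrite depth_out// mulr0.
Qed.

(** On [U], [bump] is the minimum of a constant and a multiple of the midpoint concave [depth],
    hence itself midpoint concave. *)
Lemma one_minus_bump_subharmonic (R : realType) (d : nat) (U : set 'rV[R]_d) (k : nat) :
  open U -> convex U -> Cb U (fun x => -1 * bump U k x + 1) /\
    subharmonic U (fun x => -1 * bump U k x + 1).
Proof.
move=> oU cU.
have Cbump : Cb U (fun x => -1 * bump U k x + 1).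
  apply: CbD; last exact: Cb_cst.
  apply: CbZ; apply: near_Cb.
    by exists 1 => x _; have /andP[? ?] := bump01 U k x; rewrite ger0_norm.
  move=> x Ux e e0; exists (e / (k%:R + 1)); first by rewrite divr_gt0// ltr_wpDl.
  move=> y _; rewrite ltr_pdivlMr ?ltr_wpDl// => xy.
  apply: le_lt_trans (bump_lip _ _ _ _) (le_lt_trans _ xy).
  by rewrite mulrC ler_wpM2l// lerDl.
split=> //; have SC := Cb_Sb oU Cbump.
apply/subharmonicP => //; split.
  move=> x Ux e e0; have [a a0 aH] := Cb_near oU Cbump Ux e0.
  exists a => // y Uy; rewrite ball_rVE => /aH; rewrite ltr_norml => /andP[]; lra.
apply: midpoint_submean => // x v Up Um.
have := depth_midpoint cU oU Up Um.
move=> /(ler_wpM2l (ler0n R k)) H.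
rewrite /bump !minEle; do 3 case: ifP; move=> *; lra.
Qed.

Section random_rows.
Variables (R : realType) (k d : nat) (S : set 'M[R]_(k, d)).
Variable C : ('M[R]_(k, d) -> R) -> R -> Prop.
Variables (dO : measure_display) (Om : measurableType dO) (P : probability Om R).
Variable T : Om -> 'M[R]_(k, d).
Hypothesis mT : forall U, open U -> measurable (T @^-1` U).
Hypothesis intT : forall f v, C f v -> measurable_fun setT (f \o T) ->
  bounded_on (closure S) f -> uniform_on (closure S) f -> \int[P]_u f (T u) <= v.
Local Notation Rd := (Rd R d).

Lemma measurable_lip_map (phi : 'M[R]_(k, d) -> 'rV[R]_d) (A : R) :
  (forall M N, `|phi M - phi N| <= A * `|M - N|) ->
  measurable_fun setT (fun u => phi (T u) : Rd).
Proof.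
move=> H; apply: measurable_fun_Rd => U oU.
have : open (phi @^-1` U).
  by apply: open_comp oU => M _; exact: lipschitz_continuous H M.
exact: mT.
Qed.

Lemma measurable_row i : measurable_fun setT (fun u => row i (T u) : Rd).
Proof.
by apply: (@measurable_lip_map _ 1) => M N; rewrite mul1r; exact: row_lip.
Qed.

(** The affine form serves twice: [c = 1] and [c = -1] identify a marginal, while [c = -1], [e = 1]
    tests the function [1 - bump]. *)
Lemma bump_row_le U n i (c e v : R) :
  C (fun M => c * bump U n (row i M) + e) v ->
  c * \int[P]_u bump U n (row i (T u)) + e <= v.
Proof.
move=> Cv.
have bm : bmeas setT (fun u => bump U n (row i (T u))).
  split; last first.
    by exists 1 => u _; have /andP[? ?] := bump01 U n (row i (T u)); rewrite ger0_norm.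
  apply: (measurableT_comp (f := (bump U n : Rd -> R))); first exact: bump_measurable.
  exact: measurable_row.
have <- : \int[P]_u (c * bump U n (row i (T u)) + e) =
    c * \int[P]_u bump U n (row i (T u)) + e.
  rewrite bmeas_RintegralD//; [|exact: bmeasZ|exact: bmeas_cst].
  by rewrite bmeas_RintegralZ// Rintegral_prob_cst// setCT measure0.
apply: (intT Cv).
- by have [] := bmeasD (bmeasZ c bm) (bmeas_cst setT e).
- apply: bounded_onD; last exact: bounded_on_cst.
  apply: bounded_onZ; exists 1 => M _.
  by have /andP[? ?] := bump01 U n (row i M); rewrite ger0_norm.
- apply: (@uniform_on_lip _ _ _ _ _ (`|c| * n%:R)) => M N _ _.
  have -> : c * bump U n (row i M) + e - (c * bump U n (row i N) + e) =
    c * (bump U n (row i M) - bump U n (row i N)) by ring.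
  rewrite normrM -mulrA ler_wpM2l// (le_trans (bump_lip _ _ _ _))// ler_wpM2l//.
  exact: row_lip.
Qed.

Lemma law_row (mu : probability Rd R) i :
  (forall a, bmeas setT (a : Rd -> R) -> C (fun M => a (row i M)) (\int[mu]_x a x)) ->
  forall A, measurable A -> mu A = P ((fun u => row i (T u) : Rd) @^-1` A).
Proof.
move=> H; apply: law_of_bumps; first exact: measurable_row.
move=> U n oU; have bb := @bmeas_bump R d U setT n measurableT.
have h c : c * \int[P]_u bump U n (row i (T u)) + 0 <= c * \int[mu]_x bump U n x + 0.
  apply: bump_row_le.
  have := H (fun z => c * bump U n z + 0); rewrite bmeas_RintegralD//; last 2 first.
  - exact: bmeasZ.
  - exact: bmeas_cst.
  rewrite bmeas_RintegralZ// Rintegral_prob_cst// ?setCT ?measure0//; apply.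
  by apply: bmeasD; [exact: bmeasZ|exact: bmeas_cst].
by apply/eqP; rewrite eq_le; have := h 1; have := h (-1) => *; apply/andP; split; lra.
Qed.

End random_rows.

(** * The problem below nu *)

Section separation.
Variables (R : realType) (d : nat) (X Y : set 'rV[R]_d).
Hypotheses (oX : open X) (oY : open Y).
Variables (mu nu : probability (Rd R d) R).
Hypotheses (muX : prob_on X mu) (nuY : prob_on Y nu).

(** Two successive one-variable integrations, first in [x] for fixed [y]. This is the case of the
    duality in which the cost has coefficient zero. *)
Lemma Rintegral_sum_ge0 (f g : 'rV[R]_d -> R) : Sb X f -> Sb Y g ->
  (forall x y, X x -> Y y -> 0 <= f x + g y) ->
  0 <= \int[mu]_(x in (X : set (Rd R d))) f x +
       \int[nu]_(y in (Y : set (Rd R d))) g y.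
Proof.
move=> Sf Sg H; have mX := measurable_open oX; have mY := measurable_open oY.
rewrite -lerBlDl sub0r -(Rintegral_prob_cst (- _) mY nuY).
apply: le_bmeas_Rintegral => //; first exact: bmeas_cst.
move=> y Yy; rewrite lerNl -(Rintegral_prob_cst (- g y) mX muX).
apply: le_bmeas_Rintegral => //; first exact: bmeas_cst.
by move=> x Xx; have := H x y Xx Yy; lra.
Qed.

End separation.

Section sh_below.
Variables (R : realType) (d : nat) (X Y : set 'rV[R]_d).
Hypotheses (oX : open X) (oY : open Y) (bX : bounded_set X) (bY : bounded_set Y).
Hypotheses (cX : convex X) (cY : convex Y).
Variables (mu nu : probability (Rd R d) R).
Hypotheses (muX : prob_on X mu) (nuY : prob_on Y nu).
Local Notation Rd := (Rd R d).
Local Notation "\intX f" := (\int[mu]_(x in (X : set Rd)) f x) (at level 36).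
Local Notation "\intY f" := (\int[nu]_(x in (Y : set Rd)) f x) (at level 36).

Let mX := measurable_open oX.
Let mY := measurable_open oY.

Let dual_value psi : Sb Y psi ->
  (\int[mu]_(x in (X : set Rd)) (Q2 Y psi x)%:E -
   \int[nu]_(y in (Y : set Rd)) (psi y)%:E)%E = (\intX (Q2 Y psi) - \intY psi)%:E.
Proof.
move=> Spsi; have [_ [M psiM]] := Spsi; have [y0 Yy0] := prob_on_neq0 nuY.
have psim y : Y y -> - M <= psi y by move=> /psiM; rewrite ler_norml => /andP[].
by rewrite !EFin_Rintegral//; exact/(Cb_Sb oX)/(Q2_Cb bX bY psim Yy0).
Qed.

Lemma dual_below_Sb_le : (dual_below (@Sb R d) X Y mu nu <= T2_sh_below Y mu nu)%E.
Proof.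
apply: ge_ereal_sup => _ [psi [Spsi [hpsi [m psim]]] <-].
have [y0 Yy0] := prob_on_neq0 nuY.
rewrite dual_value//; apply: le_ereal_inf_tmp => _ [eta [etaY etanu] <-].
have h := sh_le_Sbsub oY cY bY etaY etanu (conj Spsi hpsi).
have SQ := Cb_Sb oX (Q2_Cb bX bY psim Yy0).
apply: le_trans (weak_duality oX oY bX bY muX etaY SQ Spsi _); last first.
  by move=> x y Xx Yy; have := Q2_le psim x Yy; lra.
by rewrite lee_fin lerB.
Qed.

Lemma dual_below_Cb_le : (dual_below (@Cb R d) X Y mu nu <= dual_below (@Sb R d) X Y mu nu)%E.
Proof.
apply: le_ereal_sup => _ [psi [Cpsi hpsi] <-]; exists psi => //.
by split=> //; exact: Cb_Sb.
Qed.

Section attainment.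
Variable r : R.
Hypothesis dual_le : forall psi, Cb Y psi -> subharmonic Y psi ->
  \intX (Q2 Y psi) - \intY psi <= r.

Let rx (M : 'M[R]_(2, d)) : 'rV[R]_d := row ord0 M.
Let ry (M : 'M[R]_(2, d)) : 'rV[R]_d := row ord_max M.
Let S : set 'M[R]_(2, d) := [set M | X (rx M) /\ Y (ry M)].

Let mk (x y : 'rV[R]_d) : 'M[R]_(2, d) := \matrix_(i, j) (if i == ord0 then x else y) ord0 j.

Let rx_mk x y : rx (mk x y) = x.
Proof. by apply/rowP => j; rewrite !mxE. Qed.

Let ry_mk x y : ry (mk x y) = y.
Proof. by apply/rowP => j; rewrite !mxE. Qed.

(** The coefficient [t] counts the copies of the cost, each at price [r]. Functions of the first
    point may be replaced by their opposites, which fixes its law as [mu]; those of the second are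
    subharmonic, which places its law below [nu]. *)
Let C (f : 'M[R]_(2, d) -> R) (v : R) := exists a b t,
  [/\ bmeas setT (a : Rd -> R), Cb Y b, subharmonic Y b, 0 <= t &
   (forall M, f M = a (rx M) + b (ry M) + t * eucl2 (rx M) (ry M)) /\
   v = \int[mu]_x a x + \intY b + t * r].

Let CD f v g w : C f v -> C g w -> C (fun x => f x + g x) (v + w).
Proof.
move=> [a [b [t [ma Cb_ sb t0 [fE ->]]]]] [a' [b' [t' [ma' Cb' sb' t'0 [gE ->]]]]].
exists (fun x => a x + a' x), (fun x => b x + b' x), (t + t'); split.
- exact: bmeasD.
- exact: CbD.
- by have [] := Sbsub_sumof oY (conj (Cb_Sb oY Cb_) sb) (conj (Cb_Sb oY Cb') sb').
- exact: addr_ge0.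
- split=> [M|]; first by rewrite fE gE; ring.
  rewrite bmeas_RintegralD// bmeas_RintegralD//; [ring|exact: Cb_Sb|exact: Cb_Sb].
Qed.

Let CZ (c : R) f v : 0 <= c -> C f v -> C (fun x => c * f x) (c * v).
Proof.
move=> c0 [a [b [t [ma Cb_ sb t0 [fE ->]]]]].
exists (fun x => c * a x), (fun x => c * b x), (c * t); split.
- exact: bmeasZ.
- exact: CbZ.
- by have [] := Sbsub_scale oY c0 (conj (Cb_Sb oY Cb_) sb).
- exact: mulr_ge0.
- split=> [M|]; first by rewrite fE; ring.
  by rewrite bmeas_RintegralZ// bmeas_RintegralZ//; [ring|exact: Cb_Sb].
Qed.

Let C_fst a : bmeas setT (a : Rd -> R) -> C (fun M => a (rx M)) (\int[mu]_x a x).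
Proof.
move=> ba; have [_ s0] := Sbsub_cst 0 oY.
exists a, (fun=> 0), 0; split=> //; first exact: Cb_cst.
split=> [M|]; first by ring.
by rewrite Rintegral_prob_cst// mul0r !addr0.
Qed.

Let C_snd b : Cb Y b -> subharmonic Y b -> C (fun M => b (ry M)) (\intY b).
Proof.
move=> Cb_ sb; exists (fun=> 0), b, 0; split=> //; first exact: bmeas_cst.
split=> [M|]; first by ring.
by rewrite Rintegral_prob_cst// ?setCT ?measure0// mul0r !addr0 add0r.
Qed.

Let C_cst (c : R) : C (fun=> c) c.
Proof.
rewrite -{2}(@Rintegral_prob_cst _ _ _ mu setT c)// ?setCT ?measure0//.
exact: (C_fst (bmeas_cst setT c)).
Qed.

Let C_cost : C (fun M => eucl2 (rx M) (ry M)) r.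
Proof.
have [_ s0] := Sbsub_cst 0 oY.
exists (fun=> 0), (fun=> 0), 1; split=> //; [exact: bmeas_cst|exact: Cb_cst|].
split=> [M|]; first by ring.
rewrite !Rintegral_prob_cst// ?setCT ?measure0//; ring.
Qed.

Let C_pos f v : C f v -> (forall w, S w -> 0 <= f w) -> 0 <= v.
Proof.
move=> [a [b [t [ma Cb_ sb t0 [fE ->]]]]] f0.
have {}f0 x y : X x -> Y y -> 0 <= a x + b y + t * eucl2 x y.
  move=> Xx Yy; have := f0 (mk x y); rewrite fE rx_mk ry_mk; apply.
  by rewrite /S /= rx_mk ry_mk.
have Sa : Sb X a by exact: (bmeasS measurableT).
have Sb_ : Sb Y b by exact: Cb_Sb.
rewrite (Rintegral_full mX measurableT _ muX ma)//.
move: t0; rewrite le_eqVlt => /predU1P[t0|t0].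
  rewrite -t0 mul0r addr0; apply: Rintegral_sum_ge0 => // x y Xx Yy.
  by have := f0 x y Xx Yy; rewrite -t0 mul0r addr0.
(* Dividing by [t] turns the hypothesis into [- a / t <= psi + eucl2], that is [- a / t <= Q2 Y psi]
   on [X], and the assumed bound on dual values concludes. *)
pose psi y := t^-1 * b y.
have ti0 : 0 <= t^-1 by rewrite invr_ge0 ltW.
have Cpsi : Cb Y psi by exact: CbZ.
have [_ spsi] := Sbsub_scale oY ti0 (conj Sb_ sb).
have [y0 Yy0] := prob_on_neq0 nuY.
have [m psim] : exists m, forall y, Y y -> m <= psi y.
  by have [_ [_ [m ?]]] := Cb_Ash spsi Cpsi; exists m.
have SQ := Cb_Sb oX (Q2_Cb bX bY psim Yy0).
have h1 : - t^-1 * \intX a <= \intX (Q2 Y psi).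
  rewrite -bmeas_RintegralZ//; apply: le_bmeas_Rintegral => //; first exact: bmeasZ.
  move=> x Xx; apply: (Q2_ge Yy0) => y Yy.
  have := f0 x y Xx Yy; rewrite /psi -(ler_pM2l (_ : 0 < t^-1)) ?invr_gt0//.
  rewrite mulr0 !mulrDr mulrA mulVf ?gt_eqF// mul1r; lra.
have := dual_le Cpsi spsi; rewrite {2}/psi bmeas_RintegralZ// => h2.
have : - t^-1 * \intX a - t^-1 * \intY b <= r by lra.
rewrite -(ler_pM2l t0) mulrBr !mulrA mulrN mulfV ?gt_eqF// mulN1r mul1r; lra.
Qed.

Lemma T2_sh_below_le : (T2_sh_below Y mu nu <= r%:E)%E.
Proof.
have [B B0 [XB YB]] := bounded_norm2 bX bY; have B0' := ltW B0.
have SB M : S M -> forall i j, `|M i j| <= B.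
  move=> [Xx Yy] i j.
  have h (l : 'I_2) : i = l -> `|row l M| <= B -> `|M i j| <= B.
    by move=> -> lB; apply: le_trans lB; have := coord_le_norm (row l M) j; rewrite mxE.
  have [i0|i1] : i = ord0 \/ i = ord_max.
    by case: i {h} => -[|[|//]] ii; [left|right]; exact: val_inj.
  - by apply: (h ord0) => //; exact: XB.
  - by apply: (h ord_max) => //; exact: YB.
have [dO [Om [P [T [mT clT intT]]]]] := representing_matrix SB CD CZ C_cst C_pos.
pose x u : Rd := rx (T u); pose y u : Rd := ry (T u).
have mx : measurable_fun setT x by exact: measurable_row.
have my : measurable_fun setT y by exact: measurable_row.
have clX M : closure S M -> closure X (rx M) by apply: closure_row => N [].
have clY M : closure S M -> closure Y (ry M) by apply: closure_row => N [].
have xB M : closure S M -> `|rx M| <= B by move=> /clX; exact: closure_norm_le.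
have yB M : closure S M -> `|ry M| <= B by move=> /clY; exact: closure_norm_le.
pose yf : {mfun Om >-> Rd} := HB.pack y (isMeasurableFun.Build _ _ _ _ _ my).
pose eta : probability Rd R := distribution P yf.
have etaE A : measurable A -> eta A = P (y @^-1` A) by [].
have law_x A : measurable A -> mu A = P (x @^-1` A).
  exact: (law_row mT intT C_fst).
have etaY : prob_on Y eta.
  apply: probability_setC_eq0 => //.
  (* The price of [1 - bump] says that [bump] has at least the integral under [eta] that it has
     under [nu]; the latter tends to [1] since [nu] is carried by [Y]. *)
  have le1 n : \int[nu]_(z in (Y : set Rd)) bump Y n z <= fine (eta Y).
    have [Cb_ sb] := one_minus_bump_subharmonic n oY cY.
    have := bump_row_le mT intT (C_snd Cb_ sb).
    have bb := @bmeas_bump R d Y Y n mY.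
    rewrite bmeas_RintegralD//; [|exact: bmeasZ|exact: bmeas_cst].
    rewrite bmeas_RintegralZ// Rintegral_prob_cst// => le2.
    have : \int[eta]_z bump Y n z <= \int[eta]_z (\1_Y z : R).
      apply: le_bmeas_Rintegral => //; first exact: bmeas_bump.
        exact: bmeas_indic.
      by move=> z _; exact: bump_indic.
    have -> : \int[eta]_z (\1_Y z : R) = fine (eta Y).
      by rewrite /Rintegral integral_indic// setIT.
    rewrite (Rintegral_law my etaE measurableT); last exact: bmeas_bump.
    by rewrite preimage_setT; lra.
  have lim1 : \int[nu]_(z in (Y : set Rd)) bump Y n z @[n --> \oo] --> (1 : R).
    have <- : \int[nu]_(z in (Y : set Rd)) (\1_Y z : R) = 1.
      rewrite -[RHS](Rintegral_prob_cst _ mY nuY); apply: eq_Rintegral => z zY.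
      by rewrite indicE zY.
    apply: (@cvg_bmeas_Rintegral _ _ _ _ _ _ _ 1) => //.
    - by move=> n; have [] := @bmeas_bump R d Y Y n mY.
    - by move=> n z _; have /andP[? ?] := bump01 Y n z; rewrite ger0_norm.
    - by move=> z _; exact: bump_cvg.
  have h1 : 1 <= fine (eta Y).
    rewrite -(cvg_lim (@Rhausdorff R) lim1); apply: limr_le; last exact: nearW.
    by apply/cvg_ex; exists 1.
  apply/eqP; rewrite eq_le probability_le1//=.
  by rewrite -[eta Y]fineK ?fin_num_measure.
have sh_y : sh_le Y eta nu.
  move=> psi Cpsi spsi; have Spsi := Cb_Sb oY Cpsi.
  have [y0 Yy0] := prob_on_neq0 nuY; have [_ [M psiM]] := Cpsi.
  rewrite !EFin_Rintegral// lee_fin.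
  (* For ratios below [1] the homothety towards [y0] sends the closure of [Y] to points of depth
     bounded below, among which [psi] is uniformly continuous. *)
  pose t n : R := dilation_ratio R n.
  have t01 n : 0 <= t n <= 1 by exact: dilation_ratio01.
  have t1 n : t n < 1 by exact: dilation_ratio_lt1.
  pose f n z := psi (t n *: z + (1 - t n) *: y0).
  have Cf n : Cb Y (f n) by exact: dilation_Cb.
  have [Sf sf] : (forall n, Sb Y (f n)) /\ forall n, subharmonic Y (f n).
    by split=> n; have [] := Sbsub_dilation oY cY Yy0 (t01 n) (conj Spsi spsi).
  have dep M' n : closure S M' ->
      (1 - t n) * depth Y y0 <= depth Y (t n *: ry M' + (1 - t n) *: y0).
    by move=> SM; apply: depth_conv => //; exact: clY.
  have dep0 n : 0 < (1 - t n) * depth Y y0.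
    by rewrite mulr_gt0 ?subr_gt0//; exact: depth_gt0.
  have inY M' n : closure S M' -> Y (t n *: ry M' + (1 - t n) *: y0).
    by move=> SM; apply: depth_in; apply: lt_le_trans (dep0 n) (dep M' n SM).
  have lip n M' N : `|t n *: ry M' + (1 - t n) *: y0 - (t n *: ry N + (1 - t n) *: y0)|
      <= 1 * `|M' - N|.
    have -> : t n *: ry M' + (1 - t n) *: y0 - (t n *: ry N + (1 - t n) *: y0) =
        t n *: (ry M' - ry N) by apply/rowP => j; rewrite !mxE; ring.
    rewrite normrZ ger0_norm; last by case/andP: (t01 n).
    by apply: ler_pM => //; [case/andP: (t01 n)|exact: ltW|exact: row_lip].
  have le n : \int[eta]_(z in (Y : set Rd)) f n z <= \int[nu]_(z in (Y : set Rd)) f n z.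
    have bfy : bmeas setT (fun u => f n (y u)).
      split; last by exists M => u _; apply/psiM/inY.
      have [mpsi _] := Spsi.
      apply: (@measurable_comp _ _ _ _ _ _ (Y : set Rd) psi) => //.
        by move=> _ [u _ <-]; exact: inY.
      exact: (measurable_lip_map mT (lip n)).
    rewrite (Rintegral_law my etaE mY (Sf n)) -(Rintegral_full _ measurableT _ _ bfy)//.
    - apply: (intT _ _ (C_snd (Cf n) (sf n))); first by have [] := bfy.
      + by exists M => M' SM; apply/psiM/inY.
      + exact: (uniform_on_comp oY bY Cpsi (dep0 n) (fun M' => @dep M' n) (lip n)).
    - by have := my measurableT Y mY; rewrite setTI.
  have cv (Q : probability Rd R) : \int[Q]_(z in (Y : set Rd)) f n z @[n --> \oo] -->
      \int[Q]_(z in (Y : set Rd)) psi z.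
    apply: (@cvg_bmeas_Rintegral _ _ _ _ _ _ _ M) => //.
    - by move=> n; have [] := Sf n.
    - by case: Spsi.
    - by move=> n z Yz; apply: psiM; exact: dilation_in.
    - by move=> z Yz; exact: (cvg_dilation oY y0 Cpsi Yz).
  by apply: (ler_cvg_to (cv eta) (cv nu)); exact: nearW.
have bc : bmeas setT (fun u => eucl2 (x u : 'rV[R]_d) (y u)).
  split; first exact: measurable_eucl2.
  by exists (4 * d%:R * B * (B + B)) => u _; apply: eucl2_le_norm => //; [exact: xB|exact: yB].
have cost_le : \int[P]_u eucl2 (x u : 'rV[R]_d) (y u) <= r.
  apply: (intT (fun M => eucl2 (rx M) (ry M))) => //.
  - by have [] := bc.
  - exists (4 * d%:R * B * (B + B)) => M SM.
    by apply: eucl2_le_norm => //; [exact: xB|exact: yB].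
  (* Two rows move at once, each by at most the norm of [M - N]; hence the factor [2]. *)
  - apply: (@uniform_on_lip _ _ _ _ _ (4 * d%:R * B * 2)) => M N SM SN.
    apply: le_trans (eucl2_lip_norm B0' _ _ _ _) _; rewrite ?xB ?yB//.
    rewrite -[leRHS]mulrA ler_wpM2l ?mulr_ge0//.
    by have := row_lip ord0 M N; have := row_lip ord_max M N; rewrite /rx /ry; lra.
apply: le_trans (T2_le mx my law_x etaE bc cost_le).
by apply: ereal_inf_lbound; exists eta.
Qed.

End attainment.

Theorem dual_below_Cb_ge : (T2_sh_below Y mu nu <= dual_below (@Cb R d) X Y mu nu)%E.
Proof.
have ub psi : Cb Y psi -> subharmonic Y psi ->
    ((\intX (Q2 Y psi) - \intY psi)%:E <= dual_below (@Cb R d) X Y mu nu)%E.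
  move=> Cpsi spsi; rewrite -dual_value; last exact: Cb_Sb.
  by apply: ereal_sup_ubound; exists psi => //; exact: Cb_Ash.
(* The potential [0] excludes the dual value [-oo]; at [+oo] the inequality is trivial. *)
have [_ s0] := Sbsub_cst 0 oY; have ub0 := ub _ (Cb_cst _ 0) s0.
case E: (dual_below _ _ _ _ _) ub ub0 => [r| |] ub ub0.
- by apply: T2_sh_below_le => psi Cpsi spsi; rewrite -lee_fin; exact: ub.
- exact: leey.
- by move: ub0; rewrite leeNy_eq.
Qed.

End sh_below.

(** * The problem above mu *)

Section sh_above.
Variables (R : realType) (d : nat) (X Y : set 'rV[R]_d).
Hypotheses (oX : open X) (oY : open Y) (bX : bounded_set X) (bY : bounded_set Y).
Hypotheses (cX : convex X) (cY : convex Y).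
Variables (mu nu : probability (Rd R d) R).
Hypotheses (muX : prob_on X mu) (nuY : prob_on Y nu).
Local Notation Rd := (Rd R d).
Local Notation "\intX f" := (\int[mu]_(x in (X : set Rd)) f x) (at level 36).
Local Notation "\intY f" := (\int[nu]_(x in (Y : set Rd)) f x) (at level 36).

Let mX := measurable_open oX.
Let mY := measurable_open oY.

Let Q2bar_Sb psi (M : R) : (forall x, X x -> `|psi x| <= M) -> Sb Y (Q2bar X psi).
Proof.
move=> psiM; have [x0 Xx0] := prob_on_neq0 muX.
have psim x : X x -> - M <= - psi x.
  by move=> /psiM; rewrite lerN2 ler_norml => /andP[].
have := Cb_Sb oY (Q2_Cb bY bX psim Xx0) => /(bmeasZ (-1)).
by apply: eq_bmeas => y _; rewrite Q2barE mulN1r.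
Qed.

Let Q2bar_ge psi (M : R) x y : (forall x, X x -> `|psi x| <= M) -> X x ->
  psi x - eucl2 x y <= Q2bar X psi y.
Proof.
move=> psiM Xx; have psim x' : X x' -> - M <= - psi x'.
  by move=> /psiM; rewrite lerN2 ler_norml => /andP[].
by rewrite Q2barE eucl2C; have := Q2_le psim y Xx; lra.
Qed.

Let Q2bar_le psi y (c : R) : (forall x, X x -> psi x - eucl2 x y <= c) ->
  Q2bar X psi y <= c.
Proof.
move=> H; have [x0 Xx0] := prob_on_neq0 muX.
rewrite Q2barE lerNl; apply: (Q2_ge Xx0) => x Xx.
by have := H x Xx; rewrite eucl2C; lra.
Qed.

Let dual_value psi : Sb X psi ->
  (\int[mu]_(x in (X : set Rd)) (psi x)%:E -
   \int[nu]_(y in (Y : set Rd)) (Q2bar X psi y)%:E)%E =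
  (\intX psi - \intY (Q2bar X psi))%:E.
Proof.
move=> Spsi; have [_ [M psiM]] := Spsi.
by rewrite !EFin_Rintegral//; exact: Q2bar_Sb psiM.
Qed.

Lemma dual_above_Sb_le : (dual_above (@Sb R d) X Y mu nu <= T2_sh_above X mu nu)%E.
Proof.
apply: ge_ereal_sup => _ [psi [Spsi [hpsi _]] <-]; have [_ [M psiM]] := Spsi.
rewrite dual_value//; apply: le_ereal_inf_tmp => _ [xi [xiX muxi] <-].
have h := sh_le_Sbsub oX cX bX muX muxi (conj Spsi hpsi).
apply: le_trans (weak_duality oX oY bX bY xiX nuY Spsi (Q2bar_Sb psiM) _); last first.
  by move=> x y Xx Yy; have := Q2bar_ge y psiM Xx; lra.
by rewrite lee_fin lerB.
Qed.

Lemma dual_above_Cb_le : (dual_above (@Cb R d) X Y mu nu <= dual_above (@Sb R d) X Y mu nu)%E.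
Proof.
apply: le_ereal_sup => _ [psi [Cpsi hpsi] <-]; exists psi => //.
by split=> //; exact: Cb_Sb.
Qed.

Section attainment.
Variable r : R.
Hypothesis dual_le : forall psi, Cb X psi -> subharmonic X psi ->
  \intX psi - \intY (Q2bar X psi) <= r.

Let i1 : 'I_3 := Ordinal (isT : (1 < 3)%N).
Let rx (M : 'M[R]_(3, d)) : 'rV[R]_d := row ord0 M.
Let rz (M : 'M[R]_(3, d)) : 'rV[R]_d := row i1 M.
Let ry (M : 'M[R]_(3, d)) : 'rV[R]_d := row ord_max M.
Let S : set 'M[R]_(3, d) := [set M | [/\ X (rx M), X (rz M) & Y (ry M)]].

Let mk (x z y : 'rV[R]_d) : 'M[R]_(3, d) :=
  \matrix_(i, j) (if i == ord0 then x else if i == i1 then z else y) ord0 j.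

Let rx_mk x z y : rx (mk x z y) = x.
Proof. by apply/rowP => j; rewrite !mxE. Qed.

Let rz_mk x z y : rz (mk x z y) = z.
Proof. by apply/rowP => j; rewrite !mxE. Qed.

Let ry_mk x z y : ry (mk x z y) = y.
Proof. by apply/rowP => j; rewrite !mxE. Qed.

(* The coupling of [mu] with the law of [z] is tested fibrewise, against [b x]
   subharmonic for each [x]. This makes [x |-> t z + (1 - t) x] a legitimate
   competitor: it moves the mass that [z] puts on the boundary back into [X]
   without losing the order above [mu]. *)
Let fibre (b : 'rV[R]_d -> 'rV[R]_d -> R) :=
  [/\ forall x, X x -> Sbsub X (b x),
      exists M : R, forall x z, X x -> X z -> `|b x z| <= M &
      Sb X (fun x => b x x)].

(** Pricing [- b x z] at minus the integral of the diagonal forces the expectation of [b x z] to be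
    at least the [mu]-integral of [b x x]: an integrated form of the statement that the law of [z]
    given [x] dominates the point mass at [x]. *)
Let C (f : 'M[R]_(3, d) -> R) (v : R) := exists a b t,
  [/\ bmeas setT (a : Rd -> R), fibre b, 0 <= t,
   (forall M, f M = a (ry M) - b (rx M) (rz M) + t * eucl2 (rz M) (ry M)) &
   v = \int[nu]_y a y - \intX (fun x => b x x) + t * r].

Let CD f v g w : C f v -> C g w -> C (fun x => f x + g x) (v + w).
Proof.
move=> [a [b [t [ma [sb [N bN] db] t0 fE ->]]]] [a' [b' [t' [ma' [sb' [N' bN'] db'] t'0 gE ->]]]].
exists (fun x => a x + a' x), (fun x z => b x z + b' x z), (t + t'); split.
- exact: bmeasD.
- split.
  + by move=> x Xx; apply: Sbsub_sumof => //; [exact: sb|exact: sb'].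
  + exists (N + N') => x z Xx Xz.
    by rewrite (le_trans (ler_normD _ _))// lerD ?bN ?bN'.
  + exact: bmeasD.
- exact: addr_ge0.
- by move=> M; rewrite fE gE; ring.
- by rewrite bmeas_RintegralD// bmeas_RintegralD//; ring.
Qed.

Let CZ (c : R) f v : 0 <= c -> C f v -> C (fun x => c * f x) (c * v).
Proof.
move=> c0 [a [b [t [ma [sb [N bN] db] t0 fE ->]]]].
exists (fun x => c * a x), (fun x z => c * b x z), (c * t); split.
- exact: bmeasZ.
- split.
  + by move=> x Xx; apply: Sbsub_scale => //; exact: sb.
  + by exists (`|c| * N) => x z Xx Xz; rewrite normrM ler_wpM2l ?bN.
  + exact: bmeasZ.
- exact: mulr_ge0.
- by move=> M; rewrite fE; ring.
- by rewrite bmeas_RintegralZ// bmeas_RintegralZ//; ring.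
Qed.

Let fibre_fst (a : 'rV[R]_d -> R) : bmeas setT (a : Rd -> R) -> fibre (fun x _ => a x).
Proof.
move=> ba; have [_ [M aM]] := ba; split.
- by move=> x _; exact: Sbsub_cst.
- by exists M => x z _ _; exact: aM.
- exact: (bmeasS measurableT).
Qed.

Let fibre0 : fibre (fun _ _ => 0).
Proof. exact: (fibre_fst (bmeas_cst setT 0)). Qed.

Let C_fibre b : fibre b -> C (fun M => - b (rx M) (rz M)) (- \intX (fun x => b x x)).
Proof.
move=> fb; exists (fun=> 0), b, 0; split=> //; first exact: bmeas_cst.
- by move=> M; ring.
- by rewrite Rintegral_prob_cst// ?setCT ?measure0//; ring.
Qed.

(** A function of [x] alone is constant on each fibre, hence subharmonic there with either sign; so
    the law of [x] is pinned to [mu]. *)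
Let C_fst a : bmeas setT (a : Rd -> R) -> C (fun M => a (rx M)) (\int[mu]_x a x).
Proof.
move=> ba; have bNa := bmeasZ (-1) ba.
have := C_fibre (fibre_fst bNa).
have Sa : Sb X a by exact: (bmeasS measurableT).
rewrite bmeas_RintegralZ// mulN1r opprK -(Rintegral_full mX measurableT _ muX ba)//.
have -> // : (fun M => - (-1 * a (rx M))) = fun M => a (rx M).
by apply/funext => M; ring.
Qed.

Let C_lst a : bmeas setT (a : Rd -> R) -> C (fun M => a (ry M)) (\int[nu]_x a x).
Proof.
move=> ba; exists a, (fun _ _ => 0), 0; split=> //.
- by move=> M; ring.
- by rewrite Rintegral_prob_cst//; ring.
Qed.

Let C_cst (c : R) : C (fun=> c) c.
Proof.
rewrite -{2}(@Rintegral_prob_cst _ _ _ mu setT c)// ?setCT ?measure0//.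
exact: (C_fst (bmeas_cst setT c)).
Qed.

Let C_cost : C (fun M => eucl2 (rz M) (ry M)) r.
Proof.
exists (fun=> 0), (fun _ _ => 0), 1; split=> //; first exact: bmeas_cst.
- by move=> M; ring.
- by rewrite !Rintegral_prob_cst// ?setCT ?measure0//; ring.
Qed.

(* The supremum over the base point [x] of the functions [b x] is dominated by
   the cost; its regularization is an admissible dual potential. *)
Let C_pos f v : C f v -> (forall w, S w -> 0 <= f w) -> 0 <= v.
Proof.
move=> [a [b [t [ma [sb [N bN] db] t0 fE ->]]]] f0.
have {}f0 x z y : X x -> X z -> Y y -> 0 <= a y - b x z + t * eucl2 z y.
  move=> Xx Xz Yy; have := f0 (mk x z y); rewrite fE rx_mk rz_mk ry_mk; apply.
  by rewrite /S /= rx_mk rz_mk ry_mk.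
have Sa : Sb Y a by exact: (bmeasS measurableT).
rewrite (Rintegral_full mY measurableT _ nuY ma)//.
(* Without the cost, choosing [z = x] leaves an inequality between the diagonal of [b] and [a]. *)
move: t0; rewrite le_eqVlt => /predU1P[t0|t0].
  rewrite -t0 mul0r addr0.
  have := @Rintegral_sum_ge0 R d X Y oX oY mu nu muX nuY (fun x => -1 * b x x) a
    (bmeasZ (-1) db) Sa.
  rewrite bmeas_RintegralZ// => H; rewrite addrC -mulN1r; apply: H => x y Xx Yy.
  by have := f0 x x y Xx Xx Yy; rewrite -t0; lra.
have [x0 Xx0] := prob_on_neq0 muX.
have [B B0 [XB YB]] := bounded_norm2 bX bY; have B0' := ltW B0.
pose K := 4 * d%:R * B; have K0 : 0 <= K by rewrite !mulr_ge0.
have ti0 : 0 < t^-1 by rewrite invr_gt0.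
pose I := {x | X x}; pose b' (i : I) z := t^-1 * b (sval i) z.
pose i0 : I := exist _ x0 Xx0.
pose M := t^-1 * `|N|.
have b'M (i : I) z : X z -> `|b' i z| <= M.
  move=> Xz; rewrite /b' normrM gtr0_norm// ler_wpM2l//; first exact: ltW.
  by rewrite (le_trans (bN _ _ (svalP i) Xz))// ler_norm.
have sb' i : Sbsub X (b' i).
  by apply: Sbsub_scale => //; [exact: ltW|exact: sb (svalP i)].
(* The regularization at penalty [k] shifts points by at most [2 * M / k * (2 * B)], and the cost
   varies by at most [K] times the shift; this is the error term. *)
have key (k : R) : 0 < k ->
    t^-1 * \intX (fun x => b x x) - t^-1 * \intY a <= r + K * (2 * M / k * (2 * B)).
  move=> k0; pose psi := sup_regularization X b' k.
  have Cpsi : Cb X psi by exact: (sup_regularization_Cb oX cX i0 b'M k0).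
  have spsi : subharmonic X psi by exact: (sup_regularization_subharmonic oX cX i0 b'M k0 sb').
  have psiM x : X x -> `|psi x| <= M by exact: (sup_regularization_bounded cX i0 b'M k0).
  set e := K * _.
  have le_psi z y : X z -> Y y -> psi z <= t^-1 * a y + e + eucl2 z y.
    move=> Xz Yy; apply: (@sup_regularization_upper R d X cX I i0 b' M k b'M k0 z _ (2 * B)) => //.
      by move=> u Xu; rewrite (le_trans (ler_normB _ _))//; have := XB _ Xz; have := XB _ Xu; lra.
    move=> i u Xu uz.
    have h1 : b' i u <= t^-1 * a y + eucl2 u y.
      have := f0 _ u y (svalP i) Xu Yy => /(ler_wpM2l (ltW ti0)).
      by rewrite mulr0 /b' mulrDr mulrBr (mulrA _ t) mulVf ?gt_eqF// mul1r; lra.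
    have := eucl2_lip_norm B0' (XB _ Xu) (YB _ Yy) (XB _ Xz) (YB _ Yy).
    rewrite subrr normr0 addr0 -/K ler_norml => /andP[_ h2].
    have : K * `|u - z| <= e by rewrite ler_wpM2l.
    by lra.
  have h1 : \intY (Q2bar X psi) <= t^-1 * \intY a + e.
    rewrite -(Rintegral_prob_cst e mY nuY) -bmeas_RintegralZ// -bmeas_RintegralD//; last 2 first.
    - exact: bmeasZ.
    - exact: bmeas_cst.
    apply: le_bmeas_Rintegral => //; first exact: Q2bar_Sb psiM.
      by apply: bmeasD; [exact: bmeasZ|exact: bmeas_cst].
    move=> y Yy; apply: Q2bar_le => x Xx.
    by have := le_psi x y Xx Yy; lra.
  have h2 : t^-1 * \intX (fun x => b x x) <= \intX psi.
    rewrite -bmeas_RintegralZ//; apply: le_bmeas_Rintegral => //; first exact: bmeasZ.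
      exact: Cb_Sb.
    move=> x Xx; exact: (sup_regularization_ge cX i0 b'M k0 (exist _ x Xx)).
  by have := dual_le Cpsi spsi; lra.
have : t^-1 * \intX (fun x => b x x) - t^-1 * \intY a <= r.
  apply/ler_addgt0Pr => e e0.
  pose A := K * (2 * M * (2 * B)).
  have A0 : 0 <= A by rewrite !mulr_ge0//; exact: ltW.
  (* With this penalty the error is [A * e / (A + 1)], hence at most [e], including when [A = 0]. *)
  have k0 : 0 < (A + 1) / e by rewrite divr_gt0// ltr_wpDl.
  apply: le_trans (key _ k0) _; rewrite lerD2l.
  have -> : K * (2 * M / ((A + 1) / e) * (2 * B)) = A * e / (A + 1).
    rewrite /A; field; apply/andP; split; last by rewrite gt_eqF.
    by rewrite gt_eqF// -/A ltr_wpDl.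
  by rewrite ler_pdivrMr ?ltr_wpDl// mulrDr mulr1 mulrC lerDl ltW.
rewrite -(ler_pM2l t0) mulrBr !mulrA mulfV ?gt_eqF// !mul1r; lra.
Qed.

Lemma T2_sh_above_le : (T2_sh_above X mu nu <= r%:E)%E.
Proof.
have [B B0 [XB YB]] := bounded_norm2 bX bY; have B0' := ltW B0.
pose K := 4 * d%:R * B; have K0 : 0 <= K by rewrite !mulr_ge0.
have SB M : S M -> forall i j, `|M i j| <= B.
  move=> [Xx Xz Yy] i j.
  have h (l : 'I_3) : i = l -> `|row l M| <= B -> `|M i j| <= B.
    by move=> -> lB; apply: le_trans lB; have := coord_le_norm (row l M) j; rewrite mxE.
  have [iE|iE|iE] : [\/ i = ord0, i = i1 | i = ord_max].
    by case: i {h} => -[|[|[|//]]] ii;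
      [apply: Or31|apply: Or32|apply: Or33]; exact: val_inj.
  - by apply: (h ord0) => //; exact: XB.
  - by apply: (h i1) => //; exact: XB.
  - by apply: (h ord_max) => //; exact: YB.
have [dO [Om [P [T [mT clT intT]]]]] := representing_matrix SB CD CZ C_cst C_pos.
pose x u : Rd := rx (T u); pose z u : Rd := rz (T u); pose y u : Rd := ry (T u).
have mx : measurable_fun setT x by exact: measurable_row.
have my : measurable_fun setT y by exact: measurable_row.
have clX M : closure S M -> closure X (rx M) by apply: closure_row => N [].
have clZ M : closure S M -> closure X (rz M) by apply: closure_row => N [].
have clY M : closure S M -> closure Y (ry M) by apply: closure_row => N [].
have xB M : closure S M -> `|rx M| <= B by move=> /clX; exact: closure_norm_le.
have zB M : closure S M -> `|rz M| <= B by move=> /clZ; exact: closure_norm_le.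
have yB M : closure S M -> `|ry M| <= B by move=> /clY; exact: closure_norm_le.
have law_x A : measurable A -> mu A = P (x @^-1` A).
  exact: (law_row mT intT C_fst).
have law_y A : measurable A -> nu A = P (y @^-1` A).
  exact: (law_row mT intT C_lst).
pose D : set Om := x @^-1` (X : set Rd).
have mD : measurable D by have := mx measurableT X mX; rewrite setTI.
have PD : P (~` D) = 0%E by have := law_x _ (measurableC mX); rewrite [LHS]muX.
have bc : bmeas setT (fun u => eucl2 (z u : 'rV[R]_d) (y u)).
  split; first by apply: measurable_eucl2; exact: measurable_row.
  by exists (K * (B + B)) => u _; apply: eucl2_le_norm => //; [exact: zB|exact: yB].
have cost_le : \int[P]_u eucl2 (z u : 'rV[R]_d) (y u) <= r.
  apply: (intT (fun M => eucl2 (rz M) (ry M))) => //.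
  - by have [] := bc.
  - exists (K * (B + B)) => M SM.
    by apply: eucl2_le_norm => //; [exact: zB|exact: yB].
  - apply: (@uniform_on_lip _ _ _ _ _ (K * 2)) => M N SM SN.
    apply: le_trans (eucl2_lip_norm B0' _ _ _ _) _; rewrite ?zB ?yB//.
    rewrite -[leRHS]mulrA ler_wpM2l//.
    by have := row_lip i1 M N; have := row_lip ord_max M N; rewrite /rz /ry; lra.
have [x0 Xx0] := prob_on_neq0 muX.
have x0gt0 := depth_gt0 oX Xx0.
suff main n : (T2_sh_above X mu nu <= (r + K * (2 * B) * n.+1%:R^-1)%:E)%E.
  apply/lee_addgt0Pr => e e0.
  have A0 : 0 < K * (2 * B) + 1 by rewrite ltr_wpDl// !mulr_ge0.
  have [N NH] := inv_succ_lt (divr_gt0 e0 A0).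
  apply: le_trans (main N) _; rewrite -EFinD lee_fin lerD2l.
  have := NH N (leqnn N); rewrite ltr_pdivlMr//.
  have : 0 < N.+1%:R^-1 :> R by rewrite invr_gt0.
  by move: (N.+1%:R^-1) => c; rewrite mulrDr mulr1 mulrC; lra.
have [t [tE t01 t1]] : exists t : R, [/\ 1 - t = n.+1%:R^-1, 0 <= t <= 1 & t < 1].
  exists (dilation_ratio R n); split.
  - by rewrite /dilation_ratio opprB addrC subrK.
  - exact: dilation_ratio01.
  - exact: dilation_ratio_lt1.
have [t0 _] := andP t01.
pose wm (M : 'M[R]_(3, d)) := t *: rz M + (1 - t) *: rx M.
pose w u : Rd := wm (T u).
have wm_lip M N : `|wm M - wm N| <= 1 * `|M - N|.
  have -> : wm M - wm N = t *: (rz M - rz N) + (1 - t) *: (rx M - rx N).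
    by apply/rowP => j; rewrite !mxE; ring.
  rewrite (le_trans (ler_normD _ _))// !normrZ !ger0_norm ?subr_ge0 ?(ltW t1)//.
  have : t * `|rz M - rz N| <= t * `|M - N| by rewrite ler_wpM2l//; exact: row_lip.
  have : (1 - t) * `|rx M - rx N| <= (1 - t) * `|M - N|.
    by rewrite ler_wpM2l ?subr_ge0 ?(ltW t1)//; exact: row_lip.
  by rewrite mulrBl; lra.
have mw : measurable_fun setT w by exact: (measurable_lip_map mT wm_lip).
pose wf : {mfun Om >-> Rd} := HB.pack w (isMeasurableFun.Build _ _ _ _ _ mw).
pose xi : probability Rd R := distribution P wf.
have xiE A : measurable A -> xi A = P (w @^-1` A) by [].
(* On [D] the point [x] is interior and has weight [1 - t > 0], so [w] is interior wherever [z] lies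
   in the closure. *)
have Dw : D `<=` w @^-1` (X : set Rd).
  move=> u Du; apply: (@depth_in R d X).
  apply: lt_le_trans (depth_conv (rx (T u)) cX (clZ _ (clT u)) t01).
  by rewrite mulr_gt0 ?subr_gt0//; exact: depth_gt0.
have mwX : measurable (w @^-1` (X : set Rd)).
  by have := mw measurableT X mX; rewrite setTI.
have xiX : prob_on X xi.
  rewrite /prob_on xiE; last exact: measurableC.
  apply: (subset_measure0 _ _ _ PD); [|exact: measurableC|].
    by rewrite preimage_setC; exact: measurableC.
  by rewrite preimage_setC; exact: subsetC.
have sh_x : sh_le X mu xi.
  move=> psi Cpsi spsi; have Spsi := Cb_Sb oX Cpsi; have [mpsi _] := Spsi.
  have [_ [N psiN]] := Cpsi; rewrite !EFin_Rintegral// lee_fin.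
  pose s m : R := dilation_ratio R m.
  have s01 m : 0 <= s m <= 1 by exact: dilation_ratio01.
  have s1 m : s m < 1 by exact: dilation_ratio_lt1.
  have sE m : 1 - s m = m.+1%:R^-1 by rewrite /s /dilation_ratio opprB addrC subrK.
  (* On the closure of [S] the point [x] too may touch the boundary. Pulling it towards [x0] gives a
     depth bound uniform over the closure, hence the uniform continuity required of test functions;
     the pull vanishes as [m] grows. *)
  pose p m v := s m *: v + (1 - s m) *: x0.
  have pX m v : X v -> X (p m v) by move=> Xv; exact: dilation_in.
  pose b m v v' := psi (t *: v' + (1 - t) *: p m v).
  have shiftE m v v' : t *: v' + (1 - t) *: p m v =
      t *: v' + (1 - t) *: v + m.+1%:R^-1 *: ((1 - t) *: (x0 - v)).
    by rewrite -sE /p; apply/rowP => j; rewrite !mxE; ring.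
  have fb m : fibre (b m).
    split.
    - by move=> v Xv; apply: Sbsub_dilation => //; exact: pX.
    - by exists N => v v' Xv Xv'; apply: psiN; apply: dilation_in => //; exact: pX.
    (* On the diagonal the two contractions compose to the homothety towards [x0] of ratio
       [t + (1 - t) * s m]. *)
    - have tau01 : 0 <= t + (1 - t) * s m <= 1.
        have /andP[a0 a1] := s01 m.
        have : (1 - t) * s m <= 1 - t by rewrite ler_piMr// subr_ge0 ltW.
        have : 0 <= (1 - t) * s m by rewrite mulr_ge0// subr_ge0 ltW.
        by move=> *; apply/andP; split; lra.
      apply: (eq_bmeas _ (dilation_bmeas oX cX Xx0 tau01 Spsi)) => v _.
      by rewrite /b /p; congr psi; apply/rowP => j; rewrite !mxE; ring.
  pose phi m (M' : 'M[R]_(3, d)) := t *: rz M' + (1 - t) *: p m (rx M').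
  have dep0 m : 0 < (1 - t) * ((1 - s m) * depth X x0).
    by rewrite !mulr_gt0 ?subr_gt0.
  have dep m M' : closure S M' ->
      (1 - t) * ((1 - s m) * depth X x0) <= depth X (phi m M').
    move=> SM; apply: le_trans (depth_conv _ cX (clZ _ SM) t01).
    rewrite ler_wpM2l ?subr_ge0 ?(ltW t1)//.
    exact: (depth_conv _ cX (clX _ SM) (s01 m)).
  have inX m M' : closure S M' -> X (phi m M').
    by move=> SM; apply: depth_in; apply: lt_le_trans (dep0 m) (dep m M' SM).
  have lip m M' N' : `|phi m M' - phi m N'| <= 2 * `|M' - N'|.
    have -> : phi m M' - phi m N' =
        t *: (rz M' - rz N') + ((1 - t) * s m) *: (rx M' - rx N').
      by rewrite /phi /p; apply/rowP => j; rewrite !mxE; ring.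
    have /andP[a0 a1] := s01 m.
    have c0 : 0 <= (1 - t) * s m by rewrite mulr_ge0// subr_ge0 ltW.
    have c1 : (1 - t) * s m <= 1 by rewrite mulr_ile1// ?subr_ge0 ?(ltW t1)//; lra.
    rewrite (le_trans (ler_normD _ _))// (normrZ t) (normrZ ((1 - t) * s m)).
    rewrite (ger0_norm t0) (ger0_norm c0).
    have : t * `|rz M' - rz N'| <= 1 * `|M' - N'|.
      by apply: ler_pM => //; [exact: ltW|exact: row_lip].
    have : (1 - t) * s m * `|rx M' - rx N'| <= 1 * `|M' - N'|.
      by apply: ler_pM => //; exact: row_lip.
    by lra.
  have bb m : bmeas setT (fun u => b m (x u) (z u)).
    split; last by exists N => u _; exact/psiN/inX.
    apply: (@measurable_comp _ _ _ _ _ _ (X : set Rd) psi) => //.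
      by move=> _ [u _ <-]; exact: inX.
    exact: (measurable_lip_map mT (lip m)).
  have le m : \intX (fun v => b m v v) <= \int[P]_(u in D) b m (x u) (z u).
    have NE : (fun u => - b m (x u) (z u)) = fun u => -1 * b m (x u) (z u).
      by apply/funext => u; rewrite mulN1r.
    rewrite -(Rintegral_full mD measurableT _ PD (bb m))// -lerN2.
    have -> : - (\int[P]_u b m (x u) (z u)) = \int[P]_u (- b m (x u) (z u)).
      by rewrite NE bmeas_RintegralZ// mulN1r.
    apply: (intT _ _ (C_fibre (fb m))).
    - have [mb _] := bmeasZ (-1) (bb m).
      by rewrite (_ : _ \o _ = fun u => -1 * b m (x u) (z u)).
    - by exists N => M' SM; rewrite normrN; exact/psiN/inX.
    - move=> e e0.
      have [delta d0 dH] := uniform_on_comp oX bX Cpsi (dep0 m) (dep m) (lip m) e0.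
      exists delta => // M' N' SM SN MN.
      by rewrite -opprD normrN; exact: dH.
  have cvL : \intX (fun v => b m v v) @[m --> \oo] --> \intX psi.
    apply: (@cvg_bmeas_Rintegral _ _ _ _ _ _ _ N) => //.
    - by move=> m; have [_ _ []] := fb m.
    - by move=> m v Xv; apply: psiN; apply: dilation_in => //; exact: pX.
    - move=> v Xv; have := cvg_shift oX ((1 - t) *: (x0 - v)) Cpsi Xv.
      rewrite (_ : (fun m => b m v v) =
        fun m => psi (v + m.+1%:R^-1 *: ((1 - t) *: (x0 - v))))//.
      apply/funext => m; rewrite /b shiftE; congr psi; congr (_ + _).
      by rewrite -scalerDl addrC subrK scale1r.
  (* The limit is taken on [D], where [w] lies in [X] and [psi] is continuous at it. *)
  have cvR : \int[P]_(u in D) b m (x u) (z u) @[m --> \oo] --> \int[P]_(u in D) psi (w u).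
    apply: (@cvg_bmeas_Rintegral _ _ _ _ _ _ _ N) => //.
    - by move=> m; have [mb _] := bb m; exact: measurable_funTS.
    - apply: (@measurable_comp _ _ _ _ _ _ (X : set Rd) psi) => //.
        by move=> _ [u Du <-]; exact: Dw.
      exact: measurable_funTS.
    - by move=> m u _; exact/psiN/inX.
    - move=> u Du; have := cvg_shift oX ((1 - t) *: (x0 - rx (T u))) Cpsi (Dw u Du).
      rewrite (_ : (fun m => b m (x u) (z u)) =
        fun m => psi (w u + m.+1%:R^-1 *: ((1 - t) *: (x0 - rx (T u)))))//.
      by apply/funext => m; rewrite /b shiftE.
  have bw : bmeas (w @^-1` (X : set Rd)) (fun u => psi (w u)).
    split; last by exists N => u; exact: psiN.
    apply: (@measurable_comp _ _ _ _ _ _ (X : set Rd) psi) => //.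
      by move=> _ [u Du <-].
    exact: measurable_funTS.
  rewrite (Rintegral_law mw xiE mX Spsi) (Rintegral_full mD mwX Dw PD bw).
  by apply: (ler_cvg_to cvL cvR); exact: nearW.
have wB u : `|w u| <= B.
  rewrite /w /wm (le_trans (ler_normD _ _))// !normrZ !ger0_norm ?subr_ge0 ?(ltW t1)//.
  have : t * `|rz (T u)| <= t * B by rewrite ler_wpM2l//; exact: zB.
  have : (1 - t) * `|rx (T u)| <= (1 - t) * B.
    by rewrite ler_wpM2l ?subr_ge0 ?(ltW t1)//; exact: xB.
  by rewrite mulrBl; lra.
have bcw : bmeas setT (fun u => eucl2 (w u : 'rV[R]_d) (y u)).
  split; first exact: measurable_eucl2.
  by exists (K * (B + B)) => u _; apply: eucl2_le_norm => //; exact: yB.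
apply: (@le_trans _ _ (T2 xi nu)); first by apply: ereal_inf_lbound; exists xi.
apply: (T2_le mw my xiE law_y bcw).
pose e := K * (2 * B) * n.+1%:R^-1.
have -> : r + K * (2 * B) / n.+1%:R = r + e by [].
apply: (@le_trans _ _ (\int[P]_u (eucl2 (z u : 'rV[R]_d) (y u) + e))); last first.
  rewrite bmeas_RintegralD//; last exact: bmeas_cst.
  by rewrite Rintegral_prob_cst// ?setCT ?measure0// lerD2r.
apply: le_bmeas_Rintegral => //; first by apply: bmeasD => //; exact: bmeas_cst.
move=> u _; have := eucl2_lip_norm B0' (wB u) (yB _ (clT u)) (zB _ (clT u)) (yB _ (clT u)).
rewrite subrr normr0 addr0 -/K ler_norml => /andP[_ h].
(* The difference of [w] and [z] is [(1 - t) (x - z)], of norm at most [2 * B / n.+1]. *)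
have : K * `|w u - rz (T u)| <= e.
  rewrite /e -mulrA ler_wpM2l//.
  have -> : w u - rz (T u) = n.+1%:R^-1 *: (rx (T u) - rz (T u)).
    by rewrite -tE /w /wm; apply/rowP => j; rewrite !mxE; ring.
  rewrite normrZ ger0_norm ?invr_ge0// mulrC ler_wpM2r ?invr_ge0//.
  rewrite (le_trans (ler_normB _ _))//.
  by have := xB _ (clT u); have := zB _ (clT u); lra.
by rewrite /z /y; lra.
Qed.

End attainment.

Theorem dual_above_Cb_ge : (T2_sh_above X mu nu <= dual_above (@Cb R d) X Y mu nu)%E.
Proof.
have ub psi : Cb X psi -> subharmonic X psi ->
    ((\intX psi - \intY (Q2bar X psi))%:E <= dual_above (@Cb R d) X Y mu nu)%E.
  move=> Cpsi spsi; rewrite -dual_value; last exact: Cb_Sb.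
  by apply: ereal_sup_ubound; exists psi => //; exact: Cb_Ash.
have [_ s0] := Sbsub_cst 0 oX; have ub0 := ub _ (Cb_cst _ 0) s0.
case E: (dual_above _ _ _ _ _) ub ub0 => [r| |] ub ub0.
- by apply: T2_sh_above_le => psi Cpsi spsi; rewrite -lee_fin; exact: ub.
- exact: leey.
- by move: ub0; rewrite leeNy_eq.
Qed.

End sh_above.

(** * Both dualities, for continuous and for bounded measurable potentials *)

Unset Implicit Arguments.

Theorem mainTheorem15 (R : realType) (d : nat) (hd : (0 < d)%N)
  (X Y : set 'rV[R]_d)
  (oX : open X) (oY : open Y) (bX : bounded_set X) (bY : bounded_set Y)
  (cX : convex X) (cY : convex Y)
  (mu nu : probability (Rd R d) R) (muX : prob_on X mu) (nuY : prob_on Y nu) :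
  (T2_sh_below Y mu nu = dual_below (@Cb R d) X Y mu nu /\
   T2_sh_below Y mu nu = dual_below (@Sb R d) X Y mu nu) /\
  (T2_sh_above X mu nu = dual_above (@Cb R d) X Y mu nu /\
   T2_sh_above X mu nu = dual_above (@Sb R d) X Y mu nu).
Proof.
(* Sandwich: a value between the [Cb] dual and the primal equals the primal, since the primal is at
   most the [Cb] dual. *)
have belowE C : (dual_below (@Cb R d) X Y mu nu <= C)%E ->
    (C <= T2_sh_below Y mu nu)%E -> T2_sh_below Y mu nu = C.
  move=> CbC Cle; apply/eqP; rewrite eq_le Cle andbT.
  by apply: le_trans CbC; exact: dual_below_Cb_ge.
have aboveE C : (dual_above (@Cb R d) X Y mu nu <= C)%E ->
    (C <= T2_sh_above X mu nu)%E -> T2_sh_above X mu nu = C.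
  move=> CbC Cle; apply/eqP; rewrite eq_le Cle andbT.
  by apply: le_trans CbC; exact: dual_above_Cb_ge.
have belowCb := dual_below_Cb_le X oY mu nu.
have aboveCb := dual_above_Cb_le Y oX mu nu.
have belowSb := dual_below_Sb_le oX oY bX bY cY muX nuY.
have aboveSb := dual_above_Sb_le oX oY bX bY cX muX nuY.
split; split; [apply: belowE|apply: belowE|apply: aboveE|apply: aboveE] => //.
- exact: le_trans belowCb belowSb.
- exact: le_trans aboveCb aboveSb.
Qed.
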